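(* Let $k\ge-4$ be an integer and let $\mathcal S$ be a nonlocal symmetry of the Gibbons–Tsarev equation in the covering $\tau_*$ which is polynomial in all variables and homogeneous of weight $k$. Then $\mathcal S=c\,S^{(k)}$ for some constant $c\in\mathbb R$.
   Context: The Gibbons–Tsarev equation is $z_{yy}+z_xz_{xy}-z_yz_{xx}+1=0$, with internal coordinates $x,y,z_X$ ($z_X=\partial^{a+b}z/\partial x^a\partial y^b$ for $X=x^ay^b$, $b\in\{0,1\}$) and total derivatives $D_x,D_y$. Let $\sigma_0=1$ and $\sigma_m=\sum_{0\le j\le m-j}\binom{m-j}{j}z_x^{m-2j}z_y^j$. Put $\psi^{(1)}=y$, $\psi^{(2)}=x$, $\psi^{(3)}=z-\tfrac12y^2$, and for $k\ge2$ let $X^{(k)}=\sigma_{k-2}-\sum_{i=1}^{k-3}i\,\sigma_{k-i-3}\psi^{(i)}$, and for $k\ge3$ let $Y^{(k)}=z_yX^{(k-1)}-(k-2)\psi^{(k-2)}$. The covering $\tau_*$ has coordinates $x,y,z_X$ and new coordinates $\psi^{(k)}$, $k\ge4$, with total derivatives $D^{( * )}_x=D_x+\sum_{k\ge4}X^{(k)}\partial/\partial\psi^{(k)}$, $D^{( * )}_y=D_y+\sum_{k\ge4}Y^{(k)}\partial/\partial\psi^{(k)}$. A nonlocal symmetry in $\tau_*$ is a vector field on this space without $\partial/\partial x,\partial/\partial y$ components commuting with $D^{( * )}_x$ and $D^{( * )}_y$. Weights: $\mathrm{wt}\,x=3$, $\mathrm{wt}\,y=2$, $\mathrm{wt}\,z_{x^ay^b}=4-3a-2b$,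 $\mathrm{wt}\,\psi^{(j)}=j+1$, extended additively to monomials; a vector field $\sum_q c_q\,\partial/\partial q$ ($q$ running over coordinates) is polynomial of weight $k$ if each $c_q$ is a weighted-homogeneous polynomial in the coordinates of weight $\mathrm{wt}\,q+k$. The symmetries $S^{(k)}$: let $\varphi(\lambda)=1/\lambda+\sum_{j\ge1}\varphi^{(j)}\lambda^j$ and $\psi(\mu)=\mu+\sum_{j\ge1}\psi^{(j)}\mu^{-j}$, and relate the coordinates $\varphi^{(j)}$ and $\psi^{(j)}$ (each a polynomial in the others of the same index range) by the formal identity $\psi(\varphi(\lambda))=1/\lambda$; then $\varphi^{(1)}=-y$, $\varphi^{(2)}=-x$, $\varphi^{(3)}=-z-\tfrac12y^2$, and in the coordinates $\varphi^{(j)}$ the total derivatives satisfy $(\varphi^2-z_x\varphi-z_y)\varphi_x=-1$, $(\varphi^2-z_x\varphi-z_y)\varphi_y=-(\varphi-z_x)$ coefficientwise in $\lambda$ (with $\varphi_x=\sum_j D^{( * )}_x(\varphi^{(j)})\lambda^j$, etc.). For $n\in\mathbb Z$ let $f_n=\mathfrak P_\varphi(\lambda^n\varphi_\lambda)=\sum_{i\ge1}f^{(i)}\lambda^i$, where, with $\varphi_\lambda=d\varphi/d\lambda$, $\mathfrak P_\varphi F=F-\sum_{j=0}^m c_j\varphi^j$ if $F=\sum_{j\le m}c_j\varphi(\lambda)^j$ is the unique expansion of the Laurent series $F$ in powers of $\varphi(\lambda)$ with $\lambda$-independent coefficients $c_j$. Then $S^{(k)}$ is the vector field $\sum_X\tilde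 D_X(Z)\partial/\partial z_X+(\text{components on the nonlocal coordinates})$ with $\tilde D_X$ compositions of total derivatives, generating function $Z=(z_y+y)f^{(1)}+z_xf^{(2)}-f^{(3)}$ for $n=1-k$, and $\varphi^{(j)}$-components $f^{(j)}+f^{(2)}D^{( * )}_x\varphi^{(j)}+f^{(1)}D^{( * )}_y\varphi^{(j)}$ ($j\ge4$); it is a symmetry in $\tau_*$ of weight $k$ (for $k=-4,\dots,0$ its generating functions are, up to constant factors, $1$, $z_x$, $z_y$, $yz_x-2x$, $3xz_x+2yz_y-4z$). *)

(* Defs.v *)
From HB Require Import structures.
From mathcomp Require Import all_boot all_order all_algebra.
From mathcomp Require Import finmap.
From mathcomp Require Import monalg.
From mathcomp Require Import reals.

Set Implicit Arguments.
Unset Strict Implicit.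
Unset Printing Implicit Defensive.

Import Order.TTheory GRing.Theory Num.Theory.
Local Open Scope ring_scope.

(* Coordinates of the covering tau_* :                                  *)
(*   Cx = x, Cy = y,                                                    *)
(*   Cz a b = z_{x^a y^b}  (b = false : y^0, b = true : y^1),           *)
(*   Cpsi n = psi^(n+4)   (the nonlocal coordinates psi^(k), k >= 4).   *)
Inductive coord := Cx | Cy | Cz of nat & bool | Cpsi of nat.

Definition coord_enc (c : coord) : (bool + (nat * bool)) + nat :=
  match c with
  | Cx => inl (inl true)
  | Cy => inl (inl false)
  | Cz a b => inl (inr (a, b))
  | Cpsi n => inr n
  end.

Definition coord_dec (e : (bool + (nat * bool)) + nat) : coord :=
  match e with
  | inl (inl true) => Cx
  | inl (inl false) => Cy
  | inl (inr (a, b)) => Cz a b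
  | inr n => Cpsi n
  end.

Lemma coord_encK : cancel coord_enc coord_dec.
Proof. by case. Qed.

HB.instance Definition _ := Countable.copy coord (can_type coord_encK).

Section GibbonsTsarev.
Variable R : fieldType.

Local Notation P := {malg R[{cmonom coord}]}.

Definition var (v : coord) : P := << ucm v >>.

(* The derivation  sum_q V q * d/dq  applied to a polynomial p. *)
Definition der (V : coord -> P) (p : P) : P :=
  \sum_(m <- msupp p) \sum_(v <- finsupp m)
     << (p@_m * (m v)%:R) *g divcm m (ucm v) >> * V v.

Definition xP : P := var Cx.
Definition yP : P := var Cy.
Definition zP (a : nat) (b : bool) : P := var (Cz a b).

Definition psiP (i : nat) : P :=
  match i with
  | 0 => 0
  | 1 => yP
  | 2 => xP
  | 3 => zP 0 false - 2^-1 *: yP ^+ 2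
  | n.+4 => var (Cpsi n)
  end.

Definition sigma (m : nat) : P :=
  \sum_(j < m./2.+1)
     ('C(m - j, j))%:R * zP 1 false ^+ (m - j.*2) * zP 0 true ^+ j.

Definition Xk (k : nat) : P :=
  sigma (k - 2) - \sum_(1 <= i < k - 2) i%:R * sigma (k - i - 3) * psiP i.

Definition Yk (k : nat) : P :=
  zP 0 true * Xk (k - 1) - (k - 2)%:R * psiP (k - 2).

Definition Dx_coef (c : coord) : P :=
  match c with
  | Cx => 1
  | Cy => 0
  | Cz a b => zP a.+1 b
  | Cpsi n => Xk (n + 4)
  end.

Definition Dx (p : P) : P := der Dx_coef p.

(* z_yy expressed through the equation z_yy + z_x z_xy - z_y z_xx + 1 = 0 *)
Definition zyy : P :=
  zP 0 true * zP 2 false - zP 1 false * zP 1 true - 1.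

(* Total derivative D^star_y : coefficients and action
   (D_y z_{x^a y} = D_x^a (z_yy)) *)
Definition Dy_coef (c : coord) : P :=
  match c with
  | Cx => 0
  | Cy => 1
  | Cz a false => zP a true
  | Cz a true => iter a Dx zyy
  | Cpsi n => Yk (n + 4)
  end.

Definition Dy (p : P) : P := der Dy_coef p.

(* A vector field is given by its coefficients V q (q a coordinate).
   Nonlocal symmetry in tau_*: no d/dx, d/dy components, and
   [V, D^star_x] = [V, D^star_y] = 0 (compared coefficientwise:
   the q-coefficient of [V, D] is V(D q) - D(V q)). *)
Definition nonlocal_symmetry (V : coord -> P) : Prop :=
  [/\ V Cx = 0, V Cy = 0,
      (forall q, der V (Dx_coef q) = Dx (V q)) &
      (forall q, der V (Dy_coef q) = Dy (V q))].

Definition wt (c : coord) : int :=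
  match c with
  | Cx => 3
  | Cy => 2
  | Cz a b => 4 - 3 * a%:Z - 2 * (b : nat)%:Z
  | Cpsi n => (n + 5)%:Z
  end.

Definition mwt (m : {cmonom coord}) : int :=
  \sum_(v <- finsupp m) (m v)%:Z * wt v.

Definition homogeneous (w : int) (p : P) : Prop :=
  forall m, m \in msupp p -> mwt m = w.

Definition vf_homogeneous (k : int) (V : coord -> P) : Prop :=
  forall q, homogeneous (wt q + k) (V q).

(* The coordinates phi^(j): phi(lambda) = 1/lambda + sum_j phi^(j) lambda^j *)
(* determined by psi(phi(lambda)) = 1/lambda, i.e.                      *)
(*   phi^(j) = - sum_{i=1}^{j} psi^(i) [lambda^j] phi^(-i),             *)
(* with phi^(-1) = lambda w, w = 1/(1 + sum_l phi^(l) lambda^(l+1)).    *)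
(* Series in lambda are represented by (exact enough) truncations in    *)
(* {poly P}.                                                            *)
Definition phi_next (s : seq P) : P :=
  let j := (size s).+1 in
  let g : {poly P} := \sum_(l < size s) (s`_l)%:P * 'X^(l.+2) in
  let w : {poly P} := \sum_(t < j.+1) (- g) ^+ t in
  - \sum_(1 <= i < j.+1) psiP i * (w ^+ i)`_(j - i).

(* phis n = [:: phi^(1); ...; phi^(n)] *)
Fixpoint phis (n : nat) : seq P :=
  if n is n'.+1 then rcons (phis n') (phi_next (phis n')) else [::].

Definition phiP (j : nat) : P := (phis j)`_(j.-1).

(* Truncations (mod lambda^(N+2)) of Phi = lambda phi and
   H = lambda^2 phi_lambda. *)
Definition PhiN (N : nat) : {poly P} :=
  1 + \sum_(j < N) (phiP j.+1)%:P * 'X^(j.+2).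
Definition HN (N : nat) : {poly P} :=
  -1 + \sum_(j < N) ((j.+1)%:R * phiP j.+1)%:P * 'X^(j.+2).

(* For M = 1 - n = k + 1 = m >= 0, lambda^m (lambda^n phi_lambda) = H and
   lambda^m phi^j = lambda^(m-j) Phi^j.  The list l = [:: c_m; ...; c_(m-t)]
   of coefficients of the expansion in powers of phi. *)
Definition accN (m N : nat) (l : seq P) : {poly P} :=
  \sum_(s < size l) (l`_s)%:P * 'X^s * PhiN N ^+ (m - s).

Fixpoint csN (m N t : nat) : seq P :=
  if t is t'.+1 then
    let l := csN m N t' in rcons l ((HN N - accN m N l)`_t)
  else [:: (HN N)`_0].

(* f^(i), the coefficient of lambda^i in
   f_n = P_phi(lambda^n phi_lambda), n = 1 - k:
   lambda^m f_n = H - sum_{j=0}^m c_j lambda^(m-j) Phi^j  (m = k+1 >= 0),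
   f_n = lambda^(k+1) H                                 (k+1 < 0). *)
Definition fcoef (k : int) (i : nat) : P :=
  match (k + 1)%R with
  | Posz m => let N := (m + i)%N in (HN N - accN m N (csN m N m))`_(m + i)
  | Negz d => if (d < i)%N then (HN (i - d.+1))`_(i - d.+1) else 0
  end.

Definition Zgen (k : int) : P :=
  (zP 0 true + yP) * fcoef k 1 + zP 1 false * fcoef k 2 - fcoef k 3.

Definition Sk_z (k : int) (a : nat) (b : bool) : P :=
  iter a Dx (if b then Dy (Zgen k) else Zgen k).

Definition Sk_phi (k : int) (j : nat) : P :=
  fcoef k j + fcoef k 2 * Dx (phiP j) + fcoef k 1 * Dy (phiP j).

(* V = c S^(k): equality of all components (there are no x, y components;
   the psi-components are determined by the phi-components, the phi^(j),
   j >= 4, together with x, y, z forming a coordinate system). *)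
Definition is_scaled_Sk (c : R) (k : int) (V : coord -> P) : Prop :=
  [/\ V Cx = 0, V Cy = 0,
      (forall a b, V (Cz a b) = c *: Sk_z k a b) &
      (forall j, (4 <= j)%N -> der V (phiP j) = c *: Sk_phi k j)].

End GibbonsTsarev.

(* Main.v *)
(* Let r, s be the Riemann invariants, z_x = r + s and z_y = - r s. On functions
   of x, y, z and the psi the characteristic derivation Dy + s Dx acts as
   Es = sum_a s^a Ea. The terms of highest order in the linearized equation
   force the generating function of V to be Z = A z_y + B z_x + C with A, B, C
   functions of x, y, z and the psi, and the coefficients K_j of
   K(s) = s Es A - Es B satisfy Ea K_j = (j + 2 a + 3) K_(j + a + 2).
   The field V' = V - B Dx - A Dy descends to the functions of x, y, z and the
   psi, and (V' phi - sum_j K_j phi^j) / phi_lambda is annihilated by every Ea,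
   so its coefficients are constants. As V is homogeneous, only one power of
   lambda is left:
     V' phi = c lambda^(1-k) phi_lambda + sum_j K_j phi^j.
   The left side has only positive powers of lambda, so the sum removes the
   part of lambda^(1-k) phi_lambda spanned by the nonnegative powers of phi;
   the coefficients of lambda, lambda^2, lambda^3 give A, B and C. *)
Require Import Defs.
From HB Require Import structures.
From mathcomp Require Import all_boot all_order all_algebra.
From mathcomp Require Import finmap.
From mathcomp Require Import monalg.
From mathcomp Require Import reals.
From mathcomp Require Import ring lra zify.
Import Order.TTheory GRing.Theory Num.Theory.
Import Defs.
Local Open Scope ring_scope.
Set Implicit Arguments.
Unset Strict Implicit.

(** The invariants r and s are the roots of a quadratic with discriminant z_x^2 + 4 z_y, so they are
    not polynomials in the coordinates. The computations take place in polynomials in r and d = r -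
    s, into which the coordinates embed; equations are multiplied by d instead of being divided by
    it, and exchanging r and s turns statements about Dy + s Dx into statements about Dy + r Dx.
    Higher derivatives are excluded because Dy + s Dx takes r to - 1/d, which contains no
    derivatives: the coefficient f of the top derivative of r in Z is formally d^k g with (Dy + s
    Dx) g = (c + 1) g / d^2 and c >= 0, which no nonzero polynomial f satisfies. The series phi
    enters through (Dy + s Dx) phi = - 1/(phi - s), that is, Ea phi = - phi^(- a - 1). Hence Ea
    phi_lambda = (a + 1) phi^(- a - 2) phi_lambda, and the rule for Ea K_j is what makes V' phi -
    sum_j K_j phi^j satisfy the same linear equation. The quotient is constant because the Ea form a
    triangular system on x, y, z and the psi. *)

Arguments mkmalgU : simpl never.
Arguments mcoeff : simpl never.
Arguments msupp : simpl never.
Arguments ucm : simpl never.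
Arguments divcm : simpl never.
Arguments mmap : simpl never.

(* The polynomial ring in the coordinates, as an interface: conversion would
   otherwise unfold {malg R[{cmonom coord}]}. *)
Record polyAlg (R : fieldType) := PolyAlg {
  palg :> comAlgType R;
  pv : coord -> palg;
  pder : (coord -> palg) -> palg -> palg;
  psub : (coord -> palg) -> palg -> palg;
  pder_is_linear : forall V, linear (pder V);
  pder_mul : forall V f g, pder V (f * g) = f * pder V g + pder V f * g;
  pder_var : forall V v, pder V (pv v) = V v;
  psub_is_linear : forall h, linear (psub h);
  psub_is_monoid : forall h, monoid_morphism (psub h);
  psub_var : forall h v, psub h (pv v) = h v;
  palg_ind : forall Q : palg -> Prop, (forall c, Q c%:A) ->
    (forall f g, Q f -> Q g -> Q (f + g)) -> (forall f v, Q f -> Q (f * pv v)) ->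
    forall f, Q f
}.

(** * Derivations, partial derivatives and constants of a polynomial ring *)

Section Derivations.
Variables (R : numFieldType) (T : polyAlg R).
Local Notation P := (palg T).
Implicit Types (f g : P) (V W : coord -> P).

HB.instance Definition _ V := GRing.isLinear.Build R P P *:%R (pder V) (pder_is_linear V).
HB.instance Definition _ h := GRing.isLinear.Build R P P *:%R (psub h) (psub_is_linear h).
HB.instance Definition _ h := GRing.isMonoidMorphism.Build P P (psub h) (psub_is_monoid h).

Lemma pder1 V : pder V 1 = 0.
Proof.
have := pder_mul V 1 1; rewrite !mul1r mulr1 => /eqP.
by rewrite -subr_eq0 opprD addNKr oppr_eq0 => /eqP.
Qed.

Lemma pderC V c : pder V c%:A = 0.
Proof. by rewrite linearZ /= pder1 scaler0. Qed.

Lemma pder_nat V n : pder V n%:R = 0.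
Proof. by rewrite raddfMn /= pder1 mul0rn. Qed.

Lemma pderX V f n : pder V (f ^+ n) = n%:R * f ^+ n.-1 * pder V f.
Proof.
elim: n => [|n IH]; first by rewrite expr0 pder1 !mul0r.
rewrite exprS pder_mul IH; case: n {IH} => [|n] /=; first by rewrite expr0; ring.
by rewrite exprS -!natr1; ring.
Qed.

Lemma psubC h c : psub h c%:A = c%:A :> P.
Proof. by rewrite linearZ /= rmorph1. Qed.

(** Derivations twisted by a ring morphism [h]. They are determined by their values on the variables
    ([hder_ext]), which reduces commutation of a substitution with a derivation to a check on
    coordinates. *)
Definition hder (h : P -> P) (D : P -> P) :=
  [/\ forall f g, D (f + g) = D f + D g, forall c, D c%:A = 0 &
      forall f g, D (f * g) = h f * D g + D f * h g].

Lemma hder_ext h D1 D2 : hder h D1 -> hder h D2 ->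
  (forall v, D1 (pv T v) = D2 (pv T v)) -> forall f, D1 f = D2 f.
Proof.
move=> [D1D D1C D1M] [D2D D2C D2M] e; elim/palg_ind => [c|f g ef eg|f v ef].
- by rewrite D1C D2C.
- by rewrite D1D D2D ef eg.
- by rewrite D1M D2M ef e.
Qed.

Lemma psub_comp h1 h2 f : psub h1 (psub h2 f) = psub (fun v => psub h1 (h2 v)) f.
Proof.
elim/palg_ind: f => [c|f g ef eg|f v ef]; first by rewrite !psubC.
- by rewrite 3!rmorphD /= ef eg.
- by rewrite 3!rmorphM /= ef !psub_var.
Qed.

Lemma psub_ext h1 h2 : (forall v, h1 v = h2 v) -> forall f, psub h1 f = psub h2 f.
Proof.
move=> e; elim/palg_ind => [c|f g ef eg|f v ef]; first by rewrite !psubC.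
- by rewrite 2!rmorphD /= ef eg.
- by rewrite 2!rmorphM /= ef !psub_var e.
Qed.

Lemma psub_id f : psub (pv T) f = f.
Proof.
elim/palg_ind: f => [c|f g ef eg|f v ef]; first by rewrite !psubC.
- by rewrite rmorphD /= ef eg.
- by rewrite rmorphM /= ef !psub_var.
Qed.

Lemma hder_sub_der h V : hder (psub h) (fun f => psub h (pder V f)).
Proof.
split=> [f g|c|f g]; first by rewrite 2!raddfD.
- by rewrite pderC raddf0.
- by rewrite pder_mul rmorphD /= 2!rmorphM.
Qed.

Lemma hder_der_sub h V : hder (psub h) (fun f => pder V (psub h f)).
Proof.
split=> [f g|c|f g]; first by rewrite 2!raddfD.
- by rewrite psubC pderC.
- by rewrite rmorphM /= pder_mul.
Qed.

Lemma hder_der V : hder id (pder V).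
Proof. by split=> [f g|c|f g]; rewrite ?raddfD ?pderC ?pder_mul. Qed.

Lemma hder_add h D1 D2 : hder h D1 -> hder h D2 -> hder h (fun f => D1 f + D2 f).
Proof.
move=> [D1D D1C D1M] [D2D D2C D2M]; split=> [f g|c|f g].
- by rewrite D1D D2D; ring.
- by rewrite D1C D2C addr0.
- by rewrite D1M D2M; ring.
Qed.

Lemma hder_scale h D a : hder h D -> hder h (fun f => a * D f).
Proof.
move=> [D1D D1C D1M]; split=> [f g|c|f g].
- by rewrite D1D; ring.
- by rewrite D1C mulr0.
- by rewrite D1M; ring.
Qed.

Lemma pder_ext V W f : (forall v, V v = W v) -> pder V f = pder W f.
Proof. by move=> e; apply: (hder_ext (hder_der V) (hder_der W)) => v; rewrite !pder_var. Qed.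

Lemma pder_comm V W f :
  pder V (pder W f) - pder W (pder V f) = pder (fun v => pder V (W v) - pder W (V v)) f.
Proof.
move: f; apply: (hder_ext (h := id) _ (hder_der _)) => [|v]; last by rewrite !pder_var.
split=> [f g|c|f g]; first by rewrite 4!raddfD /=; ring.
- by rewrite !pderC !raddf0 addr0.
- by rewrite !pder_mul 2!raddfD /= !pder_mul; ring.
Qed.

Definition pd (v : coord) : P -> P := pder (fun w => (w == v)%:R).

HB.instance Definition _ v := GRing.Linear.on (pd v).

Lemma pd_var v w : pd v (pv T w) = (w == v)%:R.
Proof. exact: pder_var. Qed.

Lemma pd_mul v f g : pd v (f * g) = f * pd v g + pd v f * g.
Proof. exact: pder_mul. Qed.

Lemma pd_nat v n : pd v n%:R = 0.
Proof. exact: pder_nat. Qed.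

Lemma pd1 v : pd v 1 = 0.
Proof. exact: pder1. Qed.

Lemma pdX v f n : pd v (f ^+ n) = n%:R * f ^+ n.-1 * pd v f.
Proof. exact: pderX. Qed.

Lemma pdC v c : pd v c%:A = 0.
Proof. exact: pderC. Qed.

Lemma pd_der v V f : pd v (pder V f) = pder V (pd v f) + pder (fun w => pd v (V w)) f.
Proof.
have := pder_comm (fun w => (w == v)%:R) V f.
rewrite -/(pd v _) -/(pd v _) => /(canRL (subrK _)) ->; rewrite addrC; congr (_ + _).
by apply: pder_ext => w; rewrite pder_nat subr0.
Qed.

Lemma pder0 f : pder (fun _ => 0) f = 0.
Proof.
apply: (hder_ext (hder_der _) (D2 := fun _ => 0)) => [|v]; last by rewrite pder_var.
by split=> *; rewrite ?mulr0 ?mul0r ?addr0.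
Qed.

Lemma pdpd v w f : pd v (pd w f) = pd w (pd v f).
Proof.
rewrite {2}/pd pd_der [X in _ + X](pder_ext (W := fun _ => 0)); first by rewrite pder0 addr0.
by move=> u; rewrite pd_nat.
Qed.

Lemma finite_vars f : exists s : seq coord, uniq s /\ forall v, v \notin s -> pd v f = 0.
Proof.
suff [s hs] : exists s : seq coord, forall v, v \notin s -> pd v f = 0.
  by exists (undup s); rewrite undup_uniq; split=> // v; rewrite mem_undup; apply: hs.
elim/palg_ind: f => [c|f g [s hs] [t ht]|f v [s hs]].
- by exists [::] => v _; rewrite pdC.
- exists (s ++ t) => v; rewrite mem_cat negb_or => /andP[/hs e1 /ht e2].
  by rewrite raddfD /= e1 e2 addr0.
- exists (v :: s) => w; rewrite inE negb_or => /andP[nv /hs e1].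
  by rewrite pd_mul e1 pd_var eq_sym (negPf nv) mulr0 mul0r addr0.
Qed.

Lemma pder_expand f : exists2 s : seq coord, uniq s &
  (forall v, v \notin s -> pd v f = 0) /\ (forall V, pder V f = \sum_(v <- s) V v * pd v f).
Proof.
(* Every list containing the support is allowed, because the two summands of a sum need one common
   list. *)
suff key f0 : exists s0 : seq coord, forall s, uniq s -> {subset s0 <= s} ->
    (forall v, v \notin s -> pd v f0 = 0) /\
    (forall V, pder V f0 = \sum_(v <- s) V v * pd v f0).
  have [s hs] := key f; exists (undup s); rewrite ?undup_uniq //.
  by apply: hs; rewrite ?undup_uniq // => v; rewrite mem_undup.
elim/palg_ind: f0 => [c|g h [s hs] [t ht]|g v [s hs]].
- exists [::] => s us _; split=> [v _|V]; rewrite ?pdC // pderC big1 // => v _.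
  by rewrite pdC mulr0.
- exists (s ++ t) => u uu sub.
  have [|g0 gE] := hs u uu; first by move=> x xs; apply: sub; rewrite mem_cat xs.
  have [|h0 hE] := ht u uu; first by move=> x xs; apply: sub; rewrite mem_cat xs orbT.
  split=> [w wu|V]; first by rewrite raddfD /= g0 // h0 // addr0.
  rewrite raddfD /= gE hE -big_split; apply: eq_bigr => w _ /=.
  by rewrite raddfD /= mulrDr.
- exists (v :: s) => u uu sub.
  have [|g0 gE] := hs u uu; first by move=> x xs; apply: sub; rewrite inE xs orbT.
  have vu : v \in u by apply: sub; rewrite inE eqxx.
  split=> [w wu|V].
    rewrite pd_mul g0 // mul0r addr0 pd_var.
    by case: eqP wu => [<-|_]; rewrite ?vu // mulr0.
  rewrite pder_mul pder_var gE mulr_suml.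
  under [in RHS]eq_bigr do rewrite pd_mul pd_var mulrDr.
  rewrite [RHS]big_split /= [X in _ = X + _](bigD1_seq v) //= eqxx mulr1.
  rewrite [X in _ = _ + X + _]big1 ?addr0 => [|w /negPf nw].
    by rewrite mulrC; congr (_ + _); apply: eq_bigr => w _; rewrite mulrA.
  by rewrite eq_sym nw !mulr0.
Qed.

(** Induction on derivatives, in place of a degree: all sufficiently long chains of partial
    derivatives of a polynomial end in 0, which [nilp] records. *)
Lemma pd_ind (Q : P -> Prop) : Q 0 -> (forall f, (forall v, Q (pd v f)) -> Q f) ->
  forall f, Q f.
Proof.
move=> Q0 Qd.
pose nilp := fix nilp (n : nat) (f : P) {struct n} : Prop :=
  if n is m.+1 then forall v, nilp m (pd v f) else f = 0.
have nil0 n : nilp n 0 by elim: n => //= n IH v; rewrite raddf0.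
have nilD n : forall f g, nilp n f -> nilp n g -> nilp n (f + g).
  elim: n => [f g -> ->|n IH f g hf hg v]; first by rewrite addr0.
  by change (nilp n (pd v (f + g))); rewrite raddfD; exact: IH (hf v) (hg v).
have nilS n : forall f, nilp n f -> nilp n.+1 f.
  elim: n => [f -> v|n IH f hf v]; first by rewrite /= raddf0.
  exact: (IH (pd v f) (hf v)).
have nilM n : forall f v, nilp n f -> nilp n.+1 (f * pv T v).
  elim: n => [f v -> w|n IH f v hf w]; first by rewrite mul0r raddf0.
  rewrite pd_mul pd_var; apply: (nilD n.+1); last exact/IH/hf.
  by case: eqP => _; rewrite ?mulr0 ?mulr1.
have ex f : exists n, nilp n f.
  elim/palg_ind: f => [c|f g [n hn] [m hm]|f v [n hn]].
  - by exists 1%N => v; rewrite /= pdC.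
  - have up k : forall h l, nilp l h -> nilp (k + l)%N h by elim: k => //= k IH h l /IH /nilS.
    by exists (n + m)%N; apply: nilD; [rewrite addnC|]; apply: up.
  - by exists n.+1; apply: nilM.
move=> f; have [n] := ex f; elim: n f => [f -> //|n IH f hf].
by apply: Qd => v; apply/IH/hf.
Qed.

Definition euler : P -> P := pder (pv T).
HB.instance Definition _ := GRing.Linear.on euler.

(** Eigenvectors for distinct eigenvalues are independent: n times the relation, subtracted from its
    image under [euler], loses the last term. *)
Lemma euler_indep n (F : nat -> P) : (forall i, euler (F i) = i%:R * F i) ->
  \sum_(i < n) F i = 0 -> forall i, (i < n)%N -> F i = 0.
Proof.
elim: n F => // n IH F EF; rewrite big_ord_recr /= => e.
have F0 i : (i < n)%N -> F i = 0.
  move=> lt; have /eqP : (n - i)%:R *: F i = 0.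
    rewrite scaler_nat -mulr_natl natrB ?(ltnW lt) //.
    apply: (IH (fun i => (n%:R - i%:R) * F i)) => // [j|].
      by rewrite /euler pder_mul raddfB /= !pder_nat -/(euler _) EF; ring.
    have e' : \sum_(i < n) i%:R * F i + n%:R * F n = n%:R * \sum_(i < n) F i + n%:R * F n.
      have := congr1 euler e; rewrite raddf0 raddfD raddf_sum /= EF => e'.
      rewrite -mulrDr e mulr0 -[RHS]e'.
      by congr (_ + _); apply: eq_bigr => j _; rewrite EF.
    move/addIr: e'; rewrite mulr_sumr => /esym/eqP; rewrite -subr_eq0 -sumrB => /eqP e'.
    by rewrite -[RHS]e'; apply: eq_bigr => j _; rewrite mulrBl.
  by rewrite scaler_eq0 pnatr_eq0 subn_eq0 leqNgt lt => /eqP.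
move=> i; rewrite ltnS leq_eqVlt => /orP[/eqP->|]; last exact: F0.
by move: e; rewrite big1 ?add0r // => j _; rewrite F0.
Qed.

Lemma euler_decomp f : exists F : nat -> P, exists n, exists c,
  [/\ forall i, euler (F i) = i%:R * F i, F 0%N = c%:A &
      forall m, (n <= m)%N -> f = \sum_(i < m) F i].
Proof.
elim/palg_ind: f => [c|f g [F [n [c [EF F0 hF]]]] [G [m [d [EG G0 hG]]]]|f v [F [n [c [EF F0 hF]]]]].
- exists (fun i => if i == 0%N then c%:A else 0), 1%N, c; split=> // [[|i]|[//|m] _].
  + by rewrite /euler pderC mul0r.
  + by rewrite raddf0 mulr0.
  + by rewrite big_ord_recl big1 ?addr0.
- exists (fun i => F i + G i), (maxn n m), (c + d); split=> [i||k].
  + by rewrite raddfD /= EF EG mulrDr.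
  + by rewrite F0 G0 scalerDl.
  + by rewrite geq_max => /andP[/hF e1 /hG e2]; rewrite big_split -e1 -e2.
- exists (fun i => if i is j.+1 then F j * pv T v else 0), n.+1, 0; split=> [[|i]||[//|m] le].
  + by rewrite raddf0 mulr0.
  + by rewrite /euler pder_mul pder_var -/(euler _) EF -natr1; ring.
  + by rewrite scale0r.
  + by rewrite big_ord_recl add0r /= -mulr_suml -hF.
Qed.

(** Euler's formula gives sum_i i F_i = 0 for the homogeneous components F_i, so in characteristic 0
    only the constant F_0 survives. *)
Lemma pd_const f : (forall v, pd v f = 0) -> exists c, f = c%:A.
Proof.
move=> f0; have [F [n [c [EF F0 hF]]]] := euler_decomp f.
exists c; rewrite (hF n.+1) // big_ord_recl F0 big1 ?addr0 // => i _ /=.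
have E0 : \sum_(i < n.+1) (i%:R * F i) = 0.
  transitivity (euler f); first by rewrite [in RHS](hF n.+1) // raddf_sum; apply: eq_bigr => j _; rewrite -EF.
  by rewrite /euler; have [s _ [_ ->]] := pder_expand f; rewrite big1 // => v _; rewrite f0 mulr0.
have /eqP : (lift ord0 i : nat)%:R *: F (lift ord0 i) = 0.
  rewrite scaler_nat -mulr_natl.
  apply: (euler_indep (F := fun i => i%:R * F i) _ E0) => [j|]; last exact: ltn_ord.
  by rewrite /euler pder_mul pder_nat -/(euler _) EF; ring.
by rewrite scaler_eq0 pnatr_eq0 => /eqP.
Qed.

End Derivations.

Section RegularVariables.
Variables (R : numFieldType) (T : polyAlg R).
Local Notation P := (palg T).
Implicit Types (f g : P).

(** The induction on derivatives needs a power of the variable: v^n f = 0 gives v^(n+1) times the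
    v-derivative of f equal to 0. What remains is a constant, evaluated at v = 1. *)
Lemma pv_reg v f : pv T v * f = 0 -> f = 0.
Proof.
suff h n : pv T v ^+ n * f = 0 -> f = 0 by move=> e; apply: (h 1%N); rewrite expr1.
elim/pd_ind: f n => // f IH n e.
have [c fc] : exists c, f = c%:A.
  apply: pd_const => w; have [->|nw] := eqVneq w v.
    apply: (IH v n.+1); have := congr1 (fun g => pv T v * pd v g) e.
    rewrite /= pd_mul pdX pd_var eqxx raddf0 mulr0 mulr1.
    case: n e => [|n] e; first by rewrite /= !mul0r addr0 mulrA -exprS.
    move=> e'; rewrite exprS -mulrA; apply: etrans e'; rewrite [RHS]mulrDr -[LHS]addr0; congr (_ + _).
    transitivity (n.+1%:R * (pv T v ^+ n.+1 * f)); first by rewrite e mulr0.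
    by rewrite exprS; ring.
  apply: (IH w n); have := congr1 (pd w) e.
  rewrite pd_mul pdX pd_var eq_sym (negPf nw) /= mulr0 mul0r addr0 => ->; exact: raddf0.
have := congr1 (psub (fun _ => 1)) e; rewrite rmorphM rmorphXn /= psub_var expr1n mul1r.
by rewrite raddf0 fc psubC.
Qed.

Lemma pd_eq f g : (forall v, pd v f = pd v g) -> psub (fun _ => 0) f = psub (fun _ => 0) g -> f = g.
Proof.
move=> e e0; have [c fc] : exists c, f - g = c%:A.
  by apply: pd_const => v; rewrite raddfB /= e subrr.
apply/eqP; rewrite -subr_eq0 fc; apply/eqP.
by rewrite -(psubC (T := T) (fun _ => 0)) -fc raddfB /= e0 subrr.
Qed.

End RegularVariables.

(** * Riemann invariants *)

Section GibbonsTsarevAlgebra.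
Variables (R : numFieldType) (T : polyAlg R).
Local Notation P := (palg T).
Implicit Types (f g : P) (c v : coord).

(* gz, gpsi, ..., gDy are zP, psiP, ..., Dy over the interface. *)
Definition gz a b : P := pv T (Cz a b).

Definition gpsi (i : nat) : P :=
  match i with
  | 0 => 0
  | 1 => pv T Cy
  | 2 => pv T Cx
  | 3 => gz 0 false - 2^-1 *: pv T Cy ^+ 2
  | n.+4 => pv T (Cpsi n)
  end.

Definition gsigma (m : nat) : P :=
  \sum_(j < m./2.+1) ('C(m - j, j))%:R * gz 1 false ^+ (m - j.*2) * gz 0 true ^+ j.

Definition gX (k : nat) : P :=
  gsigma (k - 2) - \sum_(1 <= i < k - 2) i%:R * gsigma (k - i - 3) * gpsi i.

Definition gY (k : nat) : P := gz 0 true * gX (k - 1) - (k - 2)%:R * gpsi (k - 2).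

Definition gDx_coef (c : coord) : P :=
  match c with
  | Cx => 1
  | Cy => 0
  | Cz a b => gz a.+1 b
  | Cpsi n => gX (n + 4)
  end.

Definition gDx : P -> P := pder gDx_coef.

Definition gzyy : P := gz 0 true * gz 2 false - gz 1 false * gz 1 true - 1.

Definition gDy_coef (c : coord) : P :=
  match c with
  | Cx => 0
  | Cy => 1
  | Cz a false => gz a true
  | Cz a true => iter a gDx gzyy
  | Cpsi n => gY (n + 4)
  end.

Definition gDy : P -> P := pder gDy_coef.

HB.instance Definition _ := GRing.Linear.on gDx.
HB.instance Definition _ := GRing.Linear.on gDy.

(* Besides its own meaning, the same algebra serves as the ring of Riemann
   invariants: there [Cz 1 false] is r and [Cz 0 true] is d = r - s, and
   [io] is the substitution z_x = r + s, z_y = - r s. *)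
Definition rr : P := gz 1 false.
Definition dd : P := gz 0 true.
Definition ss : P := rr - dd.

Definition io_coef (c : coord) : P :=
  match c with
  | Cz 1 false => rr + ss
  | Cz 0 true => - (rr * ss)
  | c => pv T c
  end.
Definition io : P -> P := psub io_coef.
HB.instance Definition _ := GRing.LRMorphism.on io.

(** The exchange of r and s. The image of [io] is symmetric in them, so an identity at s yields one
    at r. *)
Definition th_coef (c : coord) : P :=
  match c with
  | Cz 1 false => ss
  | Cz 0 true => - dd
  | c => pv T c
  end.
Definition th : P -> P := psub th_coef.
HB.instance Definition _ := GRing.LRMorphism.on th.

Lemma dd_reg f : dd * f = 0 -> f = 0.
Proof. exact: pv_reg. Qed.

Lemma dd_inj f g : dd * f = dd * g -> f = g.
Proof. by move/eqP; rewrite -subr_eq0 -mulrBr => /eqP/dd_reg/eqP; rewrite subr_eq0 => /eqP. Qed.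

Lemma th_io f : th (io f) = io f.
Proof.
rewrite /th /io psub_comp; apply: psub_ext.
case=> [||[|[|a]] [|]|n] //=; rewrite ?psub_var //.
- by rewrite rmorphN rmorphM rmorphB /= !psub_var /= /ss; ring.
- by rewrite rmorphD rmorphB /= !psub_var /= /ss; ring.
Qed.

Lemma th_rr : th rr = ss. Proof. exact: psub_var. Qed.
Lemma th_dd : th dd = - dd. Proof. exact: psub_var. Qed.
Lemma th_ss : th ss = rr. Proof. by rewrite rmorphB /= th_rr th_dd /ss; ring. Qed.

Definition rr_s f := pd (Cz 1 false) f + pd (Cz 0 true) f.

(* [rr_s] is the partial derivative in r at fixed s. *)
Lemma rr_s_io f : rr_s (io f) = io (pd (Cz 1 false) f) - ss * io (pd (Cz 0 true) f).
Proof.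
rewrite -mulNr; move: f; apply: (hder_ext (h := io)).
- by apply: hder_add; apply: hder_der_sub.
- by apply: hder_add; first exact: hder_sub_der; apply: hder_scale; apply: hder_sub_der.
case=> [||[|[|a]] [|]|n]; rewrite /rr_s /io psub_var !pd_var /= ?rmorph0 ?rmorph1 ?pd_var //= ?mulr0 ?addr0 //.
- by rewrite 2!raddfN /= !pd_mul !raddfB /= !pd_var /= /ss; ring.
- by rewrite /ss 4!raddfD /= !raddfN /= !pd_var /=; ring.
Qed.

(** At fixed r the derivative in d = r - s is minus the derivative in s, and z_x, z_y have
    s-derivatives 1, - r. *)
Lemma pd_dd_io f : pd (Cz 0 true) (io f) = rr * io (pd (Cz 0 true) f) - io (pd (Cz 1 false) f).
Proof.
rewrite -mulN1r; move: f; apply: (hder_ext (h := io)).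
- exact: hder_der_sub.
- by apply: hder_add; apply: hder_scale; apply: hder_sub_der.
case=> [||[|[|a]] [|]|n]; rewrite /io psub_var !pd_var /= ?rmorph0 ?rmorph1 ?pd_var //= ?mulr0 ?addr0 //.
- by rewrite raddfN /= !pd_mul !raddfB /= !pd_var /= /ss; ring.
- by rewrite raddfD /= !raddfB /= !pd_var /=; ring.
Qed.

Lemma pd_io v f : v != Cz 1 false -> v != Cz 0 true -> pd v (io f) = io (pd v f).
Proof.
move=> n1 n2; move: f; apply: (hder_ext (h := io)).
- exact: hder_der_sub.
- exact: hder_sub_der.
move=> w; rewrite /io psub_var pd_var.
have [->|nw] := eqVneq w v.
  by rewrite rmorph1; case: v n1 n2 => [||[|[|a]] [|]|n] //= _ _; rewrite pd_var eqxx.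
rewrite rmorph0; case: w nw => [||[|[|a]] [|]|n] /= nw; rewrite ?pd_var ?(negPf nw) //.
- by rewrite raddfN /= pd_mul raddfB /= !pd_var !(eq_sym _ v) (negPf n1) (negPf n2) /=; ring.
- by rewrite raddfD /= raddfB /= !pd_var !(eq_sym _ v) (negPf n1) (negPf n2) /=; ring.
Qed.

Lemma psub0_io f : psub (fun _ => 0) (io f) = psub (fun _ => 0) f.
Proof.
rewrite /io psub_comp; apply: psub_ext.
case=> [||[|[|a]] [|]|n] //=; rewrite ?psub_var //.
- by rewrite rmorphN rmorphM rmorphB /= !psub_var; ring.
- by rewrite rmorphD rmorphB /= !psub_var; ring.
Qed.

(** The Jacobian of z_x, z_y in r and s is d up to sign, and d is regular; so all derivatives of f
    lie again in the kernel, and [pd_ind] applies. *)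
Lemma io_eq0 f : io f = 0 -> f = 0.
Proof.
elim/pd_ind: f => // f IH e; apply: pd_eq => [v|]; last by rewrite -psub0_io e !rmorph0.
have q0 : pd (Cz 0 true) f = 0.
  apply/IH/dd_reg; have := pd_dd_io f; have := rr_s_io f; rewrite e /rr_s !raddf0 addr0 => h1 h2.
  set a := io (pd (Cz 1 false) f) in h1 h2; set b := io _ in h1 h2 *.
  rewrite (_ : dd * b = (a - ss * b) + (rr * b - a)); last by rewrite /ss; ring.
  by rewrite -h1 -h2 addr0.
rewrite raddf0; have [->|n2] := eqVneq v (Cz 0 true); first exact: q0.
apply: IH; have [->|n1] := eqVneq v (Cz 1 false).
  by have := rr_s_io f; rewrite e q0 /rr_s !raddf0 addr0 mulr0 subr0 => <-.
by rewrite -pd_io // e raddf0.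
Qed.

Lemma io_inj f g : io f = io g -> f = g.
Proof. by move/eqP; rewrite -subr_eq0 -raddfB => /eqP/io_eq0/eqP; rewrite subr_eq0 => /eqP. Qed.

(* The algebra over the Riemann invariants is free over the image of [io],
   because the exchange [th] of r and s fixes this image. *)
Lemma io_free f g : io f + ss * io g = 0 -> f = 0 /\ g = 0.
Proof.
move=> e; have e' : io f + rr * io g = 0.
  by rewrite -(th_io f) -(th_io g) -th_ss -rmorphM -rmorphD /= e rmorph0.
have g0 : g = 0.
  apply/io_eq0/dd_reg.
  rewrite (_ : dd * io g = (io f + rr * io g) - (io f + ss * io g)); last by rewrite /ss; ring.
  by rewrite e e' subr0.
by split=> //; apply/io_eq0; move: e; rewrite g0 rmorph0 mulr0 addr0.
Qed.

(** The derivatives of z of positive order; the [basic] polynomials are thus the functions of x, y,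
    z and the psi. *)
Definition jetc (c : coord) := if c is Cz a b then (0 < a)%N || b else false.

Definition basic f := forall c, jetc c -> pd c f = 0.

Lemma basicD f g : basic f -> basic g -> basic (f + g).
Proof. by move=> bf bg c j; rewrite raddfD /= bf // bg // addr0. Qed.
Lemma basicN f : basic f -> basic (- f).
Proof. by move=> bf c j; rewrite raddfN /= bf // oppr0. Qed.
Lemma basicB f g : basic f -> basic g -> basic (f - g).
Proof. by move=> bf bg; apply/basicD/basicN. Qed.
Lemma basicM f g : basic f -> basic g -> basic (f * g).
Proof. by move=> bf bg c j; rewrite pd_mul /= bf // bg // mulr0 mul0r addr0. Qed.
Lemma basicZ a f : basic f -> basic (a *: f).
Proof. by move=> bf c j; rewrite linearZ /= bf // scaler0. Qed.
Lemma basicX f n : basic f -> basic (f ^+ n).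
Proof. by move=> bf c j; rewrite pdX bf // mulr0. Qed.
Lemma basic0 : basic 0. Proof. by move=> c _; rewrite raddf0. Qed.
Lemma basic1 : basic 1. Proof. by move=> c _; rewrite pd1. Qed.
Lemma basic_nat n : basic n%:R. Proof. by move=> c _; rewrite pd_nat. Qed.
Lemma basic_sum I (s : seq I) (p : pred I) (F : I -> P) :
  (forall i, p i -> basic (F i)) -> basic (\sum_(i <- s | p i) F i).
Proof. by move=> bF; elim/big_rec: _ => [|i g pi bg]; [exact: basic0|apply: basicD; first exact: bF]. Qed.
Lemma basic_pv v : ~~ jetc v -> basic (pv T v).
Proof. by move=> jv c jc; rewrite pd_var; case: eqP jv => // ->; rewrite jc. Qed.
Lemma basic_pd v f : basic f -> basic (pd v f).
Proof. by move=> bf c j; rewrite pdpd bf // raddf0. Qed.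
Lemma basic_psi i : basic (gpsi i).
Proof.
case: i => [|[|[|[|i]]]] /=; rewrite ?[basic 0]/basic; try exact: basic_pv.
  exact: basic0.
by apply: basicB; [apply: basic_pv|apply/basicZ/basicX/basic_pv].
Qed.

Lemma basic_pder W f : (forall v, ~~ jetc v -> basic (W v)) -> basic f -> basic (pder W f).
Proof.
move=> bW bf; have [s _ [_ ->]] := pder_expand f; apply: basic_sum => v _.
have [j|/bW bv] := boolP (jetc v); first by rewrite bf // mulr0; apply: basic0.
by apply: basicM => //; apply: basic_pd.
Qed.

Lemma io_basic f : basic f -> io f = f.
Proof.
elim/pd_ind: f => [_|f IH bf]; first by rewrite rmorph0.
apply: pd_eq => [v|]; last exact: psub0_io.
have [e1|n1] := eqVneq v (Cz 1 false); last have [e2|n2] := eqVneq v (Cz 0 true).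
- have := rr_s_io f; have := pd_dd_io f; rewrite e1 /rr_s !bf // rmorph0 !mulr0 subr0 => ->.
  by rewrite addr0.
- by rewrite e2 pd_dd_io !bf // rmorph0 mulr0 subr0.
- by rewrite pd_io // IH //; apply: basic_pd.
Qed.

Lemma th_basic f : basic f -> th f = f.
Proof. by move=> /io_basic <-; rewrite th_io. Qed.

Lemma pder_basic_eq V W f : basic f -> (forall v, ~~ jetc v -> V v = W v) -> pder V f = pder W f.
Proof.
move=> bf e; have [s _ [_ h]] := pder_expand f; rewrite !h; apply: eq_bigr => v _.
by have [j|/e ->//] := boolP (jetc v); rewrite bf // !mulr0.
Qed.

End GibbonsTsarevAlgebra.
Arguments gpsi : simpl never.

(** * The characteristic derivation *)

Section CharacteristicDerivation.
Variables (R : numFieldType) (T : polyAlg R).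
Local Notation P := (palg T).
Implicit Types (f g : P) (c v : coord).
Local Notation gz := (gz T).
Local Notation gpsi := (gpsi T).

Local Notation rr := (rr T).
Local Notation dd := (dd T).
Local Notation ss := (ss T).

Lemma Cz_eq a b a' b' : (Cz a b == Cz a' b') = (a == a') && (b == b').
Proof. by apply/eqP/andP => [[-> ->]|[/eqP-> /eqP->]]. Qed.

Lemma nat_reg n f : n.+1%:R * f = 0 -> f = 0.
Proof. by rewrite mulr_natl -scaler_nat => /eqP; rewrite scaler_eq0 pnatr_eq0 => /eqP. Qed.

Lemma psumB (I : Type) (s : seq I) (p : pred I) (F G : I -> P) :
  \sum_(i <- s | p i) F i - \sum_(i <- s | p i) G i = \sum_(i <- s | p i) (F i - G i).
Proof. by rewrite sumrB. Qed.

Lemma pder_congr V W f : (forall v, V v = W v \/ pd v f = 0) -> pder V f = pder W f.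
Proof.
move=> e; have [s _ [_ h]] := pder_expand f; rewrite !h; apply: eq_bigr => v _.
by have [->//|->] := e v; rewrite !mulr0.
Qed.

Lemma pder_addf V W f : pder (fun v => V v + W v) f = pder V f + pder W f.
Proof.
have [s _ [_ h]] := pder_expand f; rewrite !h -big_split; apply: eq_bigr => v _ /=.
by rewrite mulrDl.
Qed.

Lemma pder_scalef a V f : pder (fun v => a * V v) f = a * pder V f.
Proof.
have [s _ [_ h]] := pder_expand f; rewrite !h mulr_sumr; apply: eq_bigr => v _ /=.
by rewrite mulrA.
Qed.

Lemma pder_horner V (p : {poly P}) x :
  pder V p.[x] = (map_poly (pder V) p).[x] + p^`().[x] * pder V x.
Proof.
elim/poly_ind: p => [|p c IH]; first by rewrite map_poly0 deriv0 !horner0 raddf0 mul0r addr0.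
have -> : map_poly (pder V) (p * 'X + c%:P) = map_poly (pder V) p * 'X + (pder V c)%:P.
  apply/polyP => i; rewrite coef_map_id0 ?raddf0 // !coefD !coefC !coefMX coef_map_id0 ?raddf0 //.
  by case: i => [|i] /=; rewrite ?add0r ?addr0.
rewrite !derivE !hornerE raddfD /= pder_mul IH; ring.
Qed.

Lemma natr_shift p q m N : (m./2 < N)%N ->
  \sum_(j < m./2.+1) ('C(m - j, j))%:R * p ^+ (m - j.*2) * q ^+ j =
  \sum_(j < N) ('C(m - j, j))%:R * p ^+ (m - j.*2) * q ^+ j :> P.
Proof.
move=> lt; rewrite -!(big_mkord xpredT (fun j => ('C(m - j, j))%:R * p ^+ (m - j.*2) * q ^+ j)).
rewrite [RHS](big_cat_nat (n := m./2.+1)) //= [X in _ = _ + X]big_nat_cond [X in _ = _ + X]big1 ?addr0 //.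
by move=> j /andP[/andP[lj _] _]; rewrite bin_small ?mul0r //; lia.
Qed.

Lemma sigma_rec m : gsigma T m.+2 = gz 1 false * gsigma T m.+1 + gz 0 true * gsigma T m.
Proof.
rewrite /gsigma; set p := gz 1 false; set q := gz 0 true.
rewrite (@natr_shift p q m.+2 m.+2) ?(@natr_shift p q m.+1 m.+2) ?(@natr_shift p q m m.+1); try lia.
rewrite !(big_ord_recl m.+1) /= !mulr_sumr mulrDr -addrA; congr (_ + _).
  by rewrite !subn0 !bin0 !expr0 !mulr1 !mul1r exprS.
rewrite mulr_sumr -big_split; apply: eq_bigr => i _ /=; rewrite /bump /= !add1n !subSS.
have [le|lt] := leqP i m; last first.
  have -> : (m.+1 - i)%N = 0%N by lia.
  have -> : (m - i)%N = 0%N by lia.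
  by rewrite !bin0n; case: (nat_of_ord i) lt => [//|k] _; rewrite !mul0r !mulr0 addr0.
rewrite subSn // binS natrD.
have [le2|lt2] := leqP i.*2.+1 m.
  have -> : (m - i.*2)%N = (m - i.*2.+1).+1 by lia.
  by rewrite !exprS; ring.
have -> : 'C(m - i, i.+1) = 0%N by rewrite bin_small //; lia.
by rewrite exprS; ring.
Qed.

Lemma io_p : io (gz 1 false) = rr + ss. Proof. exact: psub_var. Qed.
Lemma io_q : io (gz 0 true) = - (rr * ss). Proof. exact: psub_var. Qed.

(** The recursion [sigma_rec], an instance of Pascal's rule, has characteristic roots r and s:
    sigma_m is the complete homogeneous symmetric polynomial of degree m in them. *)
Lemma dd_io_sigma m : dd * io (gsigma T m) = rr ^+ m.+1 - ss ^+ m.+1.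
Proof.
suff [] : dd * io (gsigma T m) = rr ^+ m.+1 - ss ^+ m.+1 /\
          dd * io (gsigma T m.+1) = rr ^+ m.+2 - ss ^+ m.+2 by [].
elim: m => [|m [IH1 IH2]].
  rewrite /gsigma !big_ord_recl !big_ord0 /= !bin0 !expr0 !expr1 !addr0 !mulr1 !mul1r.
  by rewrite rmorph1 io_p; split; rewrite /ss; ring.
split=> //; rewrite sigma_rec rmorphD !rmorphM /= io_p io_q mulrDr !(mulrCA dd) IH1 IH2.
by rewrite !exprS; ring.
Qed.

(* [Dy + s Dx] maps psi^(n+1) to the value of [eps n] at s. *)
Fixpoint eps (n : nat) : {poly P} :=
  if n is m.+1 then 'X * eps m - (m%:R * gpsi m)%:P else 1.

Lemma epsE n : eps n = 'X^n - \sum_(1 <= i < n) (i%:R * gpsi i)%:P * 'X^(n.-1 - i).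
Proof.
elim: n => [|[|n] IH]; first by rewrite big_geq // subr0 expr0.
  by rewrite /= mul0r polyC0 big_geq // !subr0 mulr1 expr1.
rewrite [LHS]/= -/(eps n.+1) {}IH.
rewrite [in RHS]big_nat_recr //= subnn expr0 mulr1.
suff -> : \sum_(1 <= i < n.+1) (i%:R * gpsi i)%:P * 'X^(n.+1 - i) =
    'X * \sum_(1 <= i < n.+1) (i%:R * gpsi i)%:P * 'X^(n - i) by rewrite !exprS; ring.
rewrite mulr_sumr big_nat_cond [RHS]big_nat_cond; apply: eq_bigr => i.
by move=> /andP[/andP[h1 h2] _]; rewrite mulrCA -exprS -subSn.
Qed.

Lemma basic_eps n i : basic (eps n)`_i.
Proof.
elim: n i => [|n IH] i /=; first by rewrite coef1; apply: basic_nat.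
rewrite coefB coefXM coefC; apply: basicB; case: eqP => _ //; try exact: basic0.
by apply: basicM; [exact: basic_nat|exact: basic_psi].
Qed.

Lemma epsXE n x : (eps n.+1).[x] = x * (eps n).[x] - n%:R * gpsi n.
Proof. by rewrite /= !hornerE. Qed.

Lemma io_psi i : io (gpsi i) = gpsi i.
Proof. exact/io_basic/basic_psi. Qed.

(** X^(n+2) is a divided difference, as it must be if Dy + s Dx and Dy + r Dx take psi^(n+2) to the
    values of [eps n.+1] at s and at r. *)
Lemma dd_io_X n : dd * io (gX T n.+2) = (eps n.+1).[rr] - (eps n.+1).[ss].
Proof.
rewrite !epsE !hornerD !hornerN !hornerXn !horner_sum /gX !subSS !subn0 rmorphB mulrBr /= dd_io_sigma.
suff -> : dd * io (\sum_(1 <= i < n) i%:R * gsigma T (n.+2 - i - 3) * gpsi i) =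
    \sum_(1 <= i < n.+1) ((i%:R * gpsi i)%:P * 'X^(n - i)).[rr] -
    \sum_(1 <= i < n.+1) ((i%:R * gpsi i)%:P * 'X^(n - i)).[ss] by ring.
rewrite psumB; case: n => [|n]; first by rewrite !big_geq // rmorph0 mulr0.
rewrite [RHS]big_nat_recr //= subnn !hornerM !hornerXn !expr0 !hornerC subrr addr0 rmorph_sum mulr_sumr.
apply: eq_big_nat => i /andP[h1 h2].
rewrite !rmorphM rmorph_nat /= io_psi mulrA mulrCA dd_io_sigma !hornerE.
have -> : (n.+3 - i - 3).+1 = (n.+1 - i)%N by lia.
by ring.
Qed.

Lemma io_Y n : io (gY T n.+3) + ss * io (gX T n.+3) = (eps n.+2).[ss].
Proof.
apply: dd_inj; rewrite /gY !subSS !subn0 rmorphB !rmorphM rmorph_nat /= io_psi io_q.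
have h1 := dd_io_X n; have h2 := dd_io_X n.+1.
set x1 := io (gX T n.+2) in h1 *; set x2 := io (gX T n.+3) in h2 *.
transitivity (- (rr * ss) * (dd * x1) - dd * (n.+1%:R * gpsi n.+1) + ss * (dd * x2)); first by ring.
by rewrite h1 h2 !(epsXE n.+1) /ss; ring.
Qed.

(** The value at s is (Dy + s Dx) c for c among x, y, z and the psi; for z it is z_y + s z_x = s^2.
    Derivatives of z are sent to 0. *)
Definition evc c : {poly P} :=
  match c with
  | Cx => 'X
  | Cy => 1
  | Cz 0 false => 'X^2
  | Cpsi n => eps n.+3
  | _ => 0
  end.

Definition Ea i : P -> P := pder (fun c => (evc c)`_i).
Definition Es : P -> P := pder (fun c => (evc c).[ss]).
HB.instance Definition _ i := GRing.Linear.on (Ea i).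
HB.instance Definition _ := GRing.Linear.on Es.

Lemma basic_evc c i : basic (evc c)`_i.
Proof.
case: c => [||[|[|a]] [|]|n]; rewrite /evc ?coef0 ?coef1 ?coefX ?coefXn; try exact: basic_nat; try exact: basic0.
exact: basic_eps.
Qed.

(** This is (Dy + s Dx) z_x, and equals - d s_x. *)
Definition tau : P := ss * gz 2 false + gz 1 true.

Definition Et_coef c : P :=
  match c with
  | Cz 1 false => -1
  | Cz 0 true => - 2%:R - dd * tau
  | Cz (a.+2) false => dd * (gz a.+2 true + ss * gz a.+3 false)
  | Cz (a.+1) true => dd * (io (iter a.+1 (@gDx R T) (gzyy T)) + ss * gz a.+2 true)
  | c => dd * (evc c).[ss]
  end.

(* [Et] extends d * (Dy + s Dx) to the Riemann invariants r and s; here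
   (Dy + s Dx) r = -1/d. *)
Definition Et : P -> P := pder Et_coef.
HB.instance Definition _ := GRing.Linear.on Et.

Lemma Et_rr : Et rr = -1. Proof. exact: pder_var. Qed.
Lemma Et_dd : Et dd = - 2%:R - dd * tau. Proof. exact: pder_var. Qed.
Lemma Et_ss : Et ss = dd * tau + 1. Proof. by rewrite raddfB /= Et_rr Et_dd; ring. Qed.

Lemma Et_io f : Et (io f) = dd * (io (gDy f) + ss * io (gDx f)).
Proof.
move: f; apply: (hder_ext (h := @io R T) (D1 := fun f => Et (io f))
  (D2 := fun f => dd * (io (gDy f) + ss * io (gDx f)))).
- exact: hder_der_sub.
- by apply: hder_scale; apply: hder_add; last apply: hder_scale; apply: hder_sub_der.
move=> v; rewrite /gDy /gDx !pder_var /io psub_var.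
case: v => [||[|[|a]] [|]|n] /=.
- by rewrite /Et pder_var /= hornerX rmorph0 rmorph1; ring.
- by rewrite /Et pder_var /= hornerC rmorph0 rmorph1; ring.
- rewrite raddfN /= /Et pder_mul -/Et Et_rr Et_ss /gzyy.
    rewrite !rmorphB !rmorphM !rmorph1 /= /gz !psub_var /= /tau /ss /gz; ring.
- by rewrite /Et pder_var /= hornerXn /gz !psub_var /= /ss; ring.
- by rewrite /Et pder_var /= [X in _ = _ * (_ + _ * X)]psub_var.
- by rewrite raddfD /= Et_rr Et_ss /gz !psub_var /= /tau /gz; ring.
- by rewrite /Et pder_var /= [X in _ = _ * (_ + _ * X)]psub_var.
- by rewrite /Et pder_var /= /gz !psub_var.
- have -> : (n + 4 = n.+1.+3)%N by rewrite addnC.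
  by rewrite /Et pder_var -/(io _) -/(io (gX _ _)) io_Y.
Qed.

End CharacteristicDerivation.
Arguments evc : simpl never.

(** * Dependence on the derivatives of z of order at least two *)

Section HigherOrder.
Variables (R : numFieldType) (T : polyAlg R).
Local Notation P := (palg T).
Implicit Types (f g : P) (c v : coord).
Local Notation gz := (gz T).
Local Notation gpsi := (gpsi T).
Local Notation rr := (rr T).
Local Notation dd := (dd T).
Local Notation ss := (ss T).
Local Notation tau := (tau T).
Local Notation gDx := (@gDx R T).
Local Notation gzyy := (gzyy T).

(** The derivatives of order at least two: [io] fixes them, and r, s, X^(k), Y^(k) do not involve
    them. *)
Definition hij (c : coord) := if c is Cz a b then (1 < a)%N || ((0 < a)%N && b) else false.

Lemma hij_jetc v : hij v -> jetc v.
Proof. by case: v => //= a b; case: a => [|[|a]]; case: b. Qed.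

Lemma pd_gz a b a' b' : pd (Cz a b) (gz a' b') = ((a' == a) && (b' == b))%:R.
Proof. by rewrite pd_var Cz_eq. Qed.

Lemma hij_sigma v m : hij v -> pd v (gsigma T m) = 0.
Proof.
case: v => // a b h; rewrite raddf_sum big1 // => j _ /=.
rewrite !pd_mul !pdX !pd_gz pd_nat.
by case: a h => [|[|a]] //; case: b => //= _; ring.
Qed.

Lemma hij_X v k : hij v -> pd v (gX T k) = 0.
Proof.
move=> h; rewrite /gX raddfB /= hij_sigma // sub0r raddf_sum /= big1 ?oppr0 // => i _.
by rewrite !pd_mul hij_sigma // pd_nat basic_psi ?hij_jetc //; ring.
Qed.

Lemma hij_Dx a b f : hij (Cz a.+1 b) ->
  pd (Cz a.+1 b) (gDx f) = gDx (pd (Cz a.+1 b) f) + pd (Cz a b) f.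
Proof.
move=> h; rewrite /gDx pd_der; congr (_ + _); apply: pder_ext => -[||a' b'|n].
- by rewrite pd1.
- by rewrite raddf0.
- by rewrite pd_gz Cz_eq eqSS.
- by rewrite hij_X.
Qed.

Lemma T_high l m : (l.+1 < m)%N -> pd (Cz m.+1 false) (iter l gDx gzyy) = 0 /\
  pd (Cz m true) (iter l gDx gzyy) = 0.
Proof.
elim: l m => [|l IH] [//|m] lt.
  rewrite /= /gzyy !raddfB /= !pd_mul !pd1 !pd_gz.
  by case: m lt => [|[|m]] // _ /=; split; ring.
have [e1 e2] := IH m lt; have [e3 e4] := IH m.+1 (ltnW lt).
rewrite iterS !hij_Dx //=; last by case: m lt {e1 e2 e3 e4} => [|[]].
by rewrite e1 e2 e3 e4 !raddf0 !addr0.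
Qed.

Lemma T_top l : pd (Cz l.+2 false) (iter l gDx gzyy) = gz 0 true /\
  pd (Cz l.+1 true) (iter l gDx gzyy) = - gz 1 false.
Proof.
elim: l => [|l [IH1 IH2]].
  by rewrite /= /gzyy !raddfB /= !pd_mul !pd1 !pd_gz /=; split; ring.
have [e1 e2] := @T_high l l.+2 (ltnSn _).
by rewrite iterS !hij_Dx //= e1 e2 IH1 IH2 !raddf0 !add0r.
Qed.

(** The multiple l comes from one Dx falling on the coefficient z_y or - z_x of a second derivative;
    the 1 comes from all of them falling on z_x or z_y itself. *)
Lemma T_next l : pd (Cz l.+1 false) (iter l gDx gzyy) = (l%:R - 1) * gz 1 true /\
  pd (Cz l true) (iter l gDx gzyy) = (1 - l%:R) * gz 2 false.
Proof.
elim: l => [|l [IH1 IH2]].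
  by rewrite /= /gzyy !raddfB /= !pd_mul !pd1 !pd_gz /=; split; ring.
have [e1 e2] := T_top l; have h1 : hij (Cz l.+1 true) by rewrite /= orbT.
rewrite iterS (hij_Dx _ h1) hij_Dx //= e1 e2 IH1 IH2 raddfN /= /gDx !pder_var /= -natr1.
by split; rewrite -/(gz 1 true) -/(gz 2 false); ring.
Qed.

Lemma jet_rr v : hij v -> pd v rr = 0.
Proof. by case: v => // a b h; rewrite pd_gz; case: a h => [|[|a]] //; case: b. Qed.
Lemma jet_dd v : hij v -> pd v dd = 0.
Proof. by case: v => // a b h; rewrite pd_gz; case: a h => [|[|a]] //; case: b. Qed.
Lemma jet_ss v : hij v -> pd v ss = 0.
Proof. by move=> h; rewrite raddfB /= jet_rr // jet_dd // subr0. Qed.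

Lemma jet_evc v c : hij v -> pd v (evc T c).[ss] = 0.
Proof.
move=> h; rewrite /pd pder_horner -/(pd v ss) jet_ss // mulr0 addr0.
rewrite (_ : map_poly _ _ = 0) ?horner0 //; apply/polyP => i.
by rewrite coef_map_id0 ?raddf0 // coef0; apply: basic_evc; apply: hij_jetc.
Qed.

Lemma jet_io v f : hij v -> pd v (io f) = io (pd v f).
Proof. by case: v => // a b h; apply: pd_io; rewrite Cz_eq; case: a h => [|[|a]]; case: b. Qed.

Lemma pd_Et_dd v : pd v (- 2%:R - dd * tau) = - pd v (dd * tau).
Proof. by rewrite raddfB raddfN /= pd_nat oppr0 add0r. Qed.

Lemma pd_add_ss v f g : hij v -> pd v (f + ss * g) = pd v f + ss * pd v g.
Proof. by move=> h; rewrite raddfD /= pd_mul jet_ss // mul0r addr0. Qed.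

Lemma pd_tau v : hij v -> pd v tau = ss * pd v (gz 2 false) + pd v (gz 1 true).
Proof. by move=> h; rewrite /tau raddfD /= pd_mul jet_ss // mul0r addr0. Qed.

Lemma pdN1 v : pd v (- 1 : P) = 0.
Proof. by rewrite raddfN /= pd1 oppr0. Qed.

Lemma io_gz a b : hij (Cz a b) -> io (gz a b) = gz a b.
Proof. by move=> h; rewrite /io psub_var; case: a h => [|[|a]]; case: b. Qed.

(** The two coordinates are the derivatives of order l + 1, so [ordle n] bounds the order by n + 1,
    and [ordle 0] means order one. *)
Definition ordle n f := forall l, (n < l)%N -> pd (Cz l.+1 false) f = 0 /\ pd (Cz l true) f = 0.

Lemma ordle_ex f : exists n, ordle n f.
Proof.
have [s [_ hs]] := finite_vars f.
pose o c := if c is Cz a b then a else 0%N.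
exists (\max_(c <- s) o c) => l lt.
have nin c : (l <= o c)%N -> c \notin s.
  by move=> le; apply/negP => cs; move: (leq_ltn_trans (leq_bigmax_seq (P := xpredT) (F := o) c cs isT) lt); rewrite ltnNge le.
by split; apply/hs/nin => //=.
Qed.

(** The right side is d times the derivative of f along the m-th jet of s: Dy + s Dx raises the jets
    of s, whereas it takes r to - 1/d. *)
Lemma Et_top m f : (0 < m)%N -> ordle m f ->
  pd (Cz m.+1 true) (Et f) = dd * (pd (Cz m.+1 false) f - rr * pd (Cz m true) f).
Proof.
move=> m0 om; rewrite /Et pd_der -/(Et _) (om m.+1 _).2 // raddf0 add0r.
have hv : hij (Cz m.+1 true) by rewrite /= orbT.
rewrite (pder_congr (W := fun w => dd * (w == Cz m.+1 false)%:R +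
   - (dd * rr) * (w == Cz m true)%:R)); last first.
  case=> [||[|[|a]] [|]|n] /=; rewrite ?pd_mul ?jet_dd ?jet_evc ?Cz_eq //; try by left; rewrite ?andbF /=; ring.
  - left; rewrite pd_Et_dd.  rewrite pd_mul jet_dd // pd_tau // !pd_gz.
    by rewrite andbF andbT !eqSS; case: m m0 {om hv} => [//|m] _ /=; ring.
  - have [->|nm] := eqVneq m 1%N.
      left; rewrite !pd_add_ss // !jet_io // !pd_gz /=.
      by have [_ ->] := T_top 1; rewrite rmorphN /= io_p /ss; ring.
    left; rewrite !pd_add_ss // !jet_io // !pd_gz.
    have [|_ ->] := @T_high 1 m.+1; first by lia.
    have n1 : (1 == m)%N = false by lia.
    by rewrite rmorph0 !eqSS n1 !andbF /=; ring.
  - left; rewrite raddfN /= pd1 oppr0 andbF andbT !eqSS.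
    by case: m m0 {om hv} => [//|m] _ /=; ring.
  - have [lt|le] := ltnP m a.+2; first by right; have [_] := om _ lt.
    left; rewrite !pd_add_ss // !jet_io // !pd_gz !eqSS andbT andbF.
    have [<-|nm] := eqVneq a.+2 m.
      by have [_ ->] := T_top a.+2; rewrite rmorphN /= io_p /ss; ring.
    have [|_ ->] := @T_high a.+2 m.+1; first by lia.
    by rewrite rmorph0 /=; ring.
  - left; rewrite !pd_add_ss // !pd_gz !eqSS !andbT !andbF.
    by case: eqP => _ /=; ring.
rewrite pder_addf !pder_scalef -!/(pd _ f); ring.
Qed.

(* [pd p_m - s pd q_m] is proportional to the derivative along the m-th jet
   of r; it almost commutes with [Et]. *)
Lemma Et_lead m f : (0 < m)%N -> ordle m f ->
  pd (Cz m.+1 false) (Et f) - ss * pd (Cz m true) (Et f) =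
  Et (pd (Cz m.+1 false) f) - ss * Et (pd (Cz m true) f)
  + dd * (m%:R - 1) * tau * pd (Cz m true) f.
Proof.
move=> m0 om; rewrite /Et !pd_der -!/(Et _).
have hp : hij (Cz m.+1 false) by rewrite /= ltnS m0.
have hq : hij (Cz m true) by rewrite /= m0 orbT.
suff e : pder (fun w => pd (Cz m.+1 false) (Et_coef T w)) f -
    ss * pder (fun w => pd (Cz m true) (Et_coef T w)) f =
    dd * (m%:R - 1) * tau * pd (Cz m true) f by rewrite -e; ring.
rewrite -mulNr -pder_scalef -pder_addf.
rewrite (pder_congr (W := fun w => dd * (m%:R - 1) * tau * (w == Cz m true)%:R)); last first.
  case=> [||[|[|a]] [|]|n] /=; rewrite ?pd_mul ?jet_dd ?jet_evc ?Cz_eq //; try by left; rewrite ?andbF /=; ring.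
  - left; rewrite !pd_Et_dd !pd_mul !jet_dd // !pd_tau // !pd_gz.
    rewrite !andbF !andbT !eqSS; case: m m0 {om hp hq} => [//|m] _ /=; rewrite !eqSS.
    by case: eqP => _ /=; ring.
  - have [e|nm] := eqVneq m 1%N.
      left; rewrite e in hp hq *; rewrite !pd_add_ss // !jet_io // !pd_gz /=.
      by have [-> ->] := T_next 1; rewrite subrr !mul0r rmorph0; ring.
    left; rewrite !pd_add_ss // !jet_io // !pd_gz.
    have [e|nm2] := eqVneq m 2%N.
      by rewrite e in hp hq *; have [-> ->] := T_top 1; rewrite rmorphN /= io_p io_q /= /ss; ring.
    have [|-> ->] := @T_high 1 m; first by lia.
    rewrite rmorph0 !andbF !andbT.
    rewrite /=.
    by ring.
  - by left; rewrite !pdN1 andbF /=; ring.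
  - have [lt|le] := ltnP m a.+2; first by right; have [_] := om _ lt.
    left; rewrite !pd_add_ss // !jet_io // !pd_gz !eqSS !andbT !andbF.
    have [e|nm] := eqVneq a.+2 m.
      rewrite -e; have [-> ->] := T_next a.+2.
      rewrite !rmorphM !rmorphB !rmorph_nat !rmorph1 /= !io_gz //.
      have -> : (a.+3 == a.+2)%N = false by lia.
      by rewrite /tau /=; ring.
    have [e|nm2] := eqVneq m a.+3.
      by rewrite e; have [-> ->] := T_top a.+2; rewrite rmorphN /= io_p io_q /= /ss; ring.
    have [|-> ->] := @T_high a.+2 m; first by lia.
    by rewrite rmorph0 /=; ring.
  - left; rewrite !pd_add_ss // !pd_gz !eqSS !andbT !andbF.
    by case: eqP => _; rewrite /=; ring.
by rewrite pder_scalef.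
Qed.

End HigherOrder.

(** * The generating function has order one *)

Section Vanishing.
Variables (R : numFieldType) (T : polyAlg R).
Local Notation P := (palg T).
Implicit Types (f g : P) (v : coord).
Local Notation gz := (gz T).
Local Notation gpsi := (gpsi T).
Local Notation rr := (rr T).
Local Notation dd := (dd T).
Local Notation ss := (ss T).
Local Notation tau := (tau T).
Local Notation pr := (pd (T := T) (Cz 1 false)).
Local Notation pd_d := (pd (T := T) (Cz 0 true)).

Lemma pdD v f g : pd v (f + g) = pd v f + pd v g. Proof. exact: raddfD. Qed.
Lemma pdB v f g : pd v (f - g) = pd v f - pd v g. Proof. exact: raddfB. Qed.
Lemma pdN v f : pd v (- f) = - pd v f. Proof. exact: raddfN. Qed.

Lemma pr_rr : pr rr = 1. Proof. exact: pd_var. Qed.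
Lemma pr_dd : pr dd = 0. Proof. exact: pd_var. Qed.
Lemma pd_d_rr : pd_d rr = 0. Proof. exact: pd_var. Qed.
Lemma pd_d_dd : pd_d dd = 1. Proof. exact: pd_var. Qed.
Lemma Es_rr : Es rr = 0. Proof. by rewrite /Es pder_var /= horner0. Qed.
Lemma Es_dd : Es dd = 0. Proof. by rewrite /Es pder_var /= horner0. Qed.

Lemma EsM f g : Es (f * g) = f * Es g + Es f * g. Proof. exact: pder_mul. Qed.
Lemma Es_nat n : Es n%:R = 0 :> P. Proof. exact: pder_nat. Qed.
Lemma EsD f g : Es (f + g) = Es f + Es g. Proof. exact: raddfD. Qed.
Lemma EsB f g : Es (f - g) = Es f - Es g. Proof. exact: raddfB. Qed.
Lemma EtD f g : Et (f + g) = Et f + Et g. Proof. exact: raddfD. Qed.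
Lemma EtB f g : Et (f - g) = Et f - Et g. Proof. exact: raddfB. Qed.
Lemma EtM f g : Et (f * g) = f * Et g + Et f * g. Proof. exact: pder_mul. Qed.

(** A polynomial cannot have negative degree in d; its d-derivative would have a still lower one, so
    [pd_ind] applies. *)
Lemma euler_neg n f : dd * pd_d f = - n.+1%:R * f -> f = 0.
Proof.
elim/pd_ind: f n => // f IH n e; apply: (@nat_reg _ _ n); apply/eqP; rewrite -oppr_eq0 -mulNr -e.
suff -> : pd_d f = 0 by rewrite mulr0.
apply: (IH (Cz 0 true) n.+1); have := congr1 pd_d e.
rewrite /= !pd_mul pd_d_dd raddfN /= pd_nat oppr0 mul0r addr0 mul1r -[n.+2%:R]natr1 => e'.
by rewrite opprD mulrDl -e'; ring.
Qed.

Lemma Es_order0 f : ordle 0 f -> Et f = - pr f - (2%:R + dd * tau) * pd_d f + dd * Es f.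
Proof.
move=> o; rewrite /Et /Es -pder_scalef.
rewrite (pder_congr (W := fun w => dd * (evc T w).[ss] +
   ((-1) * (w == Cz 1 false)%:R + - (2%:R + dd * tau) * (w == Cz 0 true)%:R))); last first.
  case=> [||[|[|a]] [|]|n]; rewrite /= ?Cz_eq /=; try by left; rewrite ?[(evc _ _)](erefl (0 : {poly P})) ?horner0; ring.
  - by right; have [_] := o 1%N isT.
  - by right; have [_] := o a.+2 isT.
  - by right; have [] := o a.+1 isT.
rewrite !pder_addf (pder_scalef (-1)) (pder_scalef (- _)) -!/(pd _ f); ring.
Qed.

(** Induction on the degree k of f in d: both [Es] and the derivative in r annihilate d, so the
    d-derivative of f satisfies the same equation with smaller k. For k = 0 the quotient of f by d
    would have degree - 1. *)
Lemma base_vanish k c f : dd * pd_d f = k%:R * f ->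
  c.+1%:R * f = dd * (dd * Es f - pr f) -> f = 0.
Proof.
elim: k f => [|k IH] f e1 e2.
  move: e1; rewrite mul0r => /dd_reg e1; set h := dd * Es f - pr f in e2.
  suff h0 : h = 0 by move: e2; rewrite h0 mulr0 => /nat_reg.
  apply: (@euler_neg 0); have := congr1 pd_d e2.
  rewrite /= !pd_mul pd_nat e1 mulr0 mul0r addr0 pd_d_dd mul1r => /eqP.
  by rewrite eq_sym addr_eq0 mulN1r => /eqP.
have f0 : pd_d f = 0.
  have ek : k.+1%:R * f = dd * pd_d f by [].
  apply: IH.
    have := congr1 pd_d e1; rewrite /= !pd_mul pd_nat mul0r addr0 pd_d_dd mul1r -natr1 => h.
    by apply/(addIr (pd_d f)); rewrite h; ring.
  have eE := congr1 (@Es R T) ek; have er := congr1 pr ek.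
  move: eE er; rewrite !EsM Es_dd !pd_mul pr_dd mul0r addr0 pd_nat !mul0r !addr0.
  rewrite Es_nat mul0r addr0 => eE er.
  apply: dd_inj; transitivity (c.+1%:R * (dd * pd_d f)); first by ring.
  rewrite -ek mulrCA e2; transitivity (dd * (dd * (k.+1%:R * Es f) - k.+1%:R * pr f)); first by ring.
  by rewrite eE er; ring.
by move: e1; rewrite f0 mulr0 => /esym/nat_reg.
Qed.

(** As d^k solves the equation with 0 in place of c.+1, this concerns g = f / d^k with d Et g = c.+1
    g. The jets of f are removed from the top: f cannot involve the top jet of s by [Et_top], and
    its derivative along that of r solves an equation of the same type. At order one [base_vanish]
    applies. *)
Lemma claim_vanish k c f :
  dd * Et f = (c.+1%:R - 2%:R * k%:R - k%:R * dd * tau) * f -> f = 0.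
Proof.
elim/pd_ind: f k c => // f IH k c e.
have o0 : ordle 0 f.
  have [n on] := ordle_ex f; elim: n on => // n IHn on; apply: IHn.
  set m := n.+1 in on; set g := pd (Cz m true) f.
  have m0 : (0 < m)%N by [].
  have hij1 : hij (Cz m.+1 true) by [].
  have hq : hij (Cz m true) by rewrite /= orbT.
  have hp : hij (Cz m.+1 false) by [].
  have tau1 : pd (Cz m.+1 true) tau = 0 by rewrite pd_tau // !pd_gz ?andbF /=; ring.
  have pf : pd (Cz m.+1 false) f = rr * g.
    have := congr1 (pd (Cz m.+1 true)) e.
    have kill : pd (Cz m.+1 true) (c.+1%:R - 2%:R * k%:R - k%:R * dd * tau) = 0.
      by rewrite !raddfB /= !pd_mul !pd_nat jet_dd // tau1; ring.
    rewrite /= !pd_mul kill (on m.+1 _).2 // mulr0 mul0r addr0 jet_dd // mul0r addr0 Et_top //.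
    by move=> /dd_reg/dd_reg/eqP; rewrite subr_eq0 => /eqP.
  have lead := Et_lead m0 on; rewrite pf -/g EtM Et_rr in lead.
  (* [tau] is - d s_x and so does not involve the jets of r. *)
  have kl : pd (Cz m.+1 false) (c.+1%:R - 2%:R * k%:R - k%:R * dd * tau) -
      ss * pd (Cz m true) (c.+1%:R - 2%:R * k%:R - k%:R * dd * tau) = 0.
    rewrite !raddfB /= !pd_mul !pd_nat !jet_dd // !pd_tau // !pd_gz /= !andbF.
    by case: n => [|n'] /= in m on g m0 hij1 hq hp tau1 pf lead *; ring.
  have e1 := congr1 (pd (Cz m.+1 false)) e; have e2 := congr1 (pd (Cz m true)) e.
  rewrite /= !pd_mul jet_dd // mul0r addr0 pf in e1.
  rewrite /= !pd_mul jet_dd // mul0r addr0 -/g in e2.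
  have g0 : g = 0.
    (* The term with m - 1 = n in [Et_lead] raises k by n, which costs 2 n in the constant; [Et] of
       the factor [rr] in [pf] adds 1 to it. *)
    apply: (IH (Cz m true) (k + n)%N (c + (n + n).+1)%N); rewrite -/g; apply: dd_inj.
    set K := c.+1%:R - _ - _ in kl e1 e2.
    have lead' : dd * (pd (Cz m.+1 false) (Et f) - ss * pd (Cz m true) (Et f)) = K * (rr - ss) * g.
      rewrite mulrBr e1 (mulrCA dd ss) e2.
      transitivity (K * (rr - ss) * g + (pd (Cz m.+1 false) K - ss * pd (Cz m true) K) * f); first by ring.
      by rewrite kl mul0r addr0.
    rewrite lead in lead'.
    have -> : dd * (dd * Et g) = dd * (rr * Et g + -1 * g - ss * Et g + dd * (m%:R - 1) * tau * g)
       + dd * g - dd * dd * n%:R * tau * g.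
      by rewrite /m -natr1 /ss; ring.
    rewrite lead' /K natrD -!natr1 !natrD -!natr1 /ss; ring.
  move=> l; rewrite leq_eqVlt => /orP[/eqP <-|]; last exact: on.
  by rewrite pf -/g g0 mulr0.
have dt : pd (Cz 1 true) tau = 1 by rewrite pd_tau // !pd_gz ?andbF /=; ring.
have h1 : hij (Cz 1 true) by [].
(* Here f has order one, so z_xy enters only through [tau]; this is its coefficient. *)
have ed : dd * pd_d f = k%:R * f.
  have := congr1 (pd (Cz 1 true)) e; rewrite (Es_order0 o0) /=.
  have z1 : pd (Cz 1 true) f = 0 := (o0 1%N isT).2.
  have z2 : pd (Cz 1 true) (pr f) = 0 by rewrite pdpd z1 raddf0.
  have z3 : pd (Cz 1 true) (pd_d f) = 0 by rewrite pdpd z1 raddf0.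
  have z4 : pd (Cz 1 true) (Es f) = 0.
    rewrite /Es pd_der z1 raddf0 add0r (pder_ext (W := fun _ => 0)) ?pder0 // => v.
    exact: jet_evc.
  rewrite !pd_mul !(pdD, pdB, pdN) !pd_mul !(pdD, pdB, pdN) !pd_mul z1 z2 z3 z4 !(pd_nat, pd1) !pd_gz ?jet_dd // ?jet_ss //= => h.
  apply: dd_inj; apply/eqP; rewrite -subr_eq0 -oppr_eq0; apply/eqP.
  rewrite ?dt in h; by move/eqP: h; rewrite -subr_eq0 => /eqP h; rewrite -[RHS]h; ring.
apply: (base_vanish ed (c := c)); move: e; rewrite (Es_order0 o0) => e.
have : c.+1%:R * f = dd * (- pr f - (2%:R + dd * tau) * pd_d f + dd * Es f) + (2%:R + dd * tau) * (k%:R * f).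
  by rewrite e; ring.
by rewrite -ed => ->; ring.
Qed.

End Vanishing.

(** * Highest-order terms of the linearized equation *)

Section TopOrder.
Variables (R : numFieldType) (T : polyAlg R).
Local Notation P := (palg T).
Implicit Types (f g : P) (v : coord).
Local Notation gz := (gz T).
Local Notation gpsi := (gpsi T).
Local Notation rr := (rr T).
Local Notation dd := (dd T).
Local Notation ss := (ss T).
Local Notation tau := (tau T).
Local Notation gDx := (@gDx R T).
Local Notation gDy := (@gDy R T).
Local Notation gzyy := (gzyy T).

Lemma hij_Y v k : hij v -> pd v (gY T k) = 0.
Proof.
move=> h; rewrite /gY pdB !pd_mul pd_nat hij_X // basic_psi ?hij_jetc // -/dd jet_dd //; ring.
Qed.

Lemma Dy_top N l f : ordle N f -> (N < l)%N ->
  pd (Cz l.+1 false) (gDy f) = (l == N.+1)%:R * (gz 0 true * pd (Cz N true) f) /\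
  pd (Cz l true) (gDy f) = (l == N.+1)%:R * (pd (Cz N.+1 false) f - gz 1 false * pd (Cz N true) f).
Proof.
move=> oN lN; have [z1 z2] := oN l lN; have l0 : (0 < l)%N by case: l lN {z1 z2}.
have hp : hij (Cz l.+1 false) by rewrite /= ltnS l0.
have hq : hij (Cz l true) by rewrite /= l0 orbT.
rewrite /gDy !pd_der z1 z2 !raddf0 !add0r; split.
  rewrite (pder_congr (W := fun w => (l == N.+1)%:R * gz 0 true * (w == Cz N true)%:R)); last first.
    case=> [||a [|]|n].
    - by left; rewrite /= raddf0; ring.
    - by left; rewrite /= pd1; ring.
    - have [lt|le] := ltnP N a; first by right; have [_] := oN a lt.
      left; rewrite /= Cz_eq andbT; have [e|ne] := eqVneq l N.+1; last first.
        have [|-> _] := @T_high R T a l; first by lia.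
        by rewrite /=; ring.
      have [ea|nea] := eqVneq a N; first by rewrite e ea; have [-> _] := T_top T N; rewrite /=; ring.
      have [|-> _] := @T_high R T a l; first by lia.
      by rewrite /=; ring.
    - by left; rewrite /= pd_gz Cz_eq !andbF /=; ring.
    - by left; rewrite /= hij_Y //; ring.
  by rewrite pder_scalef -/(pd _ f); ring.
rewrite (pder_congr (W := fun w => (l == N.+1)%:R * (w == Cz N.+1 false)%:R +
   - ((l == N.+1)%:R * gz 1 false) * (w == Cz N true)%:R)); last first.
  case=> [||a [|]|n].
  - by left; rewrite /= raddf0; ring.
  - by left; rewrite /= pd1; ring.
  - have [lt|le] := ltnP N a; first by right; have [_] := oN a lt.
    left; rewrite /= !Cz_eq andbT andbF; have [e|ne] := eqVneq l N.+1; last first.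
      have [|_ ->] := @T_high R T a l; first by lia.
      by rewrite /=; ring.
    have [ea|nea] := eqVneq a N; first by rewrite e ea; have [_ ->] := T_top T N; rewrite /=; ring.
    have [|_ ->] := @T_high R T a l; first by lia.
    by rewrite /=; ring.
  - case: a => [|a]; first by left; rewrite /= pd_gz !Cz_eq; case: l l0 {lN z1 z2 hp hq} => // l _; rewrite /= ?andbF /=; ring.
    have [lt|le] := ltnP N a; first by right; have [] := oN a lt.
    left; rewrite /= pd_gz !Cz_eq /= !andbT !andbF ?eqSS.
    have [e|ne] := eqVneq l N.+1; first by rewrite e ?eqSS /=; ring.
    have -> : (a.+1 == l)%N = false by lia.
    by rewrite /=; ring.
  - by left; rewrite /= hij_Y //; ring.
by rewrite pder_addf !pder_scalef -!/(pd _ f); ring.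
Qed.

Lemma Dx_top N l f : ordle N f -> (N < l)%N ->
  pd (Cz l.+1 false) (gDx f) = pd (Cz l false) f /\ pd (Cz l true) (gDx f) = pd (Cz l.-1 true) f.
Proof.
move=> oN lN; have [z1 z2] := oN l lN; case: l lN z1 z2 => // l lN z1 z2.
by rewrite !hij_Dx ?z1 ?z2 ?raddf0 ?add0r //= orbT.
Qed.

Section Symmetry.
Variable V : coord -> P.
Hypothesis VDx : forall q, pder V (gDx_coef T q) = gDx (V q).
Hypothesis VDy : forall q, pder V (gDy_coef T q) = gDy (V q).

Local Notation Z := (V (Cz 0 false)).

Lemma V_p : V (Cz 1 false) = gDx Z. Proof. by rewrite -VDx pder_var. Qed.
Lemma V_q : V (Cz 0 true) = gDy Z. Proof. by rewrite -VDy pder_var. Qed.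
Lemma V_xy : gDy (gDx Z) = gDx (gDy Z).
Proof. by rewrite -V_p -V_q -VDy -VDx /= !pder_var. Qed.

Lemma linearized : gDy (gDy Z) = gz 0 true * gDx (gDx Z) + gDy Z * gz 2 false
  - gDx Z * gz 1 true - gz 1 false * gDx (gDy Z).
Proof.
rewrite -{1}V_q -VDy /= /gzyy !raddfB /= !pder_mul pder1 !pder_var.
have -> : V (Cz 2 false) = gDx (gDx Z) by rewrite -V_p -VDx pder_var.
have -> : V (Cz 1 true) = gDx (gDy Z) by rewrite -V_q -VDx pder_var.
by rewrite V_p V_q; ring.
Qed.

Definition taub : P := rr * gz 2 false + gz 1 true.
(** If V is extended to r and s, this is d V(r), and [WW] is - d V(s); likewise [taub] is d r_x. *)
Definition UU := rr * io (gDx Z) + io (gDy Z).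
Definition WW := ss * io (gDx Z) + io (gDy Z).

(** The linearization of (Dy + s Dx) r = - 1/d, cleared of denominators. *)
Lemma symmetry_Et : dd * Et UU = - (dd * tau + 1) * UU + (dd * taub + 1) * WW.
Proof.
rewrite /UU /WW raddfD /= EtM Et_rr !Et_io linearized V_xy.
rewrite !(rmorphD, rmorphB, rmorphM, rmorphN) /= io_p io_q !io_gz // /taub /tau /ss; ring.
Qed.

(** Here [a] is the derivative of Z along the N-th jet of r. It appears as the top coefficient of
    [UU], so the equation follows from [symmetry_Et] by [Et_lead]; [WW] contributes only for N = 0,
    when [tau] and [taub] contain the jets in question. *)
Lemma symmetry_lead N : ordle N Z ->
  let a := io (pd (Cz N.+1 false) Z) - ss * io (pd (Cz N true) Z) in
  dd * Et a = - N.+1%:R * (dd * tau) * a + (N == 0%N)%:R * dd * WW.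
Proof.
move=> oN a.
have hp l : (N < l)%N -> hij (Cz l.+1 false) by rewrite /= ltnS; case: l.
have hq l : (N < l)%N -> hij (Cz l true) by case: l => //= l _; rewrite orbT.
have UW t l : (N < l)%N -> (forall v, hij v -> pd v t = 0) ->
    let u := t * io (gDx Z) + io (gDy Z) in
    pd (Cz l.+1 false) u = t * io (pd (Cz l false) Z) +
       (l == N.+1)%:R * - (rr * ss) * io (pd (Cz N true) Z) /\
    pd (Cz l true) u = t * io (pd (Cz l.-1 true) Z) + (l == N.+1)%:R *
       (io (pd (Cz N.+1 false) Z) - (rr + ss) * io (pd (Cz N true) Z)).
  move=> lN ht /=; have [e1 e2] := Dy_top oN lN; have [e3 e4] := Dx_top oN lN.
  rewrite !pdD !pd_mul !jet_io ?hp ?hq // e1 e2 e3 e4 !ht ?hp ?hq //.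
  by rewrite !(rmorphM, rmorphB, rmorph_nat) /= io_p io_q; split; ring.
have lt1 := ltnSn N.
have [pU qU] := UW rr _ lt1 (@jet_rr R T); have [pW qW] := UW ss _ lt1 (@jet_ss R T).
rewrite -/UU -/WW eqxx /= in pU qU pW qW.
have oU : ordle N.+1 UU.
  move=> l lN; have [|e1 e2] := UW rr l _ (@jet_rr R T); first exact: ltnW.
  rewrite /UU e1 e2; have -> : (l == N.+1) = false by lia.
  case: l lN {e1 e2} => // l lN; have [z1 z2] := oN l lN.
  by rewrite z1 /= z2 rmorph0; split; ring.
have pUa : pd (Cz N.+2 false) UU = rr * a by rewrite pU /a; ring.
have qUa : pd (Cz N.+1 true) UU = a by rewrite qU /a; ring.
(* [WW] is free of the top jet of r. *)
have pqW : pd (Cz N.+2 false) WW = ss * pd (Cz N.+1 true) WW by rewrite pW qW; ring.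
have := Et_lead (ltn0Sn N) oU; rewrite pUa qUa EtM Et_rr => lead.
have h1 := hp _ lt1; have h2 := hq _ lt1.
have [t1 t2] : pd (Cz N.+2 false) tau = ss * (N == 0%N)%:R /\ pd (Cz N.+1 true) tau = (N == 0%N)%:R.
  by rewrite !pd_tau // !pd_gz !andbF !andbT !eqSS /= eq_sym; split; ring.
have [t3 t4] : pd (Cz N.+2 false) taub = rr * (N == 0%N)%:R /\ pd (Cz N.+1 true) taub = (N == 0%N)%:R.
  by rewrite /taub !pdD !pd_mul !jet_rr // !pd_gz !andbF !andbT !eqSS /= eq_sym; split; ring.
have sym := symmetry_Et.
move: sym lead pUa qUa pqW t1 t2 t3 t4; clearbody a; move: UU WW tau taub => u w t tb.
move=> sym lead pUa qUa pqW t1 t2 t3 t4.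
have e1 := congr1 (pd (Cz N.+2 false)) sym; have e2 := congr1 (pd (Cz N.+1 true)) sym.
rewrite !(pdD, pdN, pd_mul, pd1) !jet_dd // t1 t3 pUa pqW in e1.
rewrite !(pdD, pdN, pd_mul, pd1) !jet_dd // t2 t4 qUa in e2.
have lead2 : dd * (pd (Cz N.+2 false) (Et u) - ss * pd (Cz N.+1 true) (Et u)) =
    - (dd * t + 1) * (dd * a) + (N == 0%N)%:R * dd * dd * w.
  move: e1 e2; set x := pd _ (Et u); set y := pd _ (Et u); rewrite !mul0r !addr0 => e1 e2.
  by rewrite mulrBr e1 (mulrCA dd ss y) e2 /ss; ring.
rewrite lead in lead2; apply: dd_inj; rewrite -natr1.
have -> : dd * (dd * Et a) = dd * (-1 * a + rr * Et a - ss * Et a) + dd * a by rewrite /ss; ring.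
have -> : dd * (- (N%:R + 1) * (dd * t) * a + (N == 0%N)%:R * dd * w) =
   - (dd * t + 1) * (dd * a) + (N == 0%N)%:R * dd * dd * w + dd * a - dd * dd * N%:R * t * a by ring.
by rewrite -lead2 -natr1; ring.
Qed.

Lemma symmetry_order0 : ordle 0 Z.
Proof.
have [n on] := ordle_ex Z; elim: n on => // n IHn on; apply: IHn.
set a := io (pd (Cz n.+2 false) Z) - ss * io (pd (Cz n.+1 true) Z).
have a0 : a = 0.
  have /= := symmetry_lead on; rewrite -/a mul0r mul0r addr0 => e.
  (* With k = n + 2 the constant term vanishes when c + 1 = 2 k, whence c = 2 n + 3. *)
  apply: (@claim_vanish _ _ n.+2 (n.+1 + n.+2)%N); rewrite e -[in RHS]natr1 natrD -!natr1; ring.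
have [|z1 z2] := @io_free _ _ (pd (Cz n.+2 false) Z) (- pd (Cz n.+1 true) Z).
  by rewrite -[RHS]a0 /a rmorphN; ring.
move=> l; rewrite leq_eqVlt => /orP[/eqP <-|]; last exact: on.
by split=> //; apply/eqP; rewrite -oppr_eq0 z2.
Qed.

End Symmetry.
End TopOrder.

(** * The generating function is affine in z_x, z_y *)

Section OrderZero.
Variables (R : numFieldType) (T : polyAlg R).
Local Notation P := (palg T).
Implicit Types (f g : P) (v : coord).
Local Notation gz := (gz T).
Local Notation gpsi := (gpsi T).
Local Notation rr := (rr T).
Local Notation dd := (dd T).
Local Notation ss := (ss T).
Local Notation tau := (tau T).
Local Notation taub := (taub T).
Local Notation gDx := (@gDx R T).
Local Notation gDy := (@gDy R T).
Local Notation pr := (pd (T := T) (Cz 1 false)).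
Local Notation pd_d := (pd (T := T) (Cz 0 true)).

Lemma rr_sE f : rr_s f = pder (fun w => (w == Cz 1 false)%:R + (w == Cz 0 true)%:R) f.
Proof. by rewrite pder_addf. Qed.

Lemma rr_sM f g : rr_s (f * g) = f * rr_s g + rr_s f * g.
Proof. by rewrite !rr_sE pder_mul. Qed.
Lemma rr_sB f g : rr_s (f - g) = rr_s f - rr_s g.
Proof. by rewrite !rr_sE raddfB. Qed.
Lemma rr_sD f g : rr_s (f + g) = rr_s f + rr_s g.
Proof. by rewrite !rr_sE raddfD. Qed.
Lemma rr_s_rr : rr_s rr = 1. Proof. by rewrite /rr_s pr_rr pd_d_rr addr0. Qed.
Lemma rr_s_dd : rr_s dd = 1. Proof. by rewrite /rr_s pr_dd pd_d_dd add0r. Qed.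
Lemma rr_s_ss : rr_s ss = 0. Proof. by rewrite rr_sB rr_s_rr rr_s_dd subrr. Qed.

Lemma map_basic_poly V (p : {poly P}) : (forall i, basic p`_i) -> (forall v, ~~ jetc v -> V v = 0) ->
  map_poly (pder V) p = 0.
Proof.
move=> bp V0; apply/polyP => i; rewrite coef_map_id0 ?raddf0 // coef0.
by rewrite (pder_basic_eq (W := fun _ => 0)) ?pder0.
Qed.

Lemma rr_s_horner (p : {poly P}) : (forall i, basic p`_i) -> rr_s p.[ss] = 0.
Proof.
move=> bp; rewrite rr_sE pder_horner -rr_sE rr_s_ss mulr0 addr0 map_basic_poly ?horner0 //.
by case=> [||[|[|a]] [|]|n] //= _; rewrite addr0.
Qed.

Lemma rr_s_Es f : rr_s (Es f) = Es (rr_s f).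
Proof.
rewrite /rr_s /Es !pd_der raddfD /= addrACA -pder_addf.
rewrite [X in _ + X](pder_ext (W := fun _ => 0)) ?pder0 ?addr0 // => v.
by rewrite -/(rr_s _) rr_s_horner // => i; apply: basic_evc.
Qed.

Lemma rr_s_pd v f : rr_s (pd v f) = pd v (rr_s f).
Proof. by rewrite /rr_s pdD pdpd [pd (Cz 0 true) _]pdpd. Qed.

Lemma ordle_pd n v f : ordle n f -> ordle n (pd v f).
Proof. by move=> o l lt; have [e1 e2] := o l lt; rewrite pdpd e1 pdpd e2 !raddf0. Qed.

Lemma ordle_io f : ordle 0 f -> ordle 0 (io f).
Proof.
move=> o l lt; have [e1 e2] := o l lt.
by rewrite !jet_io /= ?e1 ?e2 ?rmorph0 ?ltnS ?lt ?orbT.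
Qed.

Lemma ordle_hij f v : ordle 0 f -> hij v -> pd v f = 0.
Proof.
move=> o; case: v => // a b h; case: a h => [|[|a]]; case: b => // _.
- by have [_] := o 1%N isT.
- by have [_] := o a.+2 isT.
- by have [] := o a.+1 isT.
Qed.

Lemma pd_q1_Et f : ordle 0 f -> pd (Cz 1 true) (Et f) = - (dd * pd_d f).
Proof.
move=> o; have h : hij (Cz 1 true) by [].
have z4 : pd (Cz 1 true) (Es f) = 0.
  rewrite /Es pd_der (ordle_hij o h) raddf0 add0r (pder_ext (W := fun _ => 0)) ?pder0 // => v.
  exact: jet_evc.
have z2 : pd (Cz 1 true) (pr f) = 0 by rewrite pdpd (ordle_hij o h) raddf0.
have z3 : pd (Cz 1 true) (pd_d f) = 0 by rewrite pdpd (ordle_hij o h) raddf0.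
have z1 : pd (Cz 1 true) tau = 1 by rewrite pd_tau // !pd_gz /=; ring.
have z5 : pd (Cz 1 true) (2%:R + dd * tau) = dd by rewrite pdD pd_nat pd_mul z1 jet_dd //; ring.
by rewrite Es_order0 // pdD pdB pdN !pd_mul z2 z3 z4 z5 jet_dd //; ring.
Qed.

Section Symmetry.
Variable V : coord -> P.
Hypothesis VDx : forall q, pder V (gDx_coef T q) = gDx (V q).
Hypothesis VDy : forall q, pder V (gDy_coef T q) = gDy (V q).

Local Notation Z := (V (Cz 0 false)).

Definition symA := pd_d Z.
Definition symB := pr Z.
Definition symC := Z - symA * gz 0 true - symB * gz 1 false.

Lemma Z_ABC : Z = symA * gz 0 true + symB * gz 1 false + symC.
Proof. by rewrite /symC; ring. Qed.

Lemma dd_WW : dd * WW V = Et (io Z).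
Proof. by rewrite Et_io /WW; ring. Qed.

(** The first equation is the coefficient of z_xy in [symmetry_lead] for N = 0, the second is the
    rest. Differentiated in r at fixed s, they say that h = [rr_s a] has degree 1 in d and [rr_s h]
    = d Es h, so h vanishes by [base_vanish]: at fixed s, Z is affine in r. *)
Lemma order0_eqs : let a := rr_s (io Z) in
  [/\ dd * pd_d a = a + pd_d (io Z), rr_s a = dd * Es a - Es (io Z) & rr_s a = 0].
Proof.
set z := io Z; move=> a; have oz : ordle 0 z by apply/ordle_io/(symmetry_order0 VDx VDy).
have oa : ordle 0 a.
  by move=> l lt; rewrite /a -!rr_s_pd; have [-> ->] := oz l lt; rewrite rr_sE raddf0.
have e : dd * Et a = - (dd * tau * a) + Et z.
  have /= := symmetry_lead VDx VDy (symmetry_order0 VDx VDy).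
  by rewrite -rr_s_io -/z -/a mul1r dd_WW -/z => ->; ring.
have epd : dd * pd_d a = a + pd_d z.
  have hq : hij (Cz 1 true) by [].
  have := congr1 (pd (Cz 1 true)) e; rewrite pdD pdN !pd_mul !pd_q1_Et // jet_dd // pd_tau // !pd_gz.
  rewrite (ordle_hij oa hq) //= => h; do 1![apply: dd_inj]; apply/eqP; rewrite -subr_eq0 -oppr_eq0; apply/eqP.
  by move/eqP: h; rewrite -subr_eq0 => /eqP h; rewrite -[RHS]h; ring.
have e2 : rr_s a = dd * Es a - Es z.
  move: e; rewrite !Es_order0 // => e; apply: dd_inj.
  have za : pr z = a - pd_d z by rewrite /a /rr_s addrK.
  apply/eqP; rewrite -subr_eq0 -oppr_eq0; apply/eqP.
  move/eqP: e; rewrite -subr_eq0 => /eqP e; rewrite -[RHS]e za /rr_s.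
  transitivity (- dd * pr a - dd * pd_d a + dd * dd * Es a - dd * Es z
     + (tau * dd + 1) * (a + pd_d z - dd * pd_d a)).
    have -> : a + pd_d z - dd * pd_d a = 0 by rewrite epd subrr.
    by ring.
  by ring.
split=> //; set h := rr_s a.
have dh : dd * pd_d h = h.
  have := congr1 (@rr_s R T) epd; rewrite rr_sM rr_sD rr_s_dd !rr_s_pd -/a -/h mul1r => /addIr //.
have sh : rr_s h = dd * Es h.
  by rewrite {1}/h e2 rr_sB rr_sM rr_s_dd !rr_s_Es -/a -/h; ring.
apply: (@base_vanish _ _ 1 0); rewrite mul1r //.
by have -> : pr h = rr_s h - pd_d h by [rewrite /rr_s addrK]; rewrite sh mulrBr mulrBr dh; ring.
Qed.

Lemma second_derivs : [/\ pr symB = 0, pd_d symB = 0, pr symA = 0 & pd_d symA = 0].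
Proof.
have /= [e1 _ e3] := order0_eqs.
set x := pr symB; set y := pd_d symB; set w := pd_d symA.
have yE : pr symA = y by rewrite /symA pdpd.
rewrite rr_s_io -/symA -/symB in e1 e3.
have [h1 h2] : x + gz 0 true * w = 0 /\ gz 1 false * w - 2%:R * y = 0.
  apply: io_free; rewrite -[RHS]e3 rr_sB rr_sM rr_s_ss !rr_s_io -/x -/y yE -/w.
  by rewrite !(rmorphD, rmorphB, rmorphM, rmorph1) /= io_p io_q; ring.
have h3 : gz 1 false * y - x + gz 0 true * w = 0.
  apply/io_eq0/dd_reg.
  move: e1; rewrite pdB pd_mul !pd_dd_io -/symA -/symB -/x -/y -/w yE => e1.
  have es : pd_d ss = -1 by rewrite pdB pd_d_rr pd_d_dd sub0r.
  rewrite es in e1; rewrite !(rmorphD, rmorphB, rmorphM) /= io_p io_q.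
  move/eqP: e1; rewrite -subr_eq0 => /eqP e1; rewrite -[RHS]e1 /ss; ring.
have w0 : w = 0.
  apply/io_eq0/dd_reg/dd_reg.
  (* The discriminant z_x^2 + 4 z_y becomes d^2 under [io]. *)
  have : (gz 1 false * gz 1 false + 4%:R * gz 0 true) * w = 0.
    transitivity (2%:R * (gz 1 false * y - x + gz 0 true * w) + 2%:R * (x + gz 0 true * w)
      + gz 1 false * (gz 1 false * w - 2%:R * y)); first by ring.
    by rewrite h1 h2 h3; ring.
  move=> /(congr1 (@io R T)); rewrite rmorph0 !(rmorphD, rmorphM, rmorph_nat) /= io_p io_q => h.
  by rewrite -[RHS]h /ss; ring.
move: h1 h2; rewrite w0 !mulr0 addr0 sub0r => -> /eqP; rewrite oppr_eq0 => /eqP h2.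
by rewrite yE; split=> //; apply: (@nat_reg _ _ 1).
Qed.

Lemma basic_from0 f : ordle 0 f -> pr f = 0 -> pd_d f = 0 -> basic f.
Proof.
move=> o e1 e2; case=> // a b; case: a => [|[|a]]; case: b => //= _.
- by have [_] := o 1%N isT.
- by have [_] := o a.+2 isT.
- by have [] := o a.+1 isT.
Qed.

Lemma basic_A : basic symA.
Proof.
have [_ _ e1 e2] := second_derivs; apply: basic_from0 => //.
exact/ordle_pd/(symmetry_order0 VDx VDy).
Qed.
Lemma basic_B : basic symB.
Proof.
have [e1 e2 _ _] := second_derivs; apply: basic_from0 => //.
exact/ordle_pd/(symmetry_order0 VDx VDy).
Qed.
Lemma basic_C : basic symC.
Proof.
have [e1 e2 e3 e4] := second_derivs; apply: basic_from0.
- move=> l lt; have [z1 z2] := symmetry_order0 VDx VDy lt.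
  have [a1 a2] := ordle_pd (Cz 0 true) (symmetry_order0 VDx VDy) lt.
  have [b1 b2] := ordle_pd (Cz 1 false) (symmetry_order0 VDx VDy) lt.
  rewrite /symC /symA /symB !pdB !pd_mul z1 z2 a1 a2 b1 b2 !pd_gz !andbF.
  by case: l lt {z1 z2 a1 a2 b1 b2} => // l _ /=; split; ring.
- by rewrite /symC !pdB !pd_mul e1 e3 !pd_gz -/symB /=; ring.
- by rewrite /symC !pdB !pd_mul e2 e4 !pd_gz -/symA /=; ring.
Qed.

Lemma io_Z : io Z = symC + (rr + ss) * symB - rr * ss * symA.
Proof.
rewrite {1}Z_ABC; move: symA symB symC basic_A basic_B basic_C => A B C bA bB bC.
by rewrite !(rmorphD, rmorphM) /= io_p io_q !io_basic //; ring.
Qed.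

Lemma rr_s_io_Z : rr_s (io Z) = symB - ss * symA.
Proof. by rewrite rr_s_io -/symA -/symB !io_basic //; [exact: basic_A|exact: basic_B]. Qed.

Lemma Es_C : Es symC = ss ^+ 2 * Es symA - 2%:R * ss * Es symB.
Proof.
have /= [_ e2 e3] := order0_eqs.
move: e2; rewrite e3 rr_s_io_Z io_Z => /esym/eqP; rewrite subr_eq0 => /eqP.
move: symA symB symC => A B C.
rewrite !(EsB, EsD, EsM, Es_rr, Es_dd) => e.
apply/eqP; rewrite -subr_eq0; apply/eqP; move/eqP: e; rewrite eq_sym -subr_eq0 => /eqP e.
by rewrite -[RHS]e /ss; ring.
Qed.

Definition symK := ss * Es symA - Es symB.

(** Divided by - d this reads V(s) = B s_x + A s_y + K, so K is the s-component of V - B Dx - A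
    Dy. *)
Lemma WWE : WW V = (symB - rr * symA) * tau - symA - dd * symK.
Proof.
apply: dd_inj; rewrite dd_WW io_Z.
have Eb f : basic f -> Et f = dd * Es f.
  by move=> bf; rewrite Es_order0 ?bf //; [ring|move=> l lt; rewrite !bf //= lt orbT].
have eC := Es_C; rewrite /symK; move: symA symB symC basic_A basic_B basic_C eC => A B C bA bB bC eC.
rewrite !(EtB, EtD, EtM, Et_rr, Et_dd) !Eb // eC /ss; ring.
Qed.

Lemma UUE : UU V = (symB - ss * symA) * taub - symA + dd * th symK.
Proof.
have -> : UU V = th (WW V) by rewrite /UU /WW rmorphD rmorphM /= th_ss !th_io.
have tt : th tau = taub by rewrite /tau /taub rmorphD rmorphM /= th_ss /th !psub_var.
rewrite WWE; move: symA symB symK basic_A basic_B => A B K bA bB.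
by rewrite !(rmorphB, rmorphM) /= tt th_rr th_dd (th_basic bA) (th_basic bB); ring.
Qed.

End Symmetry.
End OrderZero.

(** * The recursion for the coefficients K_j *)

Section Recursion.
Variables (R : numFieldType) (T : polyAlg R).
Local Notation P := (palg T).
Implicit Types (f g : P) (v : coord).
Local Notation gz := (gz T).
Local Notation gpsi := (gpsi T).
Local Notation rr := (rr T).
Local Notation dd := (dd T).
Local Notation ss := (ss T).
Local Notation tau := (tau T).
Local Notation taub := (taub T).
Local Notation gDx := (@gDx R T).
Local Notation gDy := (@gDy R T).
Local Notation pr := (pd (T := T) (Cz 1 false)).
Local Notation pd_d := (pd (T := T) (Cz 0 true)).

(** An element with derivative 1 is transcendental over the constants of V in characteristic 0:
    applying V to a relation gives one of smaller degree. *)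
Lemma poly_indep V x (p : {poly P}) : pder V x = 1 -> (forall i, pder V p`_i = 0) ->
  p.[x] = 0 -> p = 0.
Proof.
move=> Vx; have [n] := ubnP (size p); elim: n p => // n IH p sp cp px.
have dp0 : p^`() = 0.
  have [->|p0] := eqVneq p 0; first by rewrite deriv0.
  apply: IH.
  - by apply: leq_trans (lt_size_deriv p0) _; rewrite -ltnS.
  - by move=> i; rewrite coef_deriv raddfMn /= cp mul0rn.
  - have := congr1 (pder V) px; rewrite pder_horner Vx mulr1 raddf0.
    have -> : map_poly (pder V) p = 0.
      by apply/polyP => i; rewrite coef_map_id0 ?raddf0 // coef0.
    by rewrite horner0 add0r.
have pc i : p`_i.+1 = 0.
  apply: (@nat_reg _ _ i); have := congr1 (fun q : {poly P} => q`_i) dp0.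
  by rewrite /= coef_deriv coef0 mulr_natl.
have pE : p = (p`_0)%:P by apply/polyP => -[|i]; rewrite coefC //= pc.
by move: px; rewrite pE hornerC => ->; rewrite polyC0.
Qed.

(** Independence of r and s over the basic polynomials, in two steps: r at fixed s, where [rr_s]
    annihilates the coefficients, then s by means of minus the derivative in d. *)
Lemma bivariate_indep (F : {poly {poly P}}) : (forall j i, basic F`_j`_i) ->
  (map_poly (horner_eval ss) F).[rr] = 0 -> F = 0.
Proof.
move=> bF F0; have := @poly_indep _ rr _ _ _ F0.
move=> /(_ (fun w => (w == Cz 1 false)%:R + (w == Cz 0 true)%:R)).
rewrite -rr_sE rr_s_rr => /(_ erefl) h.
have : map_poly (horner_eval ss) F = 0.
  by apply: h => i; rewrite -rr_sE coef_map /=; apply: rr_s_horner.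
move=> F1; apply/polyP => j; rewrite coef0.
apply: (@poly_indep (fun w => (-1) * (w == Cz 0 true)%:R) ss).
- by rewrite pder_scalef -/(pd _ ss) pdB pd_d_rr pd_d_dd; ring.
- by move=> i; rewrite pder_scalef -/(pd _ _) bF // mulr0.
- by have := congr1 (fun q : {poly P} => q`_j) F1; rewrite coef_map coef0.
Qed.

(** As f involves finitely many variables, sum_a s^a Ea f is a finite sum; its length is left free
    so that several polynomials can share one. *)
Lemma Es_poly f : exists n, (forall i, (n <= i)%N -> Ea i f = 0) /\
  forall m, (n <= m)%N -> Es f = (\poly_(i < m) Ea i f).[ss].
Proof.
have [s _ [_ hs]] := pder_expand f.
pose n := \max_(v <- s) size (evc T v).
have sz v : v \in s -> (size (evc T v) <= n)%N.
  by move=> vs; apply: (leq_bigmax_seq (P := xpredT) (F := fun v => size (evc T v)) v vs isT).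
exists n; split=> [i le|m le].
  rewrite /Ea hs big_seq big1 // => v vs.
  by rewrite nth_default ?mul0r //; apply: leq_trans le; apply: sz.
rewrite /Es hs horner_poly big_seq.
under eq_bigr => v vs do rewrite (@horner_coef_wide _ m) ?(leq_trans (sz v vs)) // mulr_suml.
rewrite -big_seq exchange_big; apply: eq_bigr => i _ /=.
by rewrite /Ea hs mulr_suml; apply: eq_bigr => v _; rewrite mulrAC.
Qed.

Lemma basic_Ea i f : basic f -> basic (Ea i f).
Proof. by move=> bf; apply: basic_pder => // v _; apply: basic_evc. Qed.

(** The outer variable stands for r, the inner one for s. *)
Definition evrs (F : {poly {poly P}}) := (map_poly (horner_eval ss) F).[rr].
Lemma evrsD F G : evrs (F + G) = evrs F + evrs G.
Proof. by rewrite /evrs rmorphD hornerD. Qed.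
Lemma evrsN F : evrs (- F) = - evrs F.
Proof. by rewrite /evrs rmorphN hornerN. Qed.
Lemma evrsM F G : evrs (F * G) = evrs F * evrs G.
Proof. by rewrite /evrs rmorphM hornerM. Qed.
Lemma evrsX : evrs 'X = rr.
Proof. by rewrite /evrs map_polyX hornerX. Qed.
Lemma evrsC (p : {poly P}) : evrs p%:P = p.[ss].
Proof. by rewrite /evrs map_polyC hornerC. Qed.
Lemma evrs_map (p : {poly P}) : evrs (map_poly polyC p) = p.[rr].
Proof.
by rewrite /evrs -map_poly_comp map_poly_id // => x _ /=; rewrite /horner_eval hornerC.
Qed.
Definition bieval := (evrsD, evrsN, evrsM, evrsX, evrs_map, evrsC).

Section Symmetry.
Variable V : coord -> P.
Hypothesis VDx : forall q, pder V (gDx_coef T q) = gDx (V q).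
Hypothesis VDy : forall q, pder V (gDy_coef T q) = gDy (V q).

Local Notation A := (symA V).
Local Notation B := (symB V).
Local Notation K := (symK V).

(* The coefficient of s^j in [symK]. *)
Definition symKc (j : nat) : P := if j is i.+1 then Ea i A - Ea j B else - Ea 0 B.

Arguments symKc : simpl never.

Lemma basic_Kc j : basic (symKc j).
Proof.
have bA := basic_A VDx VDy; have bB := basic_B VDx VDy.
by case: j => [|j]; [apply/basicN|apply/basicB]; apply: basic_Ea.
Qed.

(** This is [symmetry_Et] with [UUE] and [WWE] inserted. The second derivatives of z cancel, and an
    identity between polynomials in r and s with basic coefficients remains. *)
Lemma K_functional (k : {poly P}) : (forall i, basic k`_i) -> K = k.[ss] ->
  dd ^+ 2 * (map_poly (@Es R T) k).[rr] = dd * (Es A + k^`().[rr]) + k.[rr] - k.[ss].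
Proof.
move=> bk Kk.
have thk : th K = k.[rr].
  rewrite Kk -th_ss -horner_map; congr (_.[_]); apply/polyP => i; rewrite coef_map /= th_basic //.
have bA := basic_A VDx VDy; have bB := basic_B VDx VDy.
have sym := symmetry_Et VDx VDy.
have EB f : basic f -> Et f = dd * Es f.
  by move=> bf; rewrite Es_order0 ?bf //; [ring|move=> l lt; rewrite !bf //= lt orbT].
have Ek : Et k.[rr] = dd * (map_poly (@Es R T) k).[rr] - k^`().[rr].
  rewrite {1}/Et pder_horner -/(Et rr) Et_rr mulrN1; congr (_ - _).
  rewrite -[RHS]hornerZ; congr (_.[_]); apply/polyP => i.
  by rewrite coefZ !coef_map_id0 ?raddf0 //; apply: EB.
have Etb : dd * Et taub = tau - taub.
  rewrite /taub EtD EtM Et_rr /Et !pder_var /=.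
  have -> : io (gDx (gzyy T)) = - (rr * ss) * gz 3 false - (rr + ss) * gz 2 true.
    rewrite /gDx /gzyy !raddfB /= !pder_mul pder1 !pder_var /=.
    rewrite !(rmorphD, rmorphB, rmorphM, rmorph1, rmorph0) /= -/(gz 1 false) -/(gz 0 true) io_p io_q !io_gz //.
    by ring.
  by rewrite /tau /ss; ring.
move: sym; rewrite (UUE VDx VDy) (WWE VDx VDy) thk.
have eA := EB _ bA; have eB := EB _ bB.
have ds : Es B = ss * Es A - K by rewrite /symK; ring.
move: ds eA eB Etb Ek; rewrite Kk; move: (Es A) (Es B) A B taub (map_poly _ k).[rr] k^`().[rr] => eA eB A B tb ek k'.
move=> -> EtA EtB' Etb Ek.
rewrite !(EtB, EtD, EtM) EtB' EtA ?Et_ss ?Et_rr Et_dd Ek => e.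
apply: dd_inj; apply/eqP; rewrite -subr_eq0; apply/eqP; move/eqP: e; rewrite -subr_eq0 => /eqP e; rewrite -[RHS]e.
have -> : tau = dd * Et tb + tb by rewrite Etb; ring.
by rewrite /ss; ring.
Qed.

Lemma K_recursion : (exists n, forall j, (n <= j)%N -> symKc j = 0) /\
  forall i, [/\ Ea i A = - (2 * i.+1)%:R * symKc i.+1, Ea i B = - (2 * i).+1%:R * symKc i &
    forall j, Ea i (symKc j) = (j + 2 * i + 3)%:R * symKc (i + j).+2].
Proof.
have [nA [A0 EA]] := Es_poly A; have [nB [B0 EB]] := Es_poly B.
pose n := (maxn nA nB).+1.
have K0 j : (n <= j)%N -> symKc j = 0.
  by case: j => [//|j] lt; rewrite /symKc A0 ?B0 ?subr0 //; move: lt; rewrite /n; lia.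
pose k := \poly_(j < n) symKc j.
have kE j : k`_j = symKc j by rewrite coef_poly; case: ltnP => // /K0 ->.
have bk i : basic k`_i by rewrite kE; apply: basic_Kc.
pose u := \poly_(i < n) Ea i A.
have uE i : u`_i = Ea i A by rewrite coef_poly; case: ltnP => // le; rewrite A0 //; move: le; rewrite /n; lia.
have Kk : K = k.[ss].
  have -> : k = 'X * u - \poly_(i < n) Ea i B.
    apply/polyP => -[|i]; rewrite coefB coefXM kE; first by rewrite /n /symKc /= sub0r coef_poly.
    rewrite /symKc /= uE coef_poly.
    by case: ltnP => // le; rewrite B0 //; move: le; rewrite /n; lia.
  by rewrite hornerD hornerN hornerM hornerX /symK (EA n) ?(EB n) // /n; lia.
have fe := K_functional bk Kk.
have [N [NE EN]] : exists N, (forall i j, (N <= i)%N -> Ea i (symKc j) = 0) /\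
   forall j, Es (symKc j) = (\poly_(i < N) Ea i (symKc j)).[ss].
  have ex m : exists N, forall j, (j < m)%N -> (forall i, (N <= i)%N -> Ea i (symKc j) = 0) /\
      forall M, (N <= M)%N -> Es (symKc j) = (\poly_(i < M) Ea i (symKc j)).[ss].
    elim: m => [|m [N IH]]; first by exists 0%N.
    have [N' [h1 h2]] := Es_poly (symKc m); exists (maxn N N') => j.
    rewrite ltnS leq_eqVlt => /orP[/eqP->|/IH[h3 h4]]; split=> i; rewrite geq_max => /andP[l1 l2]; auto.
  have [N hN] := ex n; exists N; split=> [i j le|j].
    by have [/hN[h _]|/K0->] := ltnP j n; [apply: h|rewrite raddf0].
  have [/hN[_ h]|/K0->] := ltnP j n; first exact: h.
  by rewrite raddf0 horner_poly big1 // => i _; rewrite raddf0 mul0r.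
pose Q : {poly {poly P}} := \poly_(j < n) \poly_(i < N) Ea i (symKc j).
have QE i j : Q`_j`_i = Ea i (symKc j).
  rewrite coef_poly; case: ltnP => [_|/K0->]; last by rewrite coef0 raddf0.
  by rewrite coef_poly; case: ltnP => // le; rewrite NE.
(* The identity [fe] over formal r and s, with (r - s)^2 Q and (r - s) (u + k') multiplied out so
   that coefficients can be read off. *)
pose F : {poly {poly P}} := Q * 'X * 'X - ('X)%:P * (Q * 'X) - ('X)%:P * (Q * 'X)
  + ('X)%:P * (('X)%:P * Q)
  - ((u%:P + map_poly polyC k^`()) * 'X - ('X)%:P * (u%:P + map_poly polyC k^`())) - map_poly polyC k + k%:P.
have F0 : F = 0.
  apply: bivariate_indep => [j i|].
    have bu i' : basic u`_i' by rewrite uE; apply/basic_Ea/(basic_A VDx VDy).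
    have bQ j' i' : basic Q`_j'`_i' by rewrite QE; apply/basic_Ea/basic_Kc.
    have bC (p : {poly P}) : (forall i', basic p`_i') -> forall j' i', basic (map_poly polyC p)`_j'`_i'.
      by move=> bp j' i'; rewrite coef_map coefC; case: ifP => _ //; apply: basic0.
    have bC' (p : {poly P}) : (forall i', basic p`_i') -> forall j' i', basic (p%:P : {poly {poly P}})`_j'`_i'.
      by move=> bp j' i'; rewrite coefC; case: ifP => _ //; rewrite coef0; apply: basic0.
    have bX (G : {poly {poly P}}) : (forall j' i', basic G`_j'`_i') -> forall j' i', basic (G * 'X)`_j'`_i'.
      by move=> bG j' i'; rewrite coefMX; case: ifP => _ //; rewrite coef0; apply: basic0.
    have bXC (G : {poly {poly P}}) : (forall j' i', basic G`_j'`_i') -> forall j' i', basic (('X)%:P * G)`_j'`_i'.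
      by move=> bG j' i'; rewrite coefCM coefXM; case: ifP => _ //; apply: basic0.
    have bd i' : basic k^`()`_i' by rewrite coef_deriv -mulr_natl; apply: basicM => //; apply: basic_nat.
    have bS : forall j' i', basic (u%:P + map_poly polyC k^`() : {poly {poly P}})`_j'`_i'.
      by move=> j' i'; rewrite !coefD; apply: basicD; [apply: bC'|apply: bC].
    rewrite /F !(coefD, coefN).
    do !(apply: basicD || apply: basicN); auto.
  rewrite -/(evrs F) /F !(bieval, hornerX) -/u.
  have -> : evrs Q = (map_poly (@Es R T) k).[rr].
    congr (_.[_]).
    apply/polyP => j; rewrite coef_map coef_map_id0 ?raddf0 // kE EN /=.
    by rewrite coef_poly; case: ltnP => // /K0 ->; rewrite /horner_eval horner0 horner_poly big1 // => i _; rewrite raddf0 mul0r.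
  have -> : u.[ss] = Es A by rewrite (EA n) // /n; lia.
  by move/eqP: fe; rewrite -subr_eq0 => /eqP fe; rewrite -[RHS]fe /ss; ring.
have cF i j : F`_j`_i = 0 by rewrite F0 !coef0.
split; first by exists n.
pose cfs := (coefD, coefN, coefMX, coefCM, coefXM, coefC, coef_map).
(* [cF i j] is the coefficient of s^i r^j. The powers r^(j+2) give a second-order recursion in i for
   Ea i K_j, with [c0] and [c1] as initial values; r^0 gives Ea i A. *)
have c0 j := cF 0%N j.+2; have c1 j := cF 1%N j.+2; have c2 i j := cF i.+2 j.+2.
have u0 := cF 1%N 0%N; have u1 i := cF i.+2 0%N; clear cF.
have c0' j : Ea 0 (symKc j) = (j + 3)%:R * symKc j.+2.
  move: (c0 j); rewrite /F; do 4!rewrite ?cfs /=. rewrite ?coef0 ?QE ?kE ?uE ?coef_deriv ?kE.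
  by move=> h; apply/eqP; rewrite -subr_eq0; apply/eqP; rewrite -[RHS]h; ring.
have c1' j : Ea 1 (symKc j) - 2%:R * Ea 0 (symKc j.+1) = - (j + 3)%:R * symKc j.+3.
  move: (c1 j); rewrite /F; do 4!rewrite ?cfs /=. rewrite ?coef0 ?QE ?kE ?uE ?coef_deriv ?kE.
  by move=> h; apply/eqP; rewrite -subr_eq0; apply/eqP; rewrite -[RHS]h; ring.
have c2' i j : Ea i.+2 (symKc j) - 2%:R * Ea i.+1 (symKc j.+1) + Ea i (symKc j.+2) = 0.
  move: (c2 i j); rewrite /F; do 4!rewrite ?cfs /=. rewrite ?coef0 ?QE ?kE ?uE ?coef_deriv ?kE.
  by move=> h; apply/eqP; rewrite -subr_eq0; apply/eqP; rewrite -[RHS]h; ring.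
have u0' : Ea 0 A = - 2%:R * symKc 1.
  move: u0; rewrite /F; do 4!rewrite ?cfs /=. rewrite ?coef0 ?QE ?kE ?uE ?coef_deriv ?kE.
  by move=> h; apply/eqP; rewrite -subr_eq0; apply/eqP; rewrite -[RHS]h; ring.
have u1' i : Ea i (symKc 0) = - Ea i.+1 A - symKc i.+2.
  move: (u1 i); rewrite /F; do 4!rewrite ?cfs /=. rewrite ?coef0 ?QE ?kE ?uE ?coef_deriv ?kE.
  by move=> h; apply/eqP; rewrite -subr_eq0; apply/eqP; rewrite -[RHS]h; ring.
have rec i : (forall j, Ea i (symKc j) = (j + 2 * i + 3)%:R * symKc (i + j).+2) /\
             (forall j, Ea i.+1 (symKc j) = (j + 2 * i.+1 + 3)%:R * symKc (i.+1 + j).+2).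
  elim: i => [|i [IH1 IH2]]; split=> // j.
  - by rewrite muln0 addn0 c0'.
  - move: (c1' j); rewrite c0' => /(canRL (subrK _)) ->; rewrite add1n; ring.
  - move: (c2' i j); rewrite IH1 IH2.
    have -> : (i + j.+2).+2 = (i.+2 + j).+2 by lia.
    have -> : (i.+1 + j.+1).+2 = (i.+2 + j).+2 by lia.
    move=> h; apply/eqP; rewrite -subr_eq0; apply/eqP; rewrite -[RHS]h.
    by rewrite !(natrD, natrM) -!natr1; ring.
have recA i : Ea i A = - (2 * i.+1)%:R * symKc i.+1.
  case: i => [|i]; first by rewrite u0'.
  by move: (u1' i); rewrite (rec i).1 add0n addn0 => h; apply/eqP; rewrite -subr_eq0;
    apply/eqP; move/eqP: h; rewrite -subr_eq0 => /eqP h;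
    rewrite -[RHS]h !(natrD, natrM) -!natr1; ring.
move=> i; split=> //; last exact: (rec i).1.
case: i => [|i]; first by rewrite /symKc; ring.
have -> : Ea i.+1 B = Ea i A - symKc i.+1 by rewrite /symKc; ring.
by rewrite recA; ring.
Qed.
End Symmetry.
End Recursion.

(** * The nonlocal components *)

Section Covering.
Variables (R : numFieldType) (T : polyAlg R).
Local Notation P := (palg T).
Implicit Types (f g : P) (v : coord).
Local Notation gz := (gz T).
Local Notation gpsi := (gpsi T).
Local Notation rr := (rr T).
Local Notation dd := (dd T).
Local Notation ss := (ss T).
Local Notation tau := (tau T).
Local Notation taub := (taub T).
Local Notation gDx := (@gDx R T).
Local Notation gDy := (@gDy R T).
Local Notation gzyy := (gzyy T).
Local Notation eps := (eps T).
Local Notation pr := (pd (T := T) (Cz 1 false)).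
Local Notation pd_d := (pd (T := T) (Cz 0 true)).

Lemma gDxM f g : gDx (f * g) = f * gDx g + gDx f * g. Proof. exact: pder_mul. Qed.
Lemma gDyM f g : gDy (f * g) = f * gDy g + gDy f * g. Proof. exact: pder_mul. Qed.
Lemma gDxB f g : gDx (f - g) = gDx f - gDx g. Proof. exact: raddfB. Qed.
Lemma gDyB f g : gDy (f - g) = gDy f - gDy g. Proof. exact: raddfB. Qed.

Lemma basic_ordle n f : basic f -> ordle n f.
Proof. by move=> bf l lt; rewrite !bf //=; case: l lt => //= l _; rewrite orbT. Qed.

Lemma Et_basic f : basic f -> Et f = dd * Es f.
Proof. by move=> bf; rewrite Es_order0 ?bf //; [ring|apply: basic_ordle]. Qed.

Lemma char_basic f : basic f -> io (gDy f) + ss * io (gDx f) = Es f.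
Proof. by move=> bf; apply: dd_inj; rewrite -Et_io io_basic // Et_basic. Qed.

Lemma ev_psi (ev : coord -> P) : ev Cy = 1 -> pder ev (gpsi 3) = ev (Cz 0 false) - gpsi 1.
Proof.
move=> e; rewrite /gpsi raddfB /= linearZ /= pderX !pder_var e mulr1 expr1.
rewrite mulr_natl -scaler_nat scalerA mulVf ?scale1r //; by rewrite pnatr_eq0.
Qed.

(** With psi^(1) = y, psi^(2) = x, psi^(3) = z - y^2/2 the local coordinates follow the pattern of
    the nonlocal ones. *)
Lemma Es_psi n : Es (gpsi n.+1) = (eps n).[ss].
Proof.
case: n => [|[|[|n]]].
- by rewrite /Es /gpsi pder_var.
- by rewrite /Es /gpsi pder_var /= mul0r polyC0 subr0 mulr1.
- rewrite /Es ev_psi /=; last by rewrite hornerC.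
  by rewrite /evc hornerXn !hornerE; ring.
- by rewrite /Es /gpsi pder_var.
Qed.

Lemma Ea_psi a n : Ea a (gpsi n.+1) = (eps n)`_a.
Proof.
case: n => [|[|[|n]]].
- by rewrite /Ea /gpsi pder_var.
- by rewrite /Ea /gpsi pder_var /= mul0r polyC0 subr0 mulr1.
- have -> : eps 2 = 'X^2 - (gpsi 1)%:P by rewrite /= mul0r polyC0 subr0 mulr1 mul1r expr2.
  rewrite /Ea; have [->|a0] := eqVneq a 0%N; first by rewrite ev_psi /= ?coef1 // /evc coefB coefC.
  rewrite /gpsi raddfB /= linearZ /= pderX !pder_var /evc coef1 (negPf a0) mulr0 scaler0 subr0.
  by rewrite coefB coefC (negPf a0) subr0.
- by rewrite /Ea /gpsi pder_var.
Qed.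

Lemma th_horner (p : {poly P}) : (forall i, basic p`_i) -> th p.[ss] = p.[rr].
Proof.
move=> bp; rewrite -[in RHS]th_ss -horner_map; congr (_.[_]); apply/polyP => i.
by rewrite coef_map /= th_basic.
Qed.

Lemma thK f : th (th f) = f.
Proof.
rewrite /th psub_comp -[RHS]psub_id; apply: psub_ext => v.
case: v => [||[|[|a]] [|]|m]; rewrite /= ?psub_var //=.
- by rewrite rmorphN /= psub_var /= opprK.
- by rewrite -/(th ss) th_ss.
Qed.

Lemma map_epsS (D : {additive P -> P}) n : map_poly D (eps n.+1) = 'X * map_poly D (eps n) - (D (n%:R * gpsi n))%:P.
Proof.
apply/polyP => i; rewrite -[eps n.+1]/('X * eps n - (n%:R * gpsi n)%:P) coef_map_id0 ?raddf0 //.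
rewrite !coefB !coefXM !coefC raddfB /=; case: i => [|i] /=; rewrite ?raddf0 //.
by rewrite coef_map_id0 ?raddf0.
Qed.

(** The compatibility condition of the covering in terms of r and s. The values of [eps n] at r and
    at s obey first-order recursions with factors r and s, so the left side obeys a second-order one
    with these roots and only n = 0, 1 need checking. *)
Lemma covering_identity n : let e := eps n in let M := (map_poly (@Es R T) e).[rr] in
  2%:R * (e.[rr] - e.[ss]) - dd * (e^`().[rr] + e^`().[ss]) + dd ^+ 2 * (M - th M) = 0.
Proof.
pose M n := (map_poly (@Es R T) (eps n)).[rr].
pose F n := 2%:R * ((eps n).[rr] - (eps n).[ss]) - dd * ((eps n)^`().[rr] + (eps n)^`().[ss])
   + dd ^+ 2 * (M n - th (M n)).
suff [] : F n = 0 /\ F n.+1 = 0 by [].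
have MS k : M k.+1 = rr * M k - k%:R * Es (gpsi k).
  rewrite /M (map_epsS (@Es R T)) hornerD hornerN hornerM hornerX hornerC /= EsM Es_nat; ring.
have thb k : th (eps k).[ss] = (eps k).[rr] by apply: th_horner; apply: basic_eps.
have thMS k : th (M k.+1) = ss * th (M k) - k%:R * th (Es (gpsi k)).
  by rewrite MS rmorphB !rmorphM rmorph_nat /= th_rr.
have tE k : th (k%:R * Es (gpsi k)) = k%:R * th (Es (gpsi k)) by rewrite rmorphM rmorph_nat.
have sE k : ss * (k%:R * Es (gpsi k)) = k%:R * ((eps k).[ss] + k.-1%:R * gpsi k.-1).
  by case: k => [|k]; [ring|rewrite Es_psi epsXE /=; ring].
have sE' k : rr * (k%:R * th (Es (gpsi k))) = k%:R * ((eps k).[rr] + k.-1%:R * gpsi k.-1).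
  move: (congr1 (@th R T) (sE k)); rewrite rmorphM /= tE th_ss => ->.
  by rewrite !(rmorphM, rmorphD, rmorph_nat) /= thb (th_basic (@basic_psi R T k.-1)).
elim: n => [|n [IH1 IH2]].
  have M0 : M 0%N = 0 by rewrite /M map_polyC /= /Es pder1 horner0.
  have M1 : M 1%N = 0 by rewrite MS M0; ring.
  by rewrite /F M1 M0 /= !rmorph0 mul0r polyC0 subr0 mulr1 !derivE !hornerE /ss; split; ring.
split=> //.
have : F n.+2 - (rr + ss) * F n.+1 + rr * ss * F n = 0; last by rewrite IH1 IH2 !mulr0 subr0 addr0.
have ed k x : (eps k.+1)^`().[x] = (eps k).[x] + x * (eps k)^`().[x].
  by rewrite /= !derivE !hornerE; ring.
rewrite /F !thMS !MS !ed !epsXE Es_psi thb -[n.+1%:R]natr1.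
have h1 := sE n; have h2 := sE' n.
set Mn := M n; set tM := th (M n); set X := Es (gpsi n) in h1 *; set X' := th X in h2 *.
set a := (eps n).[rr] in h2 *; set b := (eps n).[ss] in h1 *; set a' := _^`().[rr]; set b' := _^`().[ss].
transitivity (dd ^+ 2 * (ss * (n%:R * X) - n%:R * b - (rr * (n%:R * X') - n%:R * a))); first by rewrite /ss; ring.
by rewrite h1 h2; ring.
Qed.

(** Dy + s Dx is applied to the value of Dy + r Dx on psi and, by [th], conversely. The difference
    is d times the commutator plus terms from differentiating r and s; [covering_identity] disposes
    of the rest. *)
Lemma covering_psi n : gDy (gDx (gpsi n.+1)) = gDx (gDy (gpsi n.+1)).
Proof.
set f := gpsi n.+1; set X := gDx f; set Y := gDy f; have bf : basic f := @basic_psi R T n.+1.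
have be := @basic_eps R T n.
have e1 : io Y + ss * io X = (eps n).[ss] by rewrite char_basic // Es_psi.
have e2 : io Y + rr * io X = (eps n).[rr].
  by rewrite -(th_horner be) -e1 rmorphD rmorphM /= th_ss !th_io.
have e3 : Et (eps n).[rr] = - (eps n)^`().[rr] + dd * (map_poly (@Es R T) (eps n)).[rr].
  rewrite {1}/Et pder_horner -/(Et rr) Et_rr mulrN1 addrC; congr (_ + _).
  rewrite -[RHS]hornerZ; congr (_.[_]); apply/polyP => i.
  by rewrite coefZ !coef_map_id0 ?raddf0 //; apply: Et_basic.
have bd i : basic (eps n)^`()`_i.
  by rewrite coef_deriv -mulr_natl; apply: basicM; [exact: basic_nat|exact: be].
have td : th (eps n)^`().[rr] = (eps n)^`().[ss] by rewrite -(th_horner bd) thK.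
have := congr1 (@Et R T) e2.
rewrite EtD EtM Et_rr !Et_io e3 -/X -/Y => e5.
have e6 := congr1 (@th R T) e5.
rewrite !(rmorphD, rmorphM, rmorphN, rmorphB, rmorph1) /= td !(th_dd, th_rr, th_ss, th_io) in e6.
have := covering_identity n; rewrite /= -e1 -e2.
set M := (map_poly _ _).[rr] in e5 e6 *; set tM := th M in e6 *; set d1 := _^`().[rr] in e5 *; set d2 := _^`().[ss] in e6 *.
move=> ci; apply: io_inj; set x := io X in ci e5 e6; set y := io Y in ci; set x1 := io (gDy X) in e5 e6 *; set x2 := io (gDx X) in e5 e6.
set y1 := io (gDy Y) in e5 e6; set y2 := io (gDx Y) in e5 e6 *.
apply: dd_inj; apply: dd_inj; apply: dd_inj; apply/eqP; rewrite -subr_eq0; apply/eqP.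
have {e6}e6 : dd * (d1 - dd * M + d2 + dd * tM) = dd * (- (dd * (y1 + ss * y2)) - (rr * (dd * (x1 + ss * x2)) - x)
   + (dd * (y1 + rr * y2)) + (ss * (dd * (x1 + rr * x2)) + x)).
  congr (_ * _); transitivity (- (- d1 + dd * M) - (- d2 + (- dd) * tM)); first by ring.
  by rewrite -e5 -e6 /ss; ring.
rewrite -[RHS]ci; apply/eqP; rewrite -subr_eq0; apply/eqP.
transitivity (dd * (d1 - dd * M + d2 + dd * tM) - dd * (- (dd * (y1 + ss * y2)) - (rr * (dd * (x1 + ss * x2)) - x)
   + (dd * (y1 + rr * y2)) + (ss * (dd * (x1 + rr * x2)) + x))); first by rewrite /ss; ring.
by rewrite e6 subrr.
Qed.

End Covering.
Arguments symKc : simpl never.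

(** * The vertical field V' on r, s and the psi *)

Section VerticalPart.
Variables (R : numFieldType) (T : polyAlg R).
Local Notation P := (palg T).
Implicit Types (f g : P) (v : coord).
Local Notation gz := (gz T).
Local Notation gpsi := (gpsi T).
Local Notation rr := (rr T).
Local Notation dd := (dd T).
Local Notation ss := (ss T).
Local Notation tau := (tau T).
Local Notation taub := (taub T).
Local Notation gDx := (@gDx R T).
Local Notation gDy := (@gDy R T).
Local Notation gzyy := (gzyy T).
Local Notation eps := (eps T).
Local Notation pr := (pd (T := T) (Cz 1 false)).
Local Notation pd_d := (pd (T := T) (Cz 0 true)).

(* Only functions of x, y, z and the psi have (Dy + s Dx) f free of
   derivatives of z of order at least two. *)
Lemma char_basic_inv f :
  (forall v, hij v -> pd v (io (gDy f) + ss * io (gDx f)) = 0) -> basic f.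
Proof.
move=> h; have key n : ordle n f -> pd (Cz n.+1 false) f = 0 /\ pd (Cz n true) f = 0.
  move=> on; have hv : hij (Cz n.+1 true) by rewrite /= orbT.
  have [_ e1] := Dy_top on (ltnSn n); have [_ e2] := Dx_top on (ltnSn n).
  have := h _ hv; rewrite pd_add_ss // !jet_io // e1 e2 eqxx mul1r /=.
  rewrite !(rmorphB, rmorphM) /= io_p => e.
  have [|e3 e4] := @io_free _ _ (pd (Cz n.+1 false) f) (- pd (Cz n true) f).
    rewrite rmorphN -[RHS](rmorph0 (@th R T)) -e !(rmorphD, rmorphB, rmorphN, rmorphM) /= !th_io.
    by rewrite !(th_rr, th_dd) /ss; ring.
  by split=> //; apply/eqP; rewrite -oppr_eq0 e4.
have o0 : ordle 0 f.
  have [n on] := ordle_ex f; elim: n on => // n IH on; apply: IH => l.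
  by rewrite leq_eqVlt => /orP[/eqP<-|]; [apply: key|apply: on].
by have [e1 e2] := key _ o0; apply: basic_from0.
Qed.

Lemma basic_polyD (p q : {poly P}) : (forall i, basic p`_i) -> (forall i, basic q`_i) ->
  forall i, basic (p + q)`_i.
Proof. by move=> bp bq i; rewrite coefD; apply: basicD. Qed.
Lemma basic_polyB (p q : {poly P}) : (forall i, basic p`_i) -> (forall i, basic q`_i) ->
  forall i, basic (p - q)`_i.
Proof. by move=> bp bq i; rewrite coefB; apply: basicB. Qed.
Lemma basic_polyM (p q : {poly P}) : (forall i, basic p`_i) -> (forall i, basic q`_i) ->
  forall i, basic (p * q)`_i.
Proof. by move=> bp bq i; rewrite coefM; apply: basic_sum => j _; apply: basicM. Qed.

Section Symmetry.
Variable V : coord -> P.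
Hypothesis V_x : V Cx = 0.
Hypothesis V_y : V Cy = 0.
Hypothesis VDx : forall q, pder V (gDx_coef T q) = gDx (V q).
Hypothesis VDy : forall q, pder V (gDy_coef T q) = gDy (V q).

Local Notation Z := (V (Cz 0 false)).
Local Notation A := (symA V).
Local Notation B := (symB V).
Local Notation K := (symK V).

Lemma V_Dx f : pder V (gDx f) = gDx (pder V f).
Proof.
apply/eqP; rewrite -subr_eq0 pder_comm (pder_ext (W := fun _ => 0)) ?pder0 // => v.
by rewrite VDx subrr.
Qed.

Lemma V_Dy f : pder V (gDy f) = gDy (pder V f).
Proof.
apply/eqP; rewrite -subr_eq0 pder_comm (pder_ext (W := fun _ => 0)) ?pder0 // => v.
by rewrite VDy subrr.
Qed.

(* The field V' of the header. *)
Definition Tv_coef v := V v - B * gDx_coef T v - A * gDy_coef T v.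
Definition Tv : P -> P := pder Tv_coef.
HB.instance Definition _ := GRing.Linear.on Tv.

Lemma TvE f : Tv f = pder V f - B * gDx f - A * gDy f.
Proof.
rewrite /Tv (pder_ext (W := fun v => V v + ((- B) * gDx_coef T v + (- A) * gDy_coef T v))).
  by rewrite !pder_addf !pder_scalef -/(gDx f) -/(gDy f); ring.
by move=> v; rewrite /Tv_coef; ring.
Qed.

(* V' moves r and s by K(r) and K(s). *)
Definition Tvs_coef v :=
  match v with
  | Cz 1 false => th K
  | Cz 0 true => th K - K
  | _ => io (Tv_coef v)
  end.
Definition Tvs : P -> P := pder Tvs_coef.
HB.instance Definition _ := GRing.Linear.on Tvs.

Lemma Tvs_rr : Tvs rr = th K. Proof. exact: pder_var. Qed.
Lemma Tvs_ss : Tvs ss = K. Proof. by rewrite raddfB /= /Tvs !pder_var /=; ring. Qed.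

Lemma TvsM f g : Tvs (f * g) = f * Tvs g + Tvs f * g.
Proof. exact: pder_mul. Qed.
Lemma Tvs_horner (p : {poly P}) x : Tvs p.[x] = (map_poly Tvs p).[x] + p^`().[x] * Tvs x.
Proof. exact: pder_horner. Qed.

Lemma io_DxZ : io (gDx Z) = B * gz 2 false + A * gz 1 true + th K + K.
Proof.
apply: dd_inj; have e1 := UUE VDx VDy; have e2 := WWE VDx VDy.
rewrite /UU in e1; rewrite /WW in e2; set x := io (gDx Z) in e1 e2 *; set y := io (gDy Z) in e1 e2.
transitivity (rr * x + y - (ss * x + y)); first by rewrite /ss; ring.
by rewrite e1 e2 /taub /tau /ss; ring.
Qed.

Lemma io_DyZ : io (gDy Z) = WW V - ss * io (gDx Z).
Proof. by rewrite /WW; ring. Qed.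

Lemma Tvs_io f : Tvs (io f) = io (Tv f).
Proof.
have bA := basic_A VDx VDy; have bB := basic_B VDx VDy.
move: f; apply: (hder_ext (h := @io R T) (D1 := fun f => Tvs (io f)) (D2 := fun f => io (Tv f))).
- exact: hder_der_sub.
- exact: hder_sub_der.
move=> v; rewrite /Tv pder_var /io psub_var -/(io _).
case: v => [||[|[|a]] [|]|n]; rewrite ?[io_coef _ _](erefl (pv T _)) /io_coef;
  rewrite ?[LHS]pder_var //.
- rewrite -[LHS]/(Tvs (- (rr * ss))) raddfN /= TvsM Tvs_rr Tvs_ss /Tv_coef /= (V_q VDy).
  rewrite !(rmorphB, rmorphM) /= io_DyZ io_DxZ (WWE VDx VDy) (io_basic bA) (io_basic bB) io_gz // /gzyy.
  rewrite !(rmorphB, rmorphM, rmorph1) /= io_p io_q !io_gz //.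
  by rewrite /tau /ss; ring.
- transitivity (th K + K); first by rewrite raddfD /= Tvs_rr Tvs_ss.
  rewrite /Tv_coef /= (V_p VDx).
  have -> : io (gDx Z - B * gz 2 false - A * gz 1 true) = io (gDx Z) - B * gz 2 false - A * gz 1 true.
    by rewrite !(rmorphB, rmorphM) /= (io_basic bA) (io_basic bB) !io_gz.
  by rewrite io_DxZ; ring.
Qed.

Definition Gam k := Tv (gpsi k).

Lemma map_Tvs_basic n : (forall k, (k < n)%N -> basic (Gam k)) -> forall i, basic (map_poly Tvs (eps n))`_i.
Proof.
elim: n => [|n IH] bG i.
  by rewrite /= coef_map_id0 ?raddf0 // coef1 /Tvs pder_nat; apply: basic0.
rewrite (map_epsS Tvs) coefB coefXM coefC; apply: basicB; case: eqP => _; try exact: basic0.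
  by apply: IH => k kn; apply: bG; apply: ltnW.
rewrite /= /Tvs pder_mul pder_nat mul0r addr0; apply: basicM; first exact: basic_nat.
rewrite -/(Tvs _) -[gpsi n]io_psi Tvs_io -/(Gam n) io_basic; by apply: bG.
Qed.

(** V' is applied to (Dy + s Dx) psi^(n+1) = [eps n] at s. Commuting V' past Dy + s Dx yields Es B
    Dx + Es A Dy = Es A (Dy + s Dx) - K Dx, and - K Dx cancels against the term from V'(s) = K. *)
Lemma char_Gam n : io (gDy (Gam n.+1)) + ss * io (gDx (Gam n.+1)) =
  (map_poly Tvs (eps n)).[ss] + (eps n)^`().[ss] * K - Es A * (eps n).[ss].
Proof.
have bA := basic_A VDx VDy; have bB := basic_B VDx VDy.
rewrite /Gam TvE; set X := gDx (gpsi _); set Y := gDy (gpsi _).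
have e1 : io Y + ss * io X = (eps n).[ss].
  by rewrite char_basic ?Es_psi //; exact: basic_psi.
have cv : gDy X = gDx Y := covering_psi T n.
have := congr1 Tvs e1; rewrite raddfD /= TvsM Tvs_horner !Tvs_io Tvs_ss => e2.
have bs : Es B = ss * Es A - K by rewrite /symK; ring.
have eA := char_basic bA; have eB := char_basic bB; rewrite bs in eB.
have vx : gDx (pder V (gpsi n.+1)) = pder V X by rewrite -V_Dx.
have vy : gDy (pder V (gpsi n.+1)) = pder V Y by rewrite -V_Dy.
have tX : pder V X = Tv X + B * gDx X + A * gDy X by rewrite TvE; ring.
have tY : pder V Y = Tv Y + B * gDx Y + A * gDy Y by rewrite TvE; ring.
rewrite !(gDxB, gDyB, gDxM, gDyM) vx vy tX tY cv -e2 -e1 -eA.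
rewrite !(rmorphB, rmorphD, rmorphM) /= !(io_basic bA) !(io_basic bB).
have -> : io (gDy B) = ss * Es A - K - ss * io (gDx B) by rewrite -eB; ring.
by rewrite -eA; ring.
Qed.

(** Strong induction: the right side of [char_Gam] involves only [Gam k] with k < n, so it is free
    of derivatives of order at least two, and [char_basic_inv] applies. *)
Lemma basic_Gam n : basic (Gam n).
Proof.
have bA := basic_A VDx VDy; have bB := basic_B VDx VDy.
have [m] := ubnP n; elim: m n => // m IH [|n] lt.
  by rewrite /Gam raddf0; apply: basic0.
apply: char_basic_inv => v hv; rewrite char_Gam.
have bs (p : {poly P}) : (forall i, basic p`_i) -> pd v p.[ss] = 0.
  move=> bp; rewrite /pd pder_horner -/(pd v ss) jet_ss // mulr0 addr0.
  rewrite (_ : map_poly _ _ = 0) ?horner0 //; apply/polyP => i.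
  by rewrite coef_map_id0 ?raddf0 // coef0; apply/bp/hij_jetc.
have bEs f : basic f -> pd v (Es f) = 0.
  move=> bf; have [N [_ h]] := Es_poly f; rewrite (h N) //; apply: bs => i.
  by rewrite coef_poly; case: ifP => _; [apply: basic_Ea|apply: basic0].
have b1 := @basic_eps R T n.
have b2 i : basic (eps n)^`()`_i by rewrite coef_deriv -mulr_natl; apply: basicM => //; exact: basic_nat.
have b3 : forall i, basic (map_poly Tvs (eps n))`_i.
  by apply: map_Tvs_basic => k kn; apply: IH; lia.
rewrite pdB pdD !pd_mul !bs // !bEs //.
have -> : pd v K = 0 by rewrite /symK pdB pd_mul !bEs // jet_ss //; ring.
by ring.
Qed.

(** The truncated subtraction gives 0 exactly where the coefficient of [eps n] is a constant. *)
Lemma coef_map_Tvs n a : (map_poly Tvs (eps n))`_a = - (n.-1 - a)%:R * Gam (n.-1 - a).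
Proof.
elim: n a => [|n IH] a; first by rewrite /= coef_map_id0 ?raddf0 // coef1 /Tvs pder_nat sub0n; ring.
rewrite (map_epsS Tvs) coefB coefXM coefC; case: a => [|a] /=.
  rewrite subn0 sub0r /Tvs pder_mul pder_nat mul0r addr0 -/(Tvs _) -[X in Tvs X]io_psi Tvs_io -/(Gam n).
  by rewrite io_basic; [ring|exact: basic_Gam].
by rewrite subr0 IH; case: n {IH} => [|n] //=; rewrite subSS.
Qed.

(** The coefficient of s^a in [char_Gam]. The factor a + 1 + i is a + 1 - i from the derivative of
    [eps n] plus 2 i from Ea (i - 1) A = - 2 i K_i. *)
Lemma Ea_Gam a n : Ea a (Gam n.+1) = - (n.-1 - a)%:R * Gam (n.-1 - a) +
  \sum_(i < a.+2) (a.+1 + i)%:R * symKc V i * (eps n)`_(a.+1 - i).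
Proof.
have bA := basic_A VDx VDy; have bB := basic_B VDx VDy.
have [[N KN] rec] := K_recursion VDx VDy.
have bG := basic_Gam n.+1.
have [N1 [G0 EG]] := Es_poly (Gam n.+1); have [N2 [A0 EA]] := Es_poly A; have [N3 [B0 EB]] := Es_poly B.
pose M := maxn N1 (maxn N2 N3).
pose g := \poly_(i < M) Ea i (Gam n.+1); pose u := \poly_(i < M) Ea i A; pose b := \poly_(i < M) Ea i B.
have gE i : g`_i = Ea i (Gam n.+1) by rewrite coef_poly; case: ltnP => // le; rewrite G0 //; move: le; rewrite /M; lia.
have uE i : u`_i = Ea i A by rewrite coef_poly; case: ltnP => // le; rewrite A0 //; move: le; rewrite /M; lia.
have bE i : b`_i = Ea i B by rewrite coef_poly; case: ltnP => // le; rewrite B0 //; move: le; rewrite /M; lia.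
pose k := 'X * u - b.
have kE i : k`_i = symKc V i by rewrite coefB coefXM bE /symKc; case: i => [|i] /=; rewrite ?uE ?sub0r.
have Kk : K = k.[ss].
  by rewrite hornerD hornerN hornerM hornerX /symK (EA M) ?(EB M) // /M; lia.
have := char_Gam n; rewrite char_basic // (EG M) ?(EA M) ?Kk; try by rewrite /M; lia.
rewrite -/g -/u => e; clearbody k.
have z : g - (map_poly Tvs (eps n) + (eps n)^`() * k - u * eps n) = 0.
  apply: (@poly_indep _ _ (fun w => (-1) * (w == Cz 0 true)%:R) ss).
  - by rewrite pder_scalef -/(pd _ ss) pdB pd_d_rr pd_d_dd; ring.
  - have bk i : basic k`_i by rewrite kE; apply: basic_Kc.
    have bu i : basic u`_i by rewrite uE; apply: basic_Ea.
    have b1 := @basic_eps R T n.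
    have b2 i : basic (eps n)^`()`_i by rewrite coef_deriv -mulr_natl; apply: basicM => //; exact: basic_nat.
    have b3 : forall i, basic (map_poly Tvs (eps n))`_i.
      by apply: map_Tvs_basic => j _; apply: basic_Gam.
    move=> i; rewrite pder_scalef -/(pd _ _) (_ : pd _ _ = 0) ?mulr0 //.
    have bg j : basic g`_j by rewrite gE; apply: basic_Ea.
    suff bc : forall j, basic (g - (map_poly Tvs (eps n) + (eps n)^`() * k - u * eps n))`_j by rewrite bc.
    by apply: basic_polyB => //; apply: basic_polyB; [apply: basic_polyD => //|]; apply: basic_polyM.
  - by rewrite !(hornerD, hornerN, hornerM) e subrr.
have := congr1 (fun p : {poly P} => p`_a) z; rewrite /= coef0 !(coefB, coefD) gE coef_map_Tvs.
move/eqP; rewrite subr_eq0 => /eqP ->; rewrite -addrA; congr (_ + _).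
rewrite (mulrC _ k) !coefM.
have -> : \sum_(j < a.+1) k`_j * (eps n)^`()`_(a - j) =
   \sum_(i < a.+2) (a.+1 - i)%:R * symKc V i * (eps n)`_(a.+1 - i).
  rewrite [RHS]big_ord_recr /= subnn !mul0r addr0; apply: eq_bigr => i _.
  have le : (i <= a)%N by rewrite -ltnS ltn_ord.
  by rewrite kE coef_deriv (subSn le) -[X in _ * X = _]mulr_natl mulrCA mulrA.
have -> : \sum_(j < a.+1) u`_j * (eps n)`_(a - j) =
   - \sum_(i < a.+2) (2 * i)%:R * symKc V i * (eps n)`_(a.+1 - i).
  rewrite [in RHS]big_ord_recl muln0 !mul0r add0r -sumrN; apply: eq_bigr => i _ /=.
  rewrite uE; have [-> _ _] := rec i; rewrite /bump add1n subSS; ring.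
rewrite opprK -big_split; apply: eq_bigr => i _ /=.
have lt := ltn_ord i; have -> : (a.+1 + i = a.+1 - i + 2 * i)%N by lia.
by rewrite natrD; ring.
Qed.

End Symmetry.
End VerticalPart.

(** * Homogeneity *)

Section Weights.
Variables (R : numFieldType) (T : polyAlg R).
Local Notation P := (palg T).
Implicit Types (f g : P) (v : coord).
Local Notation gz := (gz T).
Local Notation gpsi := (gpsi T).
Local Notation gDx := (@gDx R T).
Local Notation gDy := (@gDy R T).
Local Notation eps := (eps T).

Lemma eps_coef n a : (eps n)`_a = (n == a)%:R - (n - a.+1)%:R * gpsi (n - a.+1).
Proof.
elim: n a => [|n IH] a; first by rewrite /= coef1 eq_sym sub0n mul0r subr0.
rewrite /= coefB coefXM coefC; case: a => [|a] /=; first by rewrite subSS subn0.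
by rewrite IH subr0 eqSS subSS.
Qed.

(** In the order y, x, z, psi^(4), ... of [vr], Ea n is 1 on the n-th coordinate and 0 on the
    earlier ones. Starting from the last variable of f, each partial derivative vanishes in turn. *)
Lemma Ea_const f : basic f -> (forall a, Ea a f = 0) -> exists c, f = c%:A.
Proof.
move=> bf E0; pose vr n := match n with 0 => Cy | 1 => Cx | 2 => Cz 0 false | n.+3 => Cpsi n end.
have evr n a : (evc T (vr n))`_a = (a == n)%:R - (if (2 < n)%N then (n - a.+1)%:R * gpsi (n - a.+1) else 0).
  case: n => [|[|[|n]]]; rewrite /evc /vr ?coef1 ?coefX ?coefXn ?subr0 //.
  by rewrite eps_coef [in RHS]eq_sym.
have z n : pd (vr n) f = 0.
  have [s [us hs]] := finite_vars f.
  pose o v := match v with Cy => 0%N | Cx => 1%N | Cz _ _ => 2 | Cpsi n => n.+3 end.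
  have big m : (\max_(v <- s) o v < m)%N -> pd (vr m) f = 0.
    move=> lt; apply: hs; apply/negP => vs.
    have := leq_bigmax_seq (P := xpredT) (F := o) (vr m) vs isT.
    have -> : o (vr m) = m by case: m {lt vs} => [|[|[|]]].
    by rewrite leqNgt lt.
  move: (\max_(v <- s) o v) big => b big.
  have [//|] := ltnP b n; first exact: big.
  have [d] := ubnP (b - n); elim: d n => // d IH n lt le.
  have hi m : (n < m)%N -> pd (vr m) f = 0.
    move=> nm; have [/big//|mb] := ltnP b m; apply: IH => //; lia.
  have := E0 n; rewrite /Ea (pder_congr (W := fun v => (v == vr n)%:R)) // => v.
  have [jv|jv] := boolP (jetc v); first by right; apply: bf.
  have -> : v = vr (o v) by case: v jv => [||[|a] [|]|m].
  have [lt2|gt|->] := ltngtP (o v) n.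
  - left; rewrite evr (_ : (n == o v) = false); last by lia.
    rewrite (_ : (o v - n.+1)%N = 0%N); last by lia.
    have -> : (vr (o v) == vr n) = false.
      apply/eqP => e; move: lt2; suff -> : o v = n by rewrite ltnn.
      by move: (congr1 o e); case: (o v) => [|[|[|?]]]; case: (n) => [|[|[|?]]].
    by case: ifP => _; ring.
  - by right; apply: hi.
  - left; rewrite evr !eqxx (_ : (n - n.+1)%N = 0%N); last by lia.
    by case: ifP => _; ring.
apply: pd_const => v; have [jv|jv] := boolP (jetc v); first exact: bf.
case: v jv => [||[|a] [|]|m] // _; [exact: (z 1%N)|exact: (z 0%N)|exact: (z 2)|exact: (z m.+3)].
Qed.

Definition Wt : P -> P := pder (fun v => (wt v)%:~R * pv T v).
HB.instance Definition _ := GRing.Linear.on Wt.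

(** Weighted homogeneity as an eigenvalue equation: it passes through derivations by a commutator,
    without reference to monomials. *)
Definition wf (z : int) f := Wt f = z%:~R * f.

Lemma wf_pv v : wf (wt v) (pv T v). Proof. exact: pder_var. Qed.
Lemma wf0 z : wf z 0. Proof. by rewrite /wf raddf0 mulr0. Qed.
Lemma wf_nat n : wf 0 n%:R. Proof. by rewrite /wf /Wt pder_nat mul0r. Qed.
Lemma wf1 : wf 0 1. Proof. exact: (wf_nat 1). Qed.
Lemma wfD z f g : wf z f -> wf z g -> wf z (f + g).
Proof. by rewrite /wf raddfD /= mulrDr => -> ->. Qed.
Lemma wfN z f : wf z f -> wf z (- f).
Proof. by rewrite /wf raddfN /= mulrN => ->. Qed.
Lemma wfB z f g : wf z f -> wf z g -> wf z (f - g).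
Proof. by move=> hf hg; apply/wfD/wfN. Qed.
Lemma wfM z1 z2 f g : wf z1 f -> wf z2 g -> wf (z1 + z2) (f * g).
Proof. by rewrite /wf /Wt pder_mul -!/(Wt _) => -> ->; rewrite intrD; ring. Qed.
Lemma wfX z f n : wf z f -> wf (z * n%:Z) (f ^+ n).
Proof.
move=> h; elim: n => [|n IH]; first by rewrite mulr0; exact: wf1.
by rewrite exprS -addn1 PoszD mulrDr mulr1 addrC; apply: wfM.
Qed.
Lemma wfZ z a f : wf z f -> wf z (a *: f).
Proof. by rewrite /wf linearZ /= => ->; rewrite scalerAr. Qed.
Lemma wf_sum z I (s : seq I) (p : pred I) (F : I -> P) :
  (forall i, p i -> wf z (F i)) -> wf z (\sum_(i <- s | p i) F i).
Proof. by move=> bF; elim/big_rec: _ => [|i g pi bg]; [exact: wf0|apply: wfD; first exact: bF]. Qed.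

Lemma wf_pder d W f z : (forall v, wf (wt v + d) (W v)) -> wf z f -> wf (z + d) (pder W f).
Proof.
move=> hW hf; rewrite /wf; have := pder_comm (fun v => (wt v)%:~R * pv T v) W f.
rewrite -!/(Wt _) => /(canRL (subrK _)) ->; rewrite hf pder_mul.
have -> : pder W z%:~R = 0 by rewrite raddfMz /= pder1 mul0rz.
rewrite (pder_ext (W := fun v => d%:~R * W v)) => [|v]; first by rewrite pder_scalef intrD; ring.
rewrite -/(Wt _) hW pder_mul pder_var.
have -> : pder W (wt v)%:~R = 0 by rewrite raddfMz /= pder1 mul0rz.
by rewrite intrD; ring.
Qed.

Lemma wf_pder_basic d W f z : (forall v, ~~ jetc v -> wf (wt v + d) (W v)) -> basic f ->
  wf z f -> wf (z + d) (pder W f).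
Proof.
move=> hW bf hf; pose W' v := if jetc v then 0 else W v.
rewrite (pder_basic_eq (W := W')) => [||v jv]; rewrite ?/W' ?(negPf jv) //.
by apply: wf_pder => // v; case: ifP => [_|/negbT/hW //]; apply: wf0.
Qed.

Lemma wf_pd v z f : wf z f -> wf (z - wt v) (pd v f).
Proof.
apply: wf_pder => w; have [->|nw] := eqVneq w v; last exact: wf0.
by rewrite subrr; exact: wf1.
Qed.

Lemma wf_psi i : wf (i%:Z + 1) (gpsi i).
Proof.
case: i => [|[|[|[|i]]]]; rewrite /gpsi; first exact: wf0.
- exact: (wf_pv Cy).
- exact: (wf_pv Cx).
- by apply: wfB; [exact: (wf_pv (Cz 0 false))|apply: wfZ; exact: (wfX 2 (wf_pv Cy))].
- have -> : i.+4%:Z + 1 = wt (Cpsi i) by rewrite /wt; lia.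
  exact: wf_pv.
Qed.

Lemma wf_p : wf 1 (gz 1 false). Proof. exact: (wf_pv (Cz 1 false)). Qed.
Lemma wf_q : wf 2 (gz 0 true). Proof. exact: (wf_pv (Cz 0 true)). Qed.

Lemma wf_sigma m : wf m%:Z (gsigma T m).
Proof.
apply: wf_sum => j _; have lt := ltn_ord j.
have -> : m%:Z = 0 + 1 * (m - j.*2)%N%:Z + 2 * (j : nat)%:Z by move: lt; rewrite ltnS; lia.
by apply: wfM; [apply: wfM; [exact: wf_nat|exact/wfX/wf_p]|exact/wfX/wf_q].
Qed.

Lemma wf_gX k : wf k%:Z (gX T k.+2).
Proof.
rewrite /gX subSS subSS subn0; apply: wfB; first exact: wf_sigma.
rewrite big_nat_cond; apply: wf_sum => i /andP[/andP[h1 h2] _].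
have -> : k%:Z = 0 + (k.+2 - i - 3)%N%:Z + (i%:Z + 1) by lia.
by apply: wfM; [apply: wfM; [exact: wf_nat|exact: wf_sigma]|exact: wf_psi].
Qed.

Lemma wf_gY k : wf (k%:Z + 2) (gY T k.+3).
Proof.
rewrite /gY !subSS !subn0; apply: wfB.
  by rewrite addrC; apply: wfM; [exact: wf_q|exact: wf_gX].
have -> : k%:Z + 2 = 0 + (k.+1%:Z + 1) by lia.
by apply: wfM; [exact: wf_nat|exact: wf_psi].
Qed.

Lemma wf_Dx z f : basic f -> wf z f -> wf (z - 3) (gDx f).
Proof.
apply: wf_pder_basic; case=> [||[|a] [|]|n] //= _.
- exact: wf1.
- exact: wf0.
- exact: wf_p.
- have -> : (n + 5)%N%:Z - 3 = n.+2%:Z by lia.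
  have -> : (n + 4)%N = n.+4 by lia.
  exact: wf_gX.
Qed.

Lemma wf_Dy z f : basic f -> wf z f -> wf (z - 2) (gDy f).
Proof.
apply: wf_pder_basic; case=> [||[|a] [|]|n] //= _.
- exact: wf0.
- exact: wf1.
- exact: wf_q.
- have -> : (n + 5)%N%:Z - 2 = n.+1%:Z + 2 by lia.
  have -> : (n + 4)%N = n.+4 by lia.
  exact: wf_gY.
Qed.

Lemma wf_eps n a : wf (n%:Z - a%:Z) (eps n)`_a.
Proof.
rewrite eps_coef; apply: wfB.
  by have [->|] := eqVneq n a; [rewrite subrr; exact: wf1|move=> _; exact: wf0].
have [le|gt] := leqP n a; first by rewrite (_ : (n - a.+1)%N = 0%N) ?mul0r; [exact: wf0|lia].
have -> : n%:Z - a%:Z = 0 + ((n - a.+1)%N%:Z + 1) by lia.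
by apply: wfM; [exact: wf_nat|exact: wf_psi].
Qed.

Lemma wf_Ea a z f : basic f -> wf z f -> wf (z - (a%:Z + 2)) (Ea a f).
Proof.
apply: wf_pder_basic; case=> [||[|b] [|]|n] //= _; rewrite /evc.
- by rewrite coefX; have [->|_] := eqVneq a 1%N; [exact: wf1|exact: wf0].
- by rewrite coef1; have [->|_] := eqVneq a 0%N; [exact: wf1|exact: wf0].
- by rewrite coefXn; have [->|_] := eqVneq a 2%N; [exact: wf1|exact: wf0].
- have -> : (n + 5)%N%:Z - (a%:Z + 2) = n.+3%:Z - a%:Z by lia.
  exact: wf_eps.
Qed.

Lemma int_reg (z : int) f : z != 0 -> z%:~R * f = 0 -> f = 0.
Proof. by move=> z0; rewrite mulrzl -scaler_int => /eqP; rewrite scaler_eq0 intr_eq0 (negPf z0) => /eqP. Qed.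

Lemma const_wf0 f z : z != 0 -> basic f -> (forall a, Ea a f = 0) -> wf z f -> f = 0.
Proof.
move=> z0 bf E0 hf; have [c e] := Ea_const bf E0.
by apply: (int_reg z0); rewrite -hf e /Wt pderC.
Qed.

Section Symmetry.
Variables (V : coord -> P) (m : int).
Hypothesis VDx : forall q, pder V (gDx_coef T q) = gDx (V q).
Hypothesis VDy : forall q, pder V (gDy_coef T q) = gDy (V q).
Hypothesis V_wf : forall v, wf (wt v + (m - 1)) (V v).

(** V has weight m - 1, so [m] is k + 1, the exponent for which lambda^m times lambda^(1-k)
    phi_lambda is lambda^2 phi_lambda. *)
Lemma wf_A : wf (m + 1) (symA V).
Proof. by have := wf_pd (Cz 0 true) (V_wf (Cz 0 false)); congr (wf _ _); rewrite /=; lia. Qed.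
Lemma wf_B : wf (m + 2) (symB V).
Proof. by have := wf_pd (Cz 1 false) (V_wf (Cz 0 false)); congr (wf _ _); rewrite /=; lia. Qed.

Lemma wf_Kc j : wf (m - j%:Z) (symKc V j).
Proof.
have bA := basic_A VDx VDy; have bB := basic_B VDx VDy.
have hB i : wf (m - i%:Z) (Ea i (symB V)).
  by have := wf_Ea i bB wf_B; congr (wf _ _); lia.
case: j => [|j]; first exact/wfN/hB.
apply: wfB; last exact: hB.
by have := wf_Ea j bA wf_A; congr (wf _ _); lia.
Qed.

Lemma wf_Gam i : wf (i%:Z + m) (Gam V i).
Proof.
have bA := basic_A VDx VDy; have bB := basic_B VDx VDy; have bp := @basic_psi R T i.
rewrite /Gam TvE; apply: wfB; first apply: wfB.
- have -> : i%:Z + m = i%:Z + 1 + (m - 1) by lia.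
  by apply: wf_pder => //; exact: wf_psi.
- have -> : i%:Z + m = m + 2 + (i%:Z + 1 - 3) by lia.
  by apply: wfM; [exact: wf_B|apply: wf_Dx => //; exact: wf_psi].
- have -> : i%:Z + m = m + 1 + (i%:Z + 1 - 2) by lia.
  by apply: wfM; [exact: wf_A|apply: wf_Dy => //; exact: wf_psi].
Qed.

Lemma Kc_high j : j%:Z != m -> (forall i, (j < i)%N -> symKc V i = 0) -> symKc V j = 0.
Proof.
move=> jm hi; have [_ rec] := K_recursion VDx VDy.
apply: (@const_wf0 _ (m - j%:Z)); last exact: wf_Kc.
- by lia.
- exact: basic_Kc.
- by move=> a; have [_ _ ->] := rec a; rewrite hi ?mulr0 //; lia.
Qed.

(** K_j vanishes for large j. Descending from there, every Ea K_j is a multiple of some K_i with i >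
    j, so K_j is a constant of weight m - j < 0, hence 0. *)
Lemma Kc0 j : m < j%:Z -> symKc V j = 0.
Proof.
have [[n Kn] _] := K_recursion VDx VDy; move=> lt.
have [le|] := leqP n j; first exact: Kn.
have [d] := ubnP (n - j); elim: d j lt => // d IH j lt ld jn.
apply: Kc_high => [|i ji]; first by lia.
by have [/Kn //|ni] := leqP n i; apply: IH => //; lia.
Qed.

End Symmetry.
End Weights.

(** * Truncated series in lambda *)

Section TruncatedSeries.
Variable P : comNzRingType.
Implicit Types (p q u : {poly P}) (n : nat).

(** Divisibility by lambda^n; identities of power series in lambda are stated as [idl n (p - q)]. *)
Definition idl n p := forall i, (i < n)%N -> p`_i = 0.

Lemma idlD n p q : idl n p -> idl n q -> idl n (p + q).
Proof. by move=> hp hq i lt; rewrite coefD hp // hq // addr0. Qed.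
Lemma idlN n p : idl n p -> idl n (- p).
Proof. by move=> hp i lt; rewrite coefN hp // oppr0. Qed.
Lemma idlB n p q : idl n p -> idl n q -> idl n (p - q).
Proof. by move=> hp hq; apply/idlD/idlN. Qed.
Lemma idl0 n : idl n 0. Proof. by move=> i _; rewrite coef0. Qed.
Lemma idl_sum n (I : Type) (s : seq I) (a : pred I) (F : I -> {poly P}) :
  (forall i, a i -> idl n (F i)) -> idl n (\sum_(i <- s | a i) F i).
Proof. by move=> h; elim/big_rec: _ => [|i x ai hx]; [exact: idl0|apply: idlD => //; exact: h]. Qed.
Lemma idl_mul a b p q : idl a p -> idl b q -> idl (a + b) (p * q).
Proof.
move=> hp hq i lt; rewrite coefM big1 // => j _.
have [lj|gj] := ltnP j a; first by rewrite hp // mul0r.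
by rewrite hq ?mulr0 //; have := ltn_ord j; lia.
Qed.
Lemma idl_le a b p : (a <= b)%N -> idl b p -> idl a p.
Proof. by move=> le h i lt; apply: h; apply: leq_trans lt le. Qed.
Lemma idlMl n p q : idl n q -> idl n (p * q).
Proof. by move=> hq; rewrite -[n]add0n; apply: idl_mul. Qed.
Lemma idlMr n p q : idl n p -> idl n (p * q).
Proof. by rewrite mulrC; apply: idlMl. Qed.
Lemma idl_exp a n p : idl a p -> idl (a * n) (p ^+ n).
Proof. by move=> h; elim: n => [|n IH]; [rewrite muln0|rewrite mulnS exprS; apply: idl_mul]. Qed.
Lemma idl_X n : idl n ('X^n : {poly P}).
Proof. by move=> i lt; rewrite coefXn ltn_eqF. Qed.

Lemma idl_coef n p q i : idl n (p - q) -> (i < n)%N -> p`_i = q`_i.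
Proof. by move=> h /h; rewrite coefB => /eqP; rewrite subr_eq0 => /eqP. Qed.
Lemma idl_subX n p q k : idl n (p - q) -> idl n (p ^+ k - q ^+ k).
Proof. by rewrite subrXX; apply: idlMr. Qed.
Lemma idl_sym n p q : idl n (p - q) -> idl n (q - p).
Proof. by move=> h; rewrite -opprB; apply: idlN. Qed.

Definition derivation (Q : comNzRingType) (D : Q -> Q) :=
  (forall f g, D (f + g) = D f + D g) /\ (forall f g, D (f * g) = f * D g + D f * g).

Section Derivation.
Variables (Q : comNzRingType) (D : Q -> Q).
Hypothesis DD : derivation D.
Lemma drvD f g : D (f + g) = D f + D g. Proof. exact: DD.1. Qed.
Lemma drvM f g : D (f * g) = f * D g + D f * g. Proof. exact: DD.2. Qed.
Lemma drv0 : D 0 = 0.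
Proof. by apply: (addIr (D 0)); rewrite -drvD !add0r. Qed.
Lemma drvN f : D (- f) = - D f.
Proof. by apply: (addrI (D f)); rewrite -drvD !subrr drv0. Qed.
Lemma drvB f g : D (f - g) = D f - D g. Proof. by rewrite drvD drvN. Qed.
Lemma drv1 : D 1 = 0.
Proof. by have := drvM 1 1; rewrite !mulr1 mul1r -{1}[D 1]addr0 => /addrI. Qed.
Lemma drv_nat n : D n%:R = 0.
Proof. by elim: n => [|n IH]; rewrite ?drv0 // -addn1 natrD drvD IH drv1 addr0. Qed.
Lemma drvX f n : D (f ^+ n) = n%:R * f ^+ n.-1 * D f.
Proof.
elim: n => [|[|n] IH]; first by rewrite expr0 drv1 !mul0r.
  by rewrite expr1 expr0 !mul1r.
by rewrite exprS drvM IH /= -[n.+2]addn1 natrD exprS; ring.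
Qed.
Lemma drv_sum (I : Type) (s : seq I) (a : pred I) (F : I -> Q) :
  D (\sum_(i <- s | a i) F i) = \sum_(i <- s | a i) D (F i).
Proof. exact: (big_morph D drvD drv0). Qed.
End Derivation.

(** Unlike the plain derivative, lambda d/dlambda does not lower the order of truncation. *)
Definition xd p := 'X * p^`().

Lemma xd_derivation : derivation xd.
Proof. by split=> p q; rewrite /xd ?derivD ?derivM; ring. Qed.

Lemma coef_xd p i : (xd p)`_i = i%:R * p`_i.
Proof. by rewrite coefXM; case: i => [|i] /=; rewrite ?mul0r // coef_deriv mulr_natl. Qed.

Lemma xd_idl n p : idl n p -> idl n (xd p).
Proof. by move=> h i lt; rewrite coef_xd h // mulr0. Qed.

Section Lift.
Variable d : P -> P.
Hypothesis dd : derivation d.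

Lemma coef_map_drv p i : (map_poly d p)`_i = d p`_i.
Proof. by rewrite coef_map_id0 // (drv0 dd). Qed.

Lemma map_derivation : derivation (map_poly d).
Proof.
split=> p q; apply/polyP => i; rewrite ?coefD !coef_map_drv ?coefD ?(drvD dd) ?coef_map_drv //.
rewrite !coefM (drv_sum dd) -big_split; apply: eq_bigr => j _ /=.
by rewrite !coef_map_drv (drvM dd).
Qed.

Lemma map_idl n p : idl n p -> idl n (map_poly d p).
Proof. by move=> h i lt; rewrite coef_map_drv h // (drv0 dd). Qed.

Lemma map_drvC c : map_poly d c%:P = (d c)%:P.
Proof. by apply/polyP => i; rewrite coef_map_drv !coefC; case: eqP => // _; exact: drv0. Qed.

Lemma map_drvXn n : map_poly d 'X^n = 0.
Proof. by apply/polyP => i; rewrite coef_map_drv coefXn coef0 (drv_nat dd). Qed.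

Lemma map_xd p : map_poly d (xd p) = xd (map_poly d p).
Proof.
by apply/polyP => i; rewrite coef_map_drv !coef_xd (drvM dd) (drv_nat dd) mul0r addr0 coef_map_drv.
Qed.

End Lift.

Lemma xdC c : xd c%:P = 0. Proof. by rewrite /xd derivC mulr0. Qed.
Lemma xdXn n : xd 'X^n = n%:R * 'X^n.
Proof. by apply/polyP => i; rewrite coef_xd -polyC_natr coefCM coefXn; case: eqP => [->|]; rewrite ?mulr0. Qed.

Section Inversion.
Variables (psi : nat -> P).

(* [phi_next], ..., [fcoef] for an arbitrary sequence psi in a commutative ring. *)
Definition ser_phi_next (s : seq P) : P :=
  let j := (size s).+1 in
  let g : {poly P} := \sum_(l < size s) (s`_l)%:P * 'X^(l.+2) in
  let w : {poly P} := \sum_(t < j.+1) (- g) ^+ t in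
  - \sum_(1 <= i < j.+1) psi i * (w ^+ i)`_(j - i).

Fixpoint ser_phis (n : nat) : seq P :=
  if n is n'.+1 then rcons (ser_phis n') (ser_phi_next (ser_phis n')) else [::].

Definition ser_phi (j : nat) : P := (ser_phis j)`_(j.-1).

Definition ser_Phi (N : nat) : {poly P} :=
  1 + \sum_(j < N) (ser_phi j.+1)%:P * 'X^(j.+2).
Definition ser_H (N : nat) : {poly P} :=
  -1 + \sum_(j < N) ((j.+1)%:R * ser_phi j.+1)%:P * 'X^(j.+2).

Definition ser_acc (m N : nat) (l : seq P) : {poly P} :=
  \sum_(s < size l) (l`_s)%:P * 'X^s * ser_Phi N ^+ (m - s).

Fixpoint ser_cs (m N t : nat) : seq P :=
  if t is t'.+1 then
    let l := ser_cs m N t' in rcons l ((ser_H N - ser_acc m N l)`_t)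
  else [:: (ser_H N)`_0].

Definition ser_f (k : int) (i : nat) : P :=
  match (k + 1)%R with
  | Posz m => let N := (m + i)%N in (ser_H N - ser_acc m N (ser_cs m N m))`_(m + i)
  | Negz d => if (d < i)%N then (ser_H (i - d.+1))`_(i - d.+1) else 0
  end.

Lemma size_phis n : size (ser_phis n) = n.
Proof. by elim: n => //= n IH; rewrite size_rcons IH. Qed.

Lemma nth_phis n l : (l < n)%N -> (ser_phis n)`_l = ser_phi l.+1.
Proof.
elim: n => // n IH lt; rewrite [ser_phis n.+1]/= nth_rcons size_phis.
move: lt; rewrite ltnS leq_eqVlt => /orP[/eqP->|lt]; last by rewrite lt IH.
by rewrite ltnn eqxx /ser_phi /= nth_rcons size_phis ltnn eqxx.
Qed.

(** The inverse of Phi as a truncated geometric series. *)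
Definition ser_w N : {poly P} := \sum_(t < N.+2) (1 - ser_Phi N) ^+ t.

Lemma PhiE n : ser_Phi n - 1 = \sum_(j < n) (ser_phi j.+1)%:P * 'X^(j.+2).
Proof. by rewrite addrC addKr. Qed.

Lemma coef_tail2 n (F : nat -> P) i : (\sum_(j < n) (F j)%:P * 'X^(j.+2))`_i =
  if (1 < i < n.+2)%N then F i.-2 else 0.
Proof.
rewrite coef_sum; case: ifP => [/andP[h1 h2]|h].
  have lt : (i.-2 < n)%N by lia.
  rewrite (bigD1 (Ordinal lt)) //= coefCM coefXn (_ : (i == i.-2.+2) = true); last by lia.
  rewrite mulr1 big1 ?addr0 // => j /eqP ne; rewrite coefCM coefXn.
  rewrite (_ : (i == j.+2) = false) ?mulr0 //; apply/eqP => e; apply: ne.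
  by apply: val_inj; rewrite /= e.
rewrite big1 // => j _; rewrite coefCM coefXn (_ : (i == j.+2) = false) ?mulr0 //.
by have := ltn_ord j; lia.
Qed.

Lemma Phi_idl n : idl 2 (ser_Phi n - 1).
Proof. by move=> i lt; rewrite PhiE (coef_tail2 _ (fun j => ser_phi j.+1)); case: ifP => //; lia. Qed.

Lemma Phi_prefix a b : (a <= b)%N -> idl a.+2 (ser_Phi b - ser_Phi a).
Proof.
move=> le i lt; rewrite (_ : ser_Phi b - _ = (ser_Phi b - 1) - (ser_Phi a - 1)); last by ring.
rewrite !PhiE coefB !(coef_tail2 _ (fun j => ser_phi j.+1)).
by case: ifP; case: ifP => //; rewrite ?subrr //; lia.
Qed.

Lemma Phi_w n : idl n.+2 (ser_Phi n * ser_w n - 1).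
Proof.
have := subrXX 1 (1 - ser_Phi n) n.+2; rewrite expr1n subKr.
under eq_bigr do rewrite expr1n mul1r.
rewrite -/(ser_w n) => <-.
rewrite (_ : 1 - _ - 1 = - (1 - ser_Phi n) ^+ n.+2); last by ring.
apply/idlN/(@idl_le _ (2 * n.+2)); first by lia.
by apply: idl_exp; apply: idl_sym; apply: Phi_idl.
Qed.

Lemma w_prefix a b : (a <= b)%N -> idl a.+2 (ser_w b - ser_w a).
Proof.
move=> le; have h1 := @Phi_w a; have h2 : idl a.+2 (ser_Phi b * ser_w b - 1) by apply: (idl_le _ (@Phi_w b)).
have h3 := Phi_prefix le.
rewrite (_ : _ - _ = - ser_w b * (ser_Phi a * ser_w a - 1) + ser_w a * (ser_Phi b * ser_w b - 1)
   - ser_w a * ser_w b * (ser_Phi b - ser_Phi a)); last by ring.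
by apply: idlB; [apply: idlD|]; apply: idlMl => //; apply: h2.
Qed.

(** Since i >= 1, only coefficients of [ser_w] up to lambda^j are read, so the truncation used in
    [ser_phi_next] may be replaced by any longer one. *)
Lemma phiE j N : (j <= N)%N -> ser_phi j.+1 = - \sum_(1 <= i < j.+2) psi i * (ser_w N ^+ i)`_(j.+1 - i).
Proof.
move=> le; rewrite /ser_phi /= nth_rcons size_phis ltnn eqxx /ser_phi_next size_phis.
have -> : \sum_(l < j) ((ser_phis j)`_l)%:P * 'X^(l.+2) = ser_Phi j - 1.
  by rewrite PhiE; apply: eq_bigr => l _; rewrite nth_phis.
rewrite opprB -/(ser_w j); congr (- _); apply: eq_big_nat => i /andP[i0 _]; congr (_ * _).
by apply/esym/(idl_coef (n := j.+2)); [apply/idl_subX/w_prefix|lia].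
Qed.

End Inversion.
End TruncatedSeries.

Arguments Phi_w {P} psi n i _.

(** * Implicit differentiation of psi(phi(lambda)) = 1/lambda *)

Section SeriesInversion.
Variables (P : comNzRingType) (psi : nat -> P).
Hypothesis psi0 : psi 0 = 0.
Variable N : nat.
Local Notation n := N.+2.
Local Notation Phi := (ser_Phi psi N).
Local Notation H := (ser_H psi N).
Local Notation w := (ser_w psi N).
Implicit Types (p q : {poly P}).

(* [ser_nu] is 1 / phi and [ser_J] is - 1 / (lambda^2 phi_lambda), both modulo
   lambda^(N+2). *)
Definition ser_nu : {poly P} := 'X * w.
Definition ser_S : {poly P} := \sum_(i < n) (psi i)%:P * 'X^(i.+1) * w ^+ i.
Definition ser_S' : {poly P} := \sum_(i < n) i%:R * (psi i)%:P * 'X^(i.+1) * w ^+ i.-1.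
Definition ser_J : {poly P} := 1 - w ^+ 2 * ser_S'.
Local Notation nu := ser_nu.
Local Notation J := ser_J.

Lemma xd_Phi : xd Phi = H + Phi.
Proof.
have X := xd_derivation P.
rewrite /ser_Phi /ser_H (drvD X) (drv1 X) add0r (drv_sum X) addrACA addNr add0r -big_split.
apply: eq_bigr => i _ /=; rewrite (drvM X) xdC xdXn mul0r addr0 polyCM -polyC_natr.
by rewrite -!natr1; ring.
Qed.

(** This is lambda psi(phi(lambda)) = 1; [ser_phi_next] solves it one coefficient at a time. *)
Lemma series_relation : idl n (Phi + ser_S - 1).
Proof.
have c i j : ((psi i)%:P * 'X^(i.+1) * w ^+ i)`_j.+1 = if (i <= j)%N then psi i * (w ^+ i)`_(j - i) else 0.
  by rewrite -mulrA coefCM coefXnM ltnS ltnNge; case: leqP => h; rewrite ?mulr0 // subSS.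
rewrite (_ : _ - 1 = (Phi - 1) + ser_S); last by ring.
move=> [|j] lt; rewrite coefD (PhiE psi) (coef_tail2 _ (fun j => ser_phi psi j.+1)) /ser_S coef_sum.
  by rewrite add0r big1 // => i _; rewrite -mulrA coefCM coefXnM mulr0.
under eq_bigr do rewrite c.
rewrite -(big_mkord xpredT (fun i => if (i <= j)%N then psi i * (w ^+ i)`_(j - i) else 0)).
rewrite (big_cat_nat (n := j.+1)) //=; last by lia.
rewrite [X in _ + (_ + X)]big_nat_cond [X in _ + (_ + X)]big1 ?addr0; last first.
  by move=> i /andP[/andP[h _] _]; rewrite leqNgt h.
rewrite big_ltn // psi0 mul0r leq0n add0r.
case: j lt => [|j] lt; first by rewrite big_geq // addr0.
rewrite ifT; last by lia.
rewrite (phiE psi (N := N)); last by lia.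
rewrite addrC; apply/eqP; rewrite subr_eq0; apply/eqP; apply: eq_big_nat => i /andP[_ h].
by rewrite ifT.
Qed.

Section Derivation.
Variable D : {poly P} -> {poly P}.
Hypothesis DD : derivation D.
Hypothesis Didl : forall p, idl n p -> idl n (D p).

Lemma drv_w : idl n (D w + w ^+ 2 * D Phi).
Proof.
have h := Phi_w psi N; have := Didl h; rewrite (drvB DD) (drv1 DD) subr0 (drvM DD) => h'.
rewrite (_ : _ + _ = w * (Phi * D w + D Phi * w) - (Phi * w - 1) * D w); last by ring.
by apply: idlB; [apply: idlMl|apply: idlMr].
Qed.

(** The derivative of [series_relation]: [J] is psi'(phi), and the sum is D applied to psi with phi
    frozen. It serves for coefficientwise derivations, for [xd] and for the weight operator
    alike. *)
Lemma drv_relation : idl n (D Phi * J + \sum_(i < n) D ((psi i)%:P * 'X^(i.+1)) * w ^+ i).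
Proof.
have := Didl series_relation; rewrite (drvB DD) (drvD DD) (drv1 DD) subr0 => h.
have -> : D Phi * J + \sum_(i < n) D ((psi i)%:P * 'X^(i.+1)) * w ^+ i =
   (D Phi + D ser_S) - ser_S' * (D w + w ^+ 2 * D Phi).
  rewrite /J /ser_S (drv_sum DD); under [in RHS]eq_bigr do rewrite (drvM DD) (drvX DD) addrC.
  rewrite big_split /= (_ : \sum_(i < n) (psi i)%:P * 'X^(i.+1) * (i%:R * w ^+ i.-1 * D w) = ser_S' * D w).
    by ring.
  by rewrite /ser_S' mulr_suml; apply: eq_bigr => i _; ring.
by apply: idlB h _; apply: idlMl; exact: drv_w.
Qed.

End Derivation.

(** The chain rule psi'(phi) phi_lambda = - 1/lambda^2. *)
Lemma HJ : idl n (H * J + 1).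
Proof.
have X := xd_derivation P.
have := drv_relation X (@xd_idl P n); rewrite xd_Phi => h.
have e1 := series_relation; have e2 := Phi_w psi N.
have e3 : \sum_(i < n) xd ((psi i)%:P * 'X^(i.+1)) * w ^+ i = ser_S + w * ser_S'.
  rewrite /ser_S /ser_S' mulr_sumr -big_split; apply: eq_bigr => i _ /=.
  rewrite (drvM X) xdC xdXn mul0r addr0; case: (i : nat) => [|j] /=; last first.
    by rewrite [w ^+ j.+1]exprS -natr1; ring.
  by rewrite psi0 !polyC0; ring.
rewrite e3 in h.
rewrite (_ : H * J + 1 = ((H + Phi) * J + (ser_S + w * ser_S')) - (Phi + ser_S - 1)
   + (Phi * w - 1) * (w * ser_S')); last by rewrite /J; ring.
by apply: idlD; [apply: idlB|apply: idlMr].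
Qed.

Lemma div_J p q : idl n (p * J + q) -> idl n (p - H * q).
Proof.
move=> h; rewrite (_ : _ - _ = p * (H * J + 1) - H * (p * J + q)); last by ring.
by apply: idlB; apply: idlMl => //; exact: HJ.
Qed.

Lemma div_J0 p : idl n (p * J) -> idl n p.
Proof. by move=> h; have := @div_J p 0; rewrite addr0 mulr0 subr0; apply. Qed.

Lemma J_nu : J = 1 - \sum_(i < n) (i%:R * psi i)%:P * nu ^+ i.+1.
Proof.
rewrite /J /ser_S' mulr_sumr; congr (_ - _); apply: eq_bigr => i _.
rewrite polyCM -polyC_natr /nu exprMn; case: (i : nat) => [|j] /=; first by ring.
by rewrite [w ^+ j.+2]exprS [w ^+ j.+1]exprS; ring.
Qed.

Lemma nu_idl k : idl k (nu ^+ k).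
Proof. by rewrite exprMn; apply: idlMr; exact: idl_X. Qed.

Lemma Phi_nu : idl n (Phi * nu - 'X).
Proof.
rewrite (_ : _ - _ = 'X * (Phi * w - 1)); last by rewrite /nu; ring.
by apply: idlMl; exact: Phi_w.
Qed.

Lemma xd_nu : idl n (xd nu + nu * w * H).
Proof.
have X := xd_derivation P; have e := drv_w X (@xd_idl P n); rewrite xd_Phi in e.
rewrite (drvM X) -['X]expr1 xdXn !expr1.
rewrite (_ : _ + _ = 'X * (xd w + w ^+ 2 * (H + Phi)) - nu * (Phi * w - 1)); last by rewrite /nu; ring.
by apply: idlB; apply: idlMl => //; exact: Phi_w.
Qed.

Lemma nu_tail (f : nat -> P) k : (N < k)%N ->
  idl n (\sum_(l < k) (f l)%:P * nu ^+ l.+1 - \sum_(l < N.+1) (f l)%:P * nu ^+ l.+1).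
Proof.
move=> lt; rewrite -!(big_mkord xpredT (fun l => (f l)%:P * nu ^+ l.+1)).
rewrite [X in X - _](big_cat_nat (n := N.+1)) //= addrAC subrr add0r.
rewrite big_nat_cond; apply: idl_sum => l /andP[/andP[h _] _]; apply: idlMl.
by apply: (idl_le _ (@nu_idl _)).
Qed.

Lemma nu_shift (g : nat -> P) a : g 0 = 0 ->
  idl n (\sum_(l < N.+1) (g (l - a.+1)%N)%:P * nu ^+ l.+1 -
         nu ^+ a.+1 * \sum_(i < n) (g i)%:P * nu ^+ i.+1).
Proof.
move=> g0; have -> : nu ^+ a.+1 * \sum_(i < n) (g i)%:P * nu ^+ i.+1 =
    \sum_(l < a.+1 + n) (g (l - a.+1)%N)%:P * nu ^+ l.+1.
  rewrite big_split_ord /= [X in _ = X + _]big1 => [|i _]; last first.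
    by rewrite (_ : (_ - a.+1)%N = 0%N) ?g0 ?polyC0 ?mul0r //=; have := ltn_ord i; lia.
  rewrite add0r mulr_sumr; apply: eq_bigr => i _.
  by rewrite addKn -addnS [in RHS]exprD mulrCA.
by apply: idl_sym; apply: (@nu_tail (fun l => g (l - a.+1)%N)); lia.
Qed.

(** The coefficient of s^a in [eps l], as in [eps_coef]. *)
Definition epc l a : P := (l == a)%:R - (l - a.+1)%:R * psi (l - a.+1).

(** The generating function of the [eps l]: the sum of eps_l(s) phi^(- l - 1) is psi'(phi) / (phi -
    s). *)
Lemma epc_sum a : idl n (\sum_(l < N.+1) (epc l a)%:P * nu ^+ l.+1 - nu ^+ a.+1 * J).
Proof.
have h := @nu_shift (fun i => i%:R * psi i) a (mul0r _).
rewrite J_nu mulrBr mulr1; move: h; set S := \sum_(i < n) _; set S1 := \sum_(l < _) _ => h.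
have -> : \sum_(l < N.+1) (epc l a)%:P * nu ^+ l.+1 =
    \sum_(l < N.+1) ((l : nat) == a)%:R * nu ^+ l.+1 - S1.
  by rewrite /S1 -sumrB; apply: eq_bigr => l _; rewrite /epc polyCB -polyC_natr; ring.
set S2 := \sum_(l < _) _.
have h2 : idl n (S2 - nu ^+ a.+1).
  have [lt|le] := ltnP a N.+1.
    rewrite /S2 (bigD1 (Ordinal lt)) //= eqxx mul1r big1 ?addr0 ?subrr; first exact: idl0.
    move=> i /eqP ne; case: eqP => e; rewrite ?mul0r //.
    by case: ne; apply: val_inj.
  rewrite /S2 big1 ?sub0r; first by apply: idlN; apply: (idl_le _ (@nu_idl _)).
  by move=> i _; rewrite (_ : _ == _ = false) ?mul0r //; have := ltn_ord i; lia.
rewrite (_ : _ - _ - _ = (S2 - nu ^+ a.+1) - (S1 - nu ^+ a.+1 * S)); last by ring.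
exact: idlB.
Qed.

Lemma pull_psi (d : P -> P) : derivation d ->
  \sum_(i < n) map_poly d ((psi i)%:P * 'X^(i.+1)) * w ^+ i =
  'X * \sum_(l < N.+1) (d (psi l.+1))%:P * nu ^+ l.+1.
Proof.
move=> dd; have X := map_derivation dd; rewrite big_ord_recl /=.
rewrite psi0 polyC0 mul0r (drv0 X) mul0r add0r mulr_sumr; apply: eq_bigr => i _.
rewrite (drvM X) (map_drvXn dd) mulr0 add0r (map_drvC dd) /= /bump add1n /nu exprMn.
by rewrite ['X^(i.+2)]exprS; ring.
Qed.

Section VerticalField.
Variables (d : P -> P) (Gam : nat -> P).
Hypothesis dd : derivation d.
Hypothesis dpsi : forall i, d (psi i.+1) = Gam i.+1.

Definition ser_Gam : {poly P} := \sum_(l < N.+1) (Gam l.+1)%:P * nu ^+ l.+1.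

(** From psi(phi) = 1/lambda one has d phi = - (d psi)(phi) / psi'(phi), and [H] is - 1 /
    psi'(phi). *)
Lemma vertical_Phi : idl n (map_poly d Phi - H * ('X * ser_Gam)).
Proof.
apply: div_J; have := drv_relation (map_derivation dd) (@map_idl _ _ dd n).
rewrite pull_psi //; congr (idl _ (_ + _ * _)); apply: eq_bigr => l _; by rewrite dpsi.
Qed.

Lemma vertical_phi i : (i < N)%N -> d (ser_phi psi i.+1) = (H * ser_Gam)`_i.+1.
Proof.
move=> lt; have := idl_coef vertical_Phi (_ : (i.+2 < n)%N); rewrite ltnS ltnS => /(_ lt).
rewrite (coef_map_drv dd) mulrCA coefXM /= => <-; rewrite /ser_Phi coefD coef1 add0r.
by rewrite (coef_tail2 _ (fun j => ser_phi psi j.+1)) ifT //; lia.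
Qed.

End VerticalField.

Section Char.
Variables (d : P -> P) (a : nat) (Gam K : nat -> P) (M : nat).
Hypothesis dd : derivation d.
Hypothesis dpsi : forall l, d (psi l.+1) = epc l a.
Local Notation D := (map_poly d).
Let DD := map_derivation dd.
Let Did := @map_idl _ _ dd n.

Lemma char_Phi : idl n (D Phi + 'X * nu ^+ a.+1).
Proof.
apply: div_J0; have := drv_relation DD Did; rewrite pull_psi // => h.
have e := epc_sum a.
have -> : (D Phi + 'X * nu ^+ a.+1) * J = (D Phi * J + 'X * \sum_(l < N.+1) (d (psi l.+1))%:P * nu ^+ l.+1)
   - 'X * (\sum_(l < N.+1) (epc l a)%:P * nu ^+ l.+1 - nu ^+ a.+1 * J).
  by under eq_bigr do rewrite dpsi; ring.
by apply: idlB => //; apply: idlMl.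
Qed.

Lemma char_nu : idl n (D nu - nu ^+ a.+3).
Proof.
have e := drv_w DD Did.
rewrite (drvM DD) -['X]expr1 (map_drvXn dd) !expr1 mul0r addr0.
rewrite (_ : _ - _ = 'X * (D w + w ^+ 2 * D Phi) - nu * w * (D Phi + 'X * nu ^+ a.+1)).
  by apply: idlB; apply: idlMl => //; exact: char_Phi.
by rewrite 2!exprS; move: (nu ^+ a.+1) => t; rewrite /nu; ring.
Qed.

Lemma char_H : idl n (D H - a.+1%:R * nu ^+ a.+2 * H).
Proof.
have X := xd_derivation P.
have e := char_Phi; have e' := xd_idl e; have f := xd_nu.
have ex : xd ('X * nu ^+ a.+1) = 'X * (a.+1%:R * nu ^+ a * xd nu) + 'X * nu ^+ a.+1.
  by rewrite (drvM X) (drvX X) -{2 4}['X]expr1 xdXn !expr1 mul1r.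
move: e'; rewrite (drvD X) ex => e'.
have -> : D H = xd (D Phi) - D Phi.
  by rewrite -(map_xd dd) -(drvB DD) xd_Phi addrK.
rewrite (_ : _ - _ - _ = (xd (D Phi) + ('X * (a.+1%:R * nu ^+ a * xd nu) + 'X * nu ^+ a.+1))
  - (D Phi + 'X * nu ^+ a.+1) - 'X * a.+1%:R * nu ^+ a * (xd nu + nu * w * H)).
  by apply: idlB; [apply: idlB|apply: idlMl].
by rewrite 2![nu ^+ _.+1]exprS; move: (nu ^+ a) (xd nu) => t t'; rewrite /nu; ring.
Qed.

Lemma char_J : idl n (D J + a.+1%:R * nu ^+ a.+2 * J).
Proof.
have g := char_H; have h := HJ; have := Did h; rewrite (drvD DD) (drv1 DD) addr0 (drvM DD) => h'.
set c := a.+1%:R * _ in g *.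
rewrite (_ : _ + _ = (H * J + 1) * (D J + c * J) + J ^+ 2 * (D H - c * H) - J * (H * D J + D H * J)).
  by apply: idlB; [apply: idlD; [apply: idlMr|apply: idlMl]|apply: idlMl].
by ring.
Qed.

Hypothesis dGam : forall l, d (Gam l.+1) = - (l - a.+1)%:R * Gam (l - a.+1) +
  \sum_(i < a.+2) (a.+1 + i)%:R * K i * epc l (a.+1 - i)%N.
Hypothesis dK : forall j, d (K j) = (j + 2 * a + 3)%:R * K (a + j).+2.
Hypothesis KM : forall j, (M < j)%N -> K j = 0.
Local Notation G := (ser_Gam Gam).

(** In the sum over l, the first term of [dGam] cancels against the derivative of the powers of nu
    ([char_nu]), and the second is evaluated by [epc_sum]. *)
Lemma char_Gam_ser : idl n (D G - J * \sum_(i < a.+2) ((a.+1 + i)%:R * K i)%:P * nu ^+ (a.+2 - i)).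
Proof.
have s := @nu_shift (fun i => i%:R * Gam i) a (mul0r _).
pose e1 (i : nat) := \sum_(l < N.+1) (epc l (a.+1 - i)%N)%:P * nu ^+ l.+1 - nu ^+ (a.+2 - i) * J.
have h1 : idl n (\sum_(i < a.+2) ((a.+1 + i)%:R * K i)%:P * e1 i).
  apply: idl_sum => i _; apply: idlMl; 
  have ei : (a.+2 - i = (a.+1 - i).+1)%N by have := ltn_ord i; lia.
  rewrite /e1 ei.
  exact: epc_sum.
pose c := \sum_(l < N.+1) (l.+1%:R * Gam l.+1)%:P * nu ^+ l.
have h2 : idl n (c * (D nu - nu ^+ a.+3)) by apply: idlMl; exact: char_nu.
move: s; rewrite [X in _ * X]big_ord_recl mul0r polyC0 mul0r add0r.
have -> : \sum_(i < N.+1) ((lift ord0 i)%:R * Gam (lift ord0 i))%:P * nu ^+ (lift ord0 i).+1 = nu ^+ 2 * c.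
  by rewrite mulr_sumr; apply: eq_bigr => i _; rewrite /= /bump add1n 2!exprS; ring.
set s1 := \sum_(l < N.+1) _ => s.
have e : D G = c * D nu - s1 + \sum_(l < N.+1) \sum_(i < a.+2) ((a.+1 + i)%:R * K i)%:P * ((epc l (a.+1 - i)%N)%:P * nu ^+ l.+1).
  rewrite /ser_Gam (drv_sum DD) /c mulr_suml /s1 -sumrB -big_split; apply: eq_bigr => l _ /=.
  rewrite (drvM DD) (drvX DD) (map_drvC dd) dGam polyCD rmorph_sum mulrDl mulr_suml /=.
  have -> : \sum_(i < a.+2) ((a.+1 + i)%:R * K i * epc l (a.+1 - i)%N)%:P * nu ^+ l.+1 =
     \sum_(i < a.+2) ((a.+1 + i)%:R * K i)%:P * ((epc l (a.+1 - i)%N)%:P * nu ^+ l.+1).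
    by apply: eq_bigr => i _; rewrite [in LHS]polyCM mulrA.
  by rewrite addrA; congr (_ + _); rewrite mulNr polyCN [(l.+1%:R * _)%:P]polyCM -polyC_natr; ring.
have -> : D G - J * \sum_(i < a.+2) ((a.+1 + i)%:R * K i)%:P * nu ^+ (a.+2 - i) =
  c * (D nu - nu ^+ a.+3) - (s1 - nu ^+ a.+1 * (nu ^+ 2 * c)) + \sum_(i < a.+2) ((a.+1 + i)%:R * K i)%:P * e1 i.
  rewrite e exchange_big /= /e1.
  under [X in _ = _ + X]eq_bigr do rewrite mulrBr mulrA.
  rewrite sumrB /= mulr_sumr.
  under [X in _ + X - _ = _]eq_bigr do rewrite -mulr_sumr.
  rewrite (_ : nu ^+ a.+3 = nu ^+ a.+1 * nu ^+ 2); last by rewrite -exprD addn2.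
  have -> : \sum_(i < a.+2) J * (((a.+1 + i)%:R * K i)%:P * nu ^+ (a.+2 - i)) =
     \sum_(i < a.+2) ((a.+1 + i)%:R * K i)%:P * nu ^+ (a.+2 - i) * J.
    by apply: eq_bigr => i _; rewrite mulrC.
  ring.
by apply: idlD => //; apply: idlB.
Qed.

(** lambda^M (V' phi - sum_j K_j phi^j); the factor clears the negative powers of lambda. *)
Definition ser_Y (G : {poly P}) : {poly P} :=
  H * 'X^M * G - \sum_(j < M.+1) (K j)%:P * 'X^(M - j) * Phi ^+ j.

(** The equation is that of [H] in [char_H], so the quotient, up to sign [ser_Y G * J], is
    annihilated. *)
Lemma char_Y : idl n (D (ser_Y G) - a.+1%:R * nu ^+ a.+2 * ser_Y G).
Proof.
(* [F j] is lambda^M phi^(j - b), for either sign of the exponent. *)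
pose b := a.+2; pose F j := if (j < b)%N then 'X^M * nu ^+ (b - j) else 'X^(M + b - j) * Phi ^+ (j - b).
pose k j : {poly P} := ((j + a.+1)%:R * K j)%:P.
have hF j : (j <= M)%N -> idl n (nu ^+ b * ('X^(M - j) * Phi ^+ j) - F j).
  move=> le; rewrite /F; case: ltnP => h.
    have e : idl n ((Phi * nu) ^+ j - 'X^j) by apply: idl_subX; exact: Phi_nu.
    rewrite (_ : _ - _ = nu ^+ (b - j) * 'X^(M - j) * ((Phi * nu) ^+ j - 'X^j)); first exact: idlMl.
    have -> : nu ^+ b = nu ^+ (b - j) * nu ^+ j by rewrite -exprD subnK // ltnW.
    have -> : 'X^M = 'X^(M - j) * 'X^j :> {poly P} by rewrite -exprD subnK.
    rewrite (exprMn _ Phi); move: (nu ^+ j) (nu ^+ (b - j)) (Phi ^+ j) ('X^j) ('X^(M - j)) => x1 x2 x3 x4 x5.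
    by ring.
  have e : idl n ((Phi * nu) ^+ b - 'X^b) by apply: idl_subX; exact: Phi_nu.
  rewrite (_ : _ - _ = Phi ^+ (j - b) * 'X^(M - j) * ((Phi * nu) ^+ b - 'X^b)); first exact: idlMl.
  have -> : Phi ^+ j = Phi ^+ (j - b) * Phi ^+ b by rewrite -exprD subnK.
  have -> : 'X^(M + b - j) = 'X^(M - j) * 'X^b :> {poly P} by rewrite -exprD addnBAC.
  rewrite (exprMn _ Phi); move: (nu ^+ b) (Phi ^+ (j - b)) (Phi ^+ b) ('X^b) ('X^(M - j)) => x1 x2 x3 x4 x5.
  by ring.
(* For j >= b the coefficient (j + a + 1) K_j is Ea K_(j - b) by [dK]; the terms with j < b will
   match those in the derivative of [G]. *)
have sF : \sum_(j < M.+1) k j * F j = \sum_(i < b) k i * ('X^M * nu ^+ (b - i)) +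
   \sum_(j < M.+1) (d (K j))%:P * ('X^(M - j) * Phi ^+ j).
  transitivity (\sum_(j < b + M.+1) k j * F j).
    rewrite -!(big_mkord xpredT (fun j => k j * F j)) [RHS](big_cat_nat (n := M.+1)) //=; last by lia.
    rewrite [X in _ = _ + X]big_nat_cond [X in _ = _ + X]big1 ?addr0 // => j /andP[/andP[h _] _].
    by rewrite /k KM // mulr0 polyC0 mul0r.
  rewrite big_split_ord /=; congr (_ + _); apply: eq_bigr => i _.
    by rewrite /F ltn_ord.
  rewrite /F ltnNge leq_addr /= /k dK addKn; congr (_%:P * ('X^_ * _)); last by lia.
  by congr (_%:R * K _); rewrite /b; lia.
have h1 : idl n (\sum_(j < M.+1) k j * (nu ^+ b * ('X^(M - j) * Phi ^+ j) - F j)).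
  by apply: idl_sum => j _; apply: idlMl; apply: hF; rewrite -ltnS.
pose r j : {poly P} := (j%:R * K j)%:P * 'X^(M - j) * Phi ^+ j.-1.
have h2 : idl n (\sum_(j < M.+1) r j * ((D Phi + 'X * nu ^+ a.+1) + nu ^+ a.+1 * (Phi * nu - 'X))).
  apply: idl_sum => j _; apply: idlMl; apply: idlD; first exact: char_Phi.
  by apply: idlMl; exact: Phi_nu.
have DS : D (\sum_(j < M.+1) (K j)%:P * 'X^(M - j) * Phi ^+ j) =
  \sum_(j < M.+1) (d (K j))%:P * ('X^(M - j) * Phi ^+ j) + \sum_(j < M.+1) r j * D Phi.
  rewrite (drv_sum DD) -big_split; apply: eq_bigr => j _ /=.
  rewrite !(drvM DD) (drvX DD) (map_drvXn dd) (map_drvC dd) /r polyCM -polyC_natr; ring.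
pose u := \sum_(i < a.+2) ((a.+1 + i)%:R * K i)%:P * nu ^+ (a.+2 - i).
have hG : idl n (D G - J * u) by exact: char_Gam_ser.
have kE : \sum_(i < b) k i * ('X^M * nu ^+ (b - i)) = 'X^M * u.
  by rewrite mulr_sumr; apply: eq_bigr => i _; rewrite /k addnC; ring.
have hS : nu ^+ b * \sum_(j < M.+1) (K j)%:P * 'X^(M - j) * Phi ^+ j * a.+1%:R
  - \sum_(j < M.+1) r j * D Phi = \sum_(j < M.+1) k j * (nu ^+ b * ('X^(M - j) * Phi ^+ j) - F j)
   + \sum_(j < M.+1) k j * F j
  - \sum_(j < M.+1) r j * ((D Phi + 'X * nu ^+ a.+1) + nu ^+ a.+1 * (Phi * nu - 'X)).
  rewrite mulr_sumr -!big_split -!sumrB /=; apply: eq_bigr => j _.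
  rewrite /k /r natrD mulrDl polyCD !polyCM -!polyC_natr /b [nu ^+ a.+2]exprS.
  case: (j : nat) => [|i] /=; first by ring.
  by rewrite [Phi ^+ i.+1]exprS; ring.
rewrite /ser_Y (drvB DD) !(drvM DD) (map_drvXn dd) DS mulr0 add0r.
move: hS; rewrite sF kE -mulr_suml; set S := \sum_(j < M.+1) _ * _ ^+ _.
set S1 := \sum_(j < M.+1) _; set S2 := \sum_(j < M.+1) _; set S3 := \sum_(j < M.+1) _; set S4 := \sum_(j < M.+1) _ => hS.
rewrite (_ : _ - _ = (D H - a.+1%:R * nu ^+ a.+2 * H) * ('X^M * G) + 'X^M * H * (D G - J * u)
   + 'X^M * u * (H * J + 1) + (nu ^+ b * (S * a.+1%:R) - S1) - S3 - 'X^M * u); last by rewrite /b; ring.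
rewrite hS.
rewrite (_ : _ - _ - _ = (D H - a.+1%:R * nu ^+ a.+2 * H) * ('X^M * G) + 'X^M * H * (D G - J * u)
   + 'X^M * u * (H * J + 1) + S2 - S4); last by ring.
apply: idlB => //; apply: idlD => //; apply: idlD; last by apply: idlMl; exact: HJ.
by apply: idlD; [apply: idlMr; exact: char_H|apply: idlMl].
Qed.

Lemma char_T : idl n (D (ser_Y G * J)).
Proof.
have h1 := char_Y; have h2 := char_J; set c := a.+1%:R * _ in h1 h2.
rewrite (drvM DD) (_ : _ + _ = ser_Y G * (D J + c * J) + (D (ser_Y G) - c * ser_Y G) * J); last by ring.
by apply: idlD; [apply: idlMl|apply: idlMr].
Qed.

End Char.
Section Euler.
Variables (d : P -> P) (Gam K : nat -> P) (M : nat) (mu : P).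
Hypothesis dd : derivation d.
Hypothesis dpsi : forall i, d (psi i) = i.+1%:R * psi i.
Hypothesis dGam : forall i, d (Gam i) = (i%:R + mu) * Gam i.
Hypothesis dK : forall j, d (K j) = (mu - j%:R) * K j.
(** The weight operator on series, with lambda of weight - 1; then phi has weight 1 and Phi weight
    0. *)
Definition ser_euler p := map_poly d p - xd p.
Local Notation D := ser_euler.
Local Notation G := (ser_Gam Gam).

Lemma euler_derivation : derivation D.
Proof.
have X := xd_derivation P; have M' := map_derivation dd.
by split=> p q; rewrite /D !(drvD X, drvD M', drvM X, drvM M'); ring.
Qed.
Let DD := euler_derivation.

Lemma euler_idl p : idl n p -> idl n (D p).
Proof. by move=> h; apply: idlB; [apply: map_idl|apply: xd_idl]. Qed.

Lemma eulerC c : D c%:P = (d c)%:P.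
Proof. by rewrite /D (map_drvC dd) xdC subr0. Qed.
Lemma eulerXn k : D 'X^k = - k%:R * 'X^k.
Proof. by rewrite /D (map_drvXn dd) xdXn sub0r mulNr. Qed.

Lemma euler_Phi : idl n (D Phi).
Proof.
apply: div_J0; have := drv_relation DD euler_idl; rewrite big1 ?addr0 // => i _.
by rewrite (drvM DD) eulerC eulerXn dpsi polyCM -polyC_natr; ring.
Qed.

Lemma euler_nu : idl n (D nu + nu).
Proof.
have e := drv_w DD euler_idl; rewrite (drvM DD) -['X]expr1 eulerXn !expr1.
rewrite (_ : _ + _ = 'X * (D w + w ^+ 2 * D Phi) - 'X * w ^+ 2 * D Phi); last by rewrite /nu; ring.
by apply: idlB; apply: idlMl => //; exact: euler_Phi.
Qed.

Lemma euler_H : idl n (D H).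
Proof.
have X := xd_derivation P; have M' := map_derivation dd.
have -> : D H = xd (D Phi) - D Phi.
  have -> : H = xd Phi - Phi by rewrite xd_Phi addrK.
  by rewrite (drvB DD) /D (map_xd dd) (drvB X).
by apply: idlB; [apply: xd_idl|]; exact: euler_Phi.
Qed.

Lemma euler_J : idl n (D J).
Proof.
have g := euler_H; have h := HJ; have := euler_idl h; rewrite (drvD DD) (drv1 DD) addr0 (drvM DD) => h'.
rewrite (_ : D J = (H * J + 1) * D J + J ^+ 2 * D H - J * (H * D J + D H * J)); last by ring.
by apply: idlB; [apply: idlD; [apply: idlMr|apply: idlMl]|apply: idlMl].
Qed.

Lemma euler_Gam : idl n (D G - mu%:P * G).
Proof.
have -> : D G - mu%:P * G = (\sum_(l < N.+1) (l.+1%:R * Gam l.+1)%:P * nu ^+ l) * (D nu + nu).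
  rewrite /ser_Gam (drv_sum DD) mulr_sumr mulr_suml -sumrB; apply: eq_bigr => l _.
  rewrite (drvM DD) (drvX DD) eulerC dGam !polyCM polyCD -polyC_natr exprS /=.
  by move: (Gam l.+1)%:P (nu ^+ l) (D nu) => x1 x2 x3; ring.
by apply: idlMl; exact: euler_nu.
Qed.

Lemma euler_Y : idl n (D (ser_Y K M G) - (mu - M%:R)%:P * ser_Y K M G).
Proof.
pose r (j : nat) : {poly P} := (K j)%:P * 'X^(M - j) * (j%:R * Phi ^+ j.-1).
have -> : D (ser_Y K M G) - (mu - M%:R)%:P * ser_Y K M G =
  D H * ('X^M * G) + H * 'X^M * (D G - mu%:P * G) - (\sum_(j < M.+1) r j) * D Phi.
  rewrite /ser_Y (drvB DD) (drv_sum DD) !(drvM DD) eulerXn.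
  have -> : \sum_(j < M.+1) D ((K j)%:P * 'X^(M - j) * Phi ^+ j) = (mu - M%:R)%:P *
       (\sum_(j < M.+1) (K j)%:P * 'X^(M - j) * Phi ^+ j) + (\sum_(j < M.+1) r j) * D Phi.
    rewrite mulr_sumr mulr_suml -big_split; apply: eq_bigr => j _ /=.
    have jM : (j <= M)%N by rewrite -ltnS; exact: ltn_ord.
    rewrite !(drvM DD) (drvX DD) eulerC eulerXn dK /r polyCM !polyCB -!polyC_natr natrB //; ring.
  by rewrite polyCB -!polyC_natr; ring.
apply: idlB; [apply: idlD; [apply: idlMr|apply: idlMl]|apply: idlMl].
- exact: euler_H.
- exact: euler_Gam.
- exact: euler_Phi.
Qed.

(** [J] has weight 0, so the series keeps the weight mu - M of [ser_Y], and the coefficient of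
    lambda^i weighs i more. *)
Lemma euler_T i : (i < n)%N ->
  d (ser_Y K M G * J)`_i = (mu + i%:R - M%:R) * (ser_Y K M G * J)`_i.
Proof.
move=> lt; have h1 := euler_Y; have h2 := euler_J; set Y := ser_Y K M G in h1 *.
have h : idl n (D (Y * J) - (mu - M%:R)%:P * (Y * J)).
  rewrite (drvM DD) (_ : _ - _ = Y * D J + (D Y - (mu - M%:R)%:P * Y) * J); last by ring.
  by apply: idlD; [apply: idlMl|apply: idlMr].
have := idl_coef h lt; rewrite coefB coef_xd (coef_map_drv dd) coefCM.
by move/(canRL (subrK _)) => ->; ring.
Qed.

End Euler.

Lemma Y_of_T p : idl n (p + H * (p * J)).
Proof.
rewrite (_ : _ + _ = p * (H * J + 1)); last by ring.
by apply: idlMl; exact: HJ.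
Qed.

End SeriesInversion.

(** * Comparison with S^(k) *)

Section Conclusion.
Variables (R : numFieldType) (T : polyAlg R).
Local Notation P := (palg T).
Implicit Types (f g : P) (v : coord).
Local Notation gz := (gz T).
Local Notation gpsi := (gpsi T).
Local Notation gDx := (@gDx R T).
Local Notation gDy := (@gDy R T).

Definition gphi j : P := ser_phi gpsi j.
Definition gZgen (k : int) : P :=
  (gz 0 true + pv T Cy) * ser_f gpsi k 1 + gz 1 false * ser_f gpsi k 2 - ser_f gpsi k 3.
Definition gSk_z (k : int) (a : nat) (b : bool) : P :=
  iter a gDx (if b then gDy (gZgen k) else gZgen k).
Definition gSk_phi (k : int) (j : nat) : P :=
  ser_f gpsi k j + ser_f gpsi k 2 * gDx (gphi j) + ser_f gpsi k 1 * gDy (gphi j).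

Lemma pder_derivation W : derivation (Q := P) (pder W).
Proof. by split=> f g; [exact: raddfD|exact: pder_mul]. Qed.

Definition basicp (p : {poly P}) := forall i, basic p`_i.
Lemma basicpM p q : basicp p -> basicp q -> basicp (p * q).
Proof. exact: basic_polyM. Qed.
Lemma basicpD p q : basicp p -> basicp q -> basicp (p + q).
Proof. exact: basic_polyD. Qed.
Lemma basicpB p q : basicp p -> basicp q -> basicp (p - q).
Proof. exact: basic_polyB. Qed.
Lemma basicpC c : basic c -> basicp c%:P.
Proof. by move=> bc i; rewrite coefC; case: eqP => // _; exact: basic0. Qed.
Lemma basicp1 : basicp 1. Proof. by apply: basicpC; exact: basic1. Qed.
Lemma basicpXn k : basicp 'X^k.
Proof. by move=> i; rewrite coefXn; exact: basic_nat. Qed.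
Lemma basicpX p k : basicp p -> basicp (p ^+ k).
Proof. by move=> h; elim: k => [|k IH]; [exact: basicp1|rewrite exprS; apply: basicpM]. Qed.
Lemma basicp_sum (I : Type) (s : seq I) (a : pred I) (F : I -> {poly P}) :
  (forall i, a i -> basicp (F i)) -> basicp (\sum_(i <- s | a i) F i).
Proof.
move=> h; elim/big_rec: _ => [|i x ai hx]; last by apply: basicpD => //; exact: h.
by move=> i; rewrite coef0; exact: basic0.
Qed.

Lemma basic_gphi j : basic (ser_phi gpsi j).
Proof.
case: j => [|j]; first exact: basic0.
elim/ltn_ind: j => j IH; rewrite (phiE gpsi (leqnn j)); apply: basicN.
rewrite big_seq_cond; apply: basic_sum => i _; apply: basicM; first exact: basic_psi.
have bw : basicp (ser_w gpsi j); last by apply: basicpX.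
apply: basicp_sum => t _; apply: basicpX; apply: basicpB; first exact: basicp1.
apply: basicpD; first exact: basicp1.
by apply: basicp_sum => l _; apply: basicpM; [apply: basicpC; apply: IH|exact: basicpXn].
Qed.

Lemma basicp_Phi N : basicp (ser_Phi gpsi N).
Proof.
apply: basicpD; first exact: basicp1.
by apply: basicp_sum => l _; apply: basicpM; [apply/basicpC/basic_gphi|exact: basicpXn].
Qed.

Lemma basicp_H N : basicp (ser_H gpsi N).
Proof.
apply: basicpD; first by rewrite -polyC1 -polyCN; apply/basicpC/basicN/basic1.
apply: basicp_sum => l _; apply: basicpM; last exact: basicpXn.
by apply/basicpC/basicM; [exact: basic_nat|exact: basic_gphi].
Qed.

Lemma basicp_w N : basicp (ser_w gpsi N).
Proof.
by apply: basicp_sum => t _; apply: basicpX; apply: basicpB; [exact: basicp1|exact: basicp_Phi].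
Qed.

Lemma basicp_nu N : basicp (ser_nu gpsi N).
Proof. by apply: basicpM; [rewrite -['X]expr1; exact: basicpXn|exact: basicp_w]. Qed.

Lemma basicp_J N : basicp (ser_J gpsi N).
Proof.
apply: basicpB; first exact: basicp1.
apply: basicpM; first by apply/basicpX/basicp_w.
apply: basicp_sum => i _; apply: basicpM; last by apply/basicpX/basicp_w.
apply: basicpM; last exact: basicpXn.
apply: basicpM; last by apply/basicpC/basic_psi.
by rewrite -polyC_natr; apply/basicpC/basic_nat.
Qed.

Section Symmetry.
Variables (V : coord -> P) (m : int).
Hypothesis V_x : V Cx = 0.
Hypothesis V_y : V Cy = 0.
Hypothesis VDx : forall q, pder V (gDx_coef T q) = gDx (V q).
Hypothesis VDy : forall q, pder V (gDy_coef T q) = gDy (V q).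
Hypothesis V_wf : forall v, wf (wt v + (m - 1)) (V v).
Local Notation Gam := (Gam V).
Local Notation K := (symKc V).
Local Notation A := (symA V).
Local Notation B := (symB V).
Local Notation C := (symC V).

(** By [char_T] and [Ea_const] the coefficients of T = Y J are constants; by [euler_T] that of
    lambda^i has weight m + i - M, so only i = e remains. Multiplication by [H] recovers - Y. *)
Lemma Tseries_const N M e : M%:Z - m = e%:Z ->
  exists c : R, idl N.+2 (ser_H gpsi N * 'X^M * ser_Gam gpsi N Gam - (c%:A)%:P * 'X^e * ser_H gpsi N
    - \sum_(j < M.+1) (K j)%:P * 'X^(M - j) * ser_Phi gpsi N ^+ j).
Proof.
move=> Me; set G := ser_Gam _ _ _; pose Y := ser_Y gpsi N K M G; pose TT := Y * ser_J gpsi N.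
have KM j : (M < j)%N -> K j = 0 by move=> lt; apply: (Kc0 VDx VDy V_wf); lia.
have [_ rec] := K_recursion VDx VDy.
have bT : basicp TT.
  apply: basicpM; last exact: basicp_J.
  apply: basicpB.
    apply: basicpM; first by apply: basicpM; [exact: basicp_H|exact: basicpXn].
    apply: basicp_sum => l _; apply: basicpM; last by apply/basicpX/basicp_nu.
    by apply/basicpC/basic_Gam.
  apply: basicp_sum => j _; apply: basicpM; last by apply/basicpX/basicp_Phi.
  by apply: basicpM; [apply/basicpC/basic_Kc|exact: basicpXn].
have ET a i : (i < N.+2)%N -> Ea a TT`_i = 0.
  move=> lt; have DE := pder_derivation (fun c => (evc T c)`_a).
  have := @char_T P gpsi erefl N (Ea a) a Gam K M DE.
  rewrite /idl => h; apply: etrans (esym (coef_map_drv DE TT i)) _; apply: h => //.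
  - by move=> l; rewrite Ea_psi eps_coef.
  - move=> l; rewrite (Ea_Gam VDx VDy) -predn_sub -subnS; congr (_ + _).
    by apply: eq_bigr => j _; rewrite eps_coef.
  - by move=> j; have [_ _ ->] := rec a.
have WT i : (i < N.+2)%N -> wf (m + i%:Z - M%:Z) TT`_i.
  move=> lt; have DE := pder_derivation (fun v => (wt v)%:~R * pv T v).
  have := @euler_T P gpsi erefl N (@Wt R T) Gam K M m%:~R DE.
  rewrite /wf => h; rewrite h //.
  - by rewrite !rmorphB rmorphD.
  - by move=> j; rewrite (wf_psi T j) -natr1 rmorphD.
  - by move=> j; rewrite (wf_Gam VDx VDy V_wf) rmorphD.
  - by move=> j; rewrite (wf_Kc VDx VDy V_wf) rmorphB.
have [c cE] : exists c : R, idl N.+2 (TT - (c%:A)%:P * 'X^e).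
  have z i : (i < N.+2)%N -> i != e -> TT`_i = 0.
    move=> lt ne; apply: (@const_wf0 _ _ _ (m + i%:Z - M%:Z)) => //; first by lia.
    - by move=> a; apply: ET.
    - exact: WT.
  have [lt|ge] := ltnP e N.+2.
    have [c ec] := Ea_const (bT e) (fun a => ET a e lt).
    exists c => i li; rewrite coefB coefCM coefXn; have [->|ne] := eqVneq i e.
      by rewrite mulr1 ec subrr.
    by rewrite mulr0 subr0 z.
  (* The surviving power lies beyond the truncation, where no constant is visible. *)
  exists 0 => i li; rewrite scale0r polyC0 mul0r subr0 z //; lia.
exists (- c); have h := @Y_of_T P gpsi erefl N Y; rewrite -/TT in h.
have -> : ser_H gpsi N * 'X^M * G - ((- c)%:A)%:P * 'X^e * ser_H gpsi N
    - \sum_(j < M.+1) (K j)%:P * 'X^(M - j) * ser_Phi gpsi N ^+ j =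
   (Y + ser_H gpsi N * TT) - ser_H gpsi N * (TT - (c%:A)%:P * 'X^e).
  rewrite scaleNr polyCN /Y /ser_Y; move: (\sum_(j < M.+1) _) => S; ring.
by apply: idlB => //; apply: idlMl.
Qed.

Lemma Tv_phi N i : (i < N)%N -> Tv V (gphi i.+1) = (ser_H gpsi N * ser_Gam gpsi N Gam)`_i.+1.
Proof.
by move=> lt; apply: (@vertical_phi P gpsi erefl N (Tv V) Gam (pder_derivation _)).
Qed.

Lemma Tv_phi0 N : (ser_H gpsi N * ser_Gam gpsi N Gam)`_0 = 0.
Proof.
have h : idl 1 (ser_H gpsi N * ser_Gam gpsi N Gam).
  apply: idlMl; apply: idl_sum => l _; apply: idlMl; apply: (idl_le _ (@nu_idl _ _ _ _)).
  by [].
exact: h.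
Qed.

Lemma coef0_Phi N j : (ser_Phi gpsi N ^+ j)`_0 = 1.
Proof.
have := idl_coef (@idl_subX _ _ _ _ j (@Phi_idl _ gpsi N)) (isT : 0 < 2)%N.
by rewrite expr1n coef1.
Qed.

Lemma coef0_H N : (ser_H gpsi N)`_0 = -1.
Proof. by rewrite /ser_H coefD coefN coef1 (coef_tail2 _ (fun j => j.+1%:R * gphi j.+1)) addr0. Qed.

Lemma H_prefix N l : (l < N.+2)%N -> (ser_H gpsi N)`_l = (ser_H gpsi l)`_l.
Proof.
by move=> lt; rewrite /ser_H !coefD !(coef_tail2 _ (fun j => j.+1%:R * gphi j.+1)) lt !ltnS leqnSn.
Qed.

Lemma size_cs l N t : size (ser_cs gpsi l N t) = t.+1.
Proof. by elim: t => //= t IH; rewrite size_rcons IH. Qed.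

(** V' phi has no term lambda^i with i <= 0. This determines the K_j by the recursion that [ser_cs]
    computes, so that - K_j is c times the coefficient of phi^j there. *)
Lemma Tv_phi_nneg M : m = M%:Z -> exists c : R, forall i, (0 < i)%N ->
  Tv V (gphi i) = c%:A * ser_f gpsi (m - 1) i.
Proof.
move=> mM; have Me : M%:Z - m = 0%N%:Z by rewrite mM subrr.
pose rel N (c : R) := forall l, (l < N.+2)%N ->
  ('X^M * (ser_H gpsi N * ser_Gam gpsi N Gam))`_l = c%:A * (ser_H gpsi N)`_l +
   \sum_(s < M.+1) K (M - s) * ('X^s * ser_Phi gpsi N ^+ (M - s))`_l.
have relP N : exists c, rel N c.
  have [c h] := Tseries_const N Me; exists c => l lt.
  have := h l lt; rewrite expr0 mulr1 !coefB coefCM coef_sum (reindex_inj rev_ord_inj) /=.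
  move/eqP; rewrite subr_eq add0r subr_eq => /eqP e.
  rewrite mulrA ['X^M * _]mulrC e addrC; congr (_ + _); apply: eq_bigr => s _.
  have le : (s <= M)%N by rewrite -ltnS; exact: ltn_ord.
  by rewrite -mulrA coefCM subSS (subKn le).
have top N c t : (M <= N)%N -> rel N c -> (t <= M)%N ->
    c%:A * (ser_H gpsi N)`_t + \sum_(s < t) K (M - s) * ('X^s * ser_Phi gpsi N ^+ (M - s))`_t = - K (M - t).
  move=> MN h tM; have := h t (_ : t < N.+2)%N; rewrite coefXnM.
  have -> : (if (t < M)%N then 0 else (ser_H gpsi N * ser_Gam gpsi N Gam)`_(t - M)) = 0.
    by case: ltnP => // ge; rewrite (_ : t - M = 0)%N ?Tv_phi0 //; lia.
  move=> /(_ ltac:(lia)) e; apply/eqP; rewrite -addr_eq0 [X in _ == X]e; apply/eqP; rewrite -!addrA; congr (_ + _).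
  rewrite -(big_mkord xpredT (fun s => K (M - s) * ('X^s * ser_Phi gpsi N ^+ (M - s))`_t)).
  rewrite -[in RHS](big_mkord xpredT (fun s => K (M - s) * ('X^s * ser_Phi gpsi N ^+ (M - s))`_t)).
  rewrite [RHS](big_cat_nat (n := t)) //=; last by lia.
  congr (_ + _); rewrite big_ltn; last by lia.
  rewrite coefXnM ltnn subnn coef0_Phi mulr1 big_nat_cond big1 ?addr0 // => s /andP[/andP[ts _] _].
  by rewrite coefXnM ts mulr0.
have [c0 r0] := relP M.
(* Each truncation comes with its own constant; all of them equal K_M. *)
have cK N c : (M <= N)%N -> rel N c -> c%:A = K M.
  by move=> MN h; have := top N c 0%N MN h (leq0n _); rewrite big_ord0 addr0 coef0_H mulrN1 subn0 => /oppr_inj.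
have csK N c t : (M <= N)%N -> rel N c -> (t <= M)%N ->
    forall s, (s <= t)%N -> c%:A * (ser_cs gpsi M N t)`_s = - K (M - s).
  move=> MN h; elim: t => [|t IH] tM s.
    rewrite leqn0 => /eqP -> /=; have := top N c 0%N MN h (leq0n _).
    by rewrite big_ord0 addr0.
  have {}IH := IH (ltnW tM).
  rewrite leq_eqVlt ltnS [ser_cs _ _ _ _]/= nth_rcons size_cs => /orP[/eqP->|st]; last by rewrite ltnS st IH.
  rewrite ltnn eqxx -(top N c t.+1) // coefB mulrBr; congr (_ + _).
  rewrite /ser_acc size_cs coef_sum mulr_sumr -sumrN; apply: eq_bigr => r _.
  rewrite -mulrA coefCM mulrA IH ?mulNr ?opprK // -ltnS; exact: ltn_ord.
exists c0 => i i0; have [c rc] := relP (M + i)%N.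
rewrite (cK M c0) // -(cK (M + i)%N c) ?leq_addr // /ser_f subrK mM.
have := rc (M + i)%N; rewrite ltnS ltnW // => /(_ isT).
rewrite coefXnM ltnNge leq_addr addKn /= => e.
have -> : Tv V (gphi i) = (ser_H gpsi (M + i) * ser_Gam gpsi (M + i) Gam)`_i.
  by case: i i0 {rc e} => // i _; apply: Tv_phi; lia.
rewrite e coefB mulrBr; congr (_ + _).
rewrite /ser_acc size_cs coef_sum mulr_sumr -sumrN; apply: eq_bigr => s _.
rewrite -mulrA coefCM mulrA (csK _ _ M) ?leq_addr // ?mulNr ?opprK // -ltnS; exact: ltn_ord.
Qed.

Lemma Tv_phi_neg M : m = - M.+1%:Z -> exists c : R, forall i, (0 < i)%N ->
  Tv V (gphi i) = c%:A * ser_f gpsi (m - 1) i.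
Proof.
move=> mM; have Me : 0%N%:Z - m = M.+1%:Z by rewrite mM; lia.
pose rel N (c : R) := forall l, (l < N.+2)%N ->
  (ser_H gpsi N * ser_Gam gpsi N Gam)`_l = c%:A * ('X^(M.+1) * ser_H gpsi N)`_l.
have relP N : exists c, rel N c.
  have [c h] := Tseries_const N Me; exists c => l lt.
  have K0 : K 0 = 0 by apply: (Kc0 VDx VDy V_wf); rewrite mM; lia.
  have := h l lt; rewrite expr0 mulr1 big_ord1 K0 polyC0 !mul0r subr0.
  by rewrite coefB -mulrA coefCM => /eqP; rewrite subr_eq0 => /eqP.
have Tv_rel N c i : rel N c -> (0 < i <= N)%N -> Tv V (gphi i) = c%:A * ('X^(M.+1) * ser_H gpsi N)`_i.
  by move=> h; case: i => // i lt; rewrite (Tv_phi lt) h //; lia.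
(* The coefficient of lambda^(M+1) determines c, so the constant is the same for all sufficiently
   long truncations. *)
have cE N c : (M < N)%N -> rel N c -> c%:A = - Tv V (gphi M.+1).
  by move=> lt h; rewrite (Tv_rel _ _ _ h) // coefXnM ltnn subnn coef0_H mulrN1 opprK.
have [c0 r0] := relP M.+1; exists c0 => i i0.
rewrite /ser_f subrK mM /=; have [c rc] := relP i.
rewrite (Tv_rel _ _ _ rc) ?i0 ?leqnn // coefXnM ltnNge; case: (ltnP M i) => h /=; last by rewrite !mulr0.
rewrite (cE i c) // (cE M.+1 c0) // H_prefix //; lia.
Qed.

Lemma Tv_phi_scaled : exists c : R, forall i, (0 < i)%N ->
  Tv V (gphi i) = c%:A * ser_f gpsi (m - 1) i.
Proof. by case: (intP m) Tv_phi_nneg Tv_phi_neg => [|n|n] h1 h2; [exact: (h1 0%N)|exact: h1|exact: h2]. Qed.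

Lemma gphi1 : gphi 1 = - pv T Cy.
Proof.
rewrite /gphi (phiE gpsi (leqnn 0)) big_nat1 expr1 /ser_w !big_ord_recl big_ord0.
by rewrite /ser_Phi big_ord0 addr0 subrr expr0 expr1 !addr0 coef1 mulr1.
Qed.

Lemma coef_w N i : (i < 3)%N -> (ser_w gpsi N.+1)`_i = (1 - ('X^2 * (gphi 1)%:P))`_i.
Proof.
move=> lt; pose q : {poly P} := 1 - 'X^2 * (gphi 1)%:P.
have h1 : idl 3 (ser_Phi gpsi N.+1 * ser_w gpsi N.+1 - 1) by apply: (idl_le _ (@Phi_w _ gpsi N.+1)).
have h2 : idl 3 (ser_Phi gpsi N.+1 - ser_Phi gpsi 1) by apply: (@Phi_prefix _ gpsi 1 N.+1).
have e1 : ser_Phi gpsi 1 = 1 + (gphi 1)%:P * 'X^2 by rewrite /ser_Phi big_ord1.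
have h3 : idl 3 ('X^2 * 'X^2 * ((gphi 1)%:P ^+ 2) : {poly P}).
  by rewrite -exprD; apply: idlMr; apply: (idl_le _ (@idl_X _ 4)).
apply: (idl_coef (n := 3)) => //; rewrite -/q.
rewrite (_ : _ - q = q * (ser_Phi gpsi N.+1 * ser_w gpsi N.+1 - 1)
  - q * ser_w gpsi N.+1 * (ser_Phi gpsi N.+1 - ser_Phi gpsi 1) + ('X^2 * 'X^2 * ((gphi 1)%:P ^+ 2)) * ser_w gpsi N.+1).
  by apply: idlD; [apply: idlB; apply: idlMl|apply: idlMr].
rewrite e1 /q; move: (ser_w _ _) (ser_Phi _ _) 'X^2 (gphi 1)%:P => x1 x2 x3 x4; ring.
Qed.

Lemma coef0_wX N i : (ser_w gpsi N.+1 ^+ i)`_0 = 1.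
Proof.
elim: i => [|i IH]; first by rewrite coef1.
by rewrite exprS coef0M IH coef_w // coefB coef1 coefXnM subr0 mulr1.
Qed.

Lemma coef1_wX N i : (ser_w gpsi N.+1 ^+ i)`_1 = 0.
Proof.
elim: i => [|i IH]; first by rewrite coef1.
rewrite exprS coefM !big_ord_recl big_ord0 IH mulr0 addr0 add0r.
by rewrite coef_w // coefB coef1 coefXnM subr0 mul0r.
Qed.

Lemma gphi2 : gphi 2 = - pv T Cx.
Proof.
have e (F : nat -> P) : \sum_(1 <= i < 3) F i = F 1%N + F 2%N by rewrite big_nat_recr // big_nat1.
rewrite /gphi (phiE gpsi (leqnn 1)) e [X in _ * X + _](coef1_wX 0 1) [X in _ + _ * X](coef0_wX 0 2).
by rewrite mulr0 add0r mulr1.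
Qed.

Lemma gphi3 : gphi 3 = - gz 0 false - 2^-1 *: pv T Cy ^+ 2.
Proof.
have e (F : nat -> P) : \sum_(1 <= i < 4) F i = F 1%N + F 2%N + F 3%N.
  by rewrite big_nat_recr // big_nat_recr // big_nat1.
rewrite /gphi (phiE gpsi (leqnn 2)) e [X in _ + _ * X + _](coef1_wX 1 2).
rewrite mulr0 addr0 [X in _ + _ * X](coef0_wX 1 3).
rewrite [ser_w _ _ ^+ 1]expr1 [X in _ * X + _](@coef_w 1 2 isT) coefB coef1 coefXnM coefC /= gphi1.
have h : pv T Cy * pv T Cy = 2^-1 *: pv T Cy ^+ 2 + 2^-1 *: pv T Cy ^+ 2.
  by rewrite -scalerDl -[2^-1]mul1r -splitr scale1r.
rewrite sub0r opprK h [gpsi 3%N](erefl (gz 0 false - 2^-1 *: pv T Cy ^+ 2)); move: (2^-1 *: _) => t; ring.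
Qed.

Lemma pder_gphi j : pder V (gphi j) = Tv V (gphi j) + B * gDx (gphi j) + A * gDy (gphi j).
Proof. by rewrite TvE; ring. Qed.

(** As V has no x and y components, V' x = - B, V' y = - A and V' z = C, so phi^(1), phi^(2),
    phi^(3) recover A, B, C. On each phi^(j) the terms B Dx + A Dy are then added back to V'. *)
Lemma symmetry_is_scaled : exists c : R,
  (forall a b, V (Cz a b) = c *: gSk_z (m - 1) a b) /\
  (forall j, (0 < j)%N -> pder V (gphi j) = c *: gSk_phi (m - 1) j).
Proof.
have [c h] := Tv_phi_scaled; exists c.
have eA : c%:A * ser_f gpsi (m - 1) 1 = A.
  rewrite -h // gphi1 raddfN /= TvE /gDx /gDy !pder_var V_y /=; ring.
have eB : c%:A * ser_f gpsi (m - 1) 2 = B.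
  rewrite -h // gphi2 raddfN /= TvE /gDx /gDy !pder_var V_x /=; ring.
(* Here phi^(3) = - z - y^2/2. *)
have eC : c%:A * ser_f gpsi (m - 1) 3 = pv T Cy * A - C.
  rewrite -h // gphi3 raddfB /= linearZ raddfN /=.
  have -> : Tv V (pv T Cy ^+ 2) = 2%:R * pv T Cy ^+ 1 * Tv V (pv T Cy) by exact: (drvX (pder_derivation _)).
  have -> : Tv V (pv T Cy) = - A by rewrite TvE /gDx /gDy !pder_var V_y /=; ring.
  have -> : Tv V (gz 0 false) = C.
    by rewrite TvE /gDx /gDy !pder_var Z_ABC /=; move: (symA V) (symB V) (symC V) => x1 x2 x3; ring.
  rewrite expr1 -mulrA mulr_natl -scaler_nat scalerA mulVf ?pnatr_eq0 // scale1r; ring.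
have eZ : V (Cz 0 false) = c *: gZgen (m - 1).
  rewrite -[c *: _]mulr_algl /gZgen mulrBr mulrDr !(mulrCA c%:A) eA eB eC Z_ABC.
  move: (symA V) (symB V) (symC V) => x1 x2 x3; ring.
split=> [a b|j j0].
  elim: a => [|a IH].
    by rewrite /gSk_z /=; case: b => //; rewrite -[LHS](pder_var V (Cz 0 true)) (VDy (Cz 0 false)) eZ linearZ.
  by rewrite -[LHS](pder_var V (Cz a.+1 b)) (VDx (Cz a b)) IH linearZ.
rewrite pder_gphi h // -eA -eB -[RHS]mulr_algl /gSk_phi; ring.
Qed.

End Symmetry.
End Conclusion.

(** * The monoid algebra as polynomial ring *)

Section Bilinear.
Variable A : comNzRingType.
Implicit Types (a b c x y u : A).

Lemma leibniz_sum (D : {additive A -> A}) (I J : Type) (r : seq I) (s : seq J) (f : I -> A) (g : J -> A) :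
  (forall i j, D (f i * g j) = f i * D (g j) + D (f i) * g j) ->
  D ((\sum_(i <- r) f i) * (\sum_(j <- s) g j)) =
  (\sum_(i <- r) f i) * D (\sum_(j <- s) g j) + D (\sum_(i <- r) f i) * (\sum_(j <- s) g j).
Proof.
move=> h; rewrite !raddf_sum !mulr_suml -big_split raddf_sum; apply: eq_bigr => i _ /=.
by rewrite !mulr_sumr -big_split raddf_sum; apply: eq_bigr => j _ /=.
Qed.

Lemma mul_sum_lr (I : Type) (r : seq I) a b (f g u : I -> A) :
  a * (\sum_(i <- r) f i * u i) + (\sum_(i <- r) g i * u i) * b =
  \sum_(i <- r) (a * f i + g i * b) * u i.
Proof. by rewrite mulr_sumr mulr_suml -big_split; apply: eq_bigr => i _ /=; ring. Qed.

End Bilinear.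

Section Concrete.
Variable R : fieldType.
Local Notation P := {malg R[{cmonom coord}]}.
Implicit Types (f g : P) (V : coord -> P) (v : coord).

Definition dermon (V : coord -> P) (m : {cmonom coord}) : P :=
  \sum_(v <- finsupp m) << (m v)%:R *g divcm m (ucm v) >> * V v.

Lemma derE V f : der V f = mmap malgC (dermon V) f.
Proof.
rewrite /der mmapE; apply: eq_bigr => m _; rewrite [RHS]mulr_sumr; apply: eq_bigr => v _.
by rewrite [RHS]mulrA; congr (_ * _); rewrite [RHS]malgM_def fgmulUU mul1m.
Qed.

Lemma derU V (c : R) m : der V << c *g m >> = c%:MP * dermon V m.
Proof. by rewrite derE mmapU. Qed.

Lemma der_is_additive V : zmod_morphism (der V).
Proof. by move=> f g; rewrite !derE raddfB. Qed.
HB.instance Definition _ V := GRing.isZmodMorphism.Build P P (der V) (der_is_additive V).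

Lemma dermonEw V (d : {fset coord}) (m : {cmonom coord}) : (finsupp m `<=` d)%fset ->
  dermon V m = \sum_(v <- d) << (m v)%:R *g divcm m (ucm v) >> * V v.
Proof.
move=> le; rewrite /dermon (big_fset_incl _ le) // => v _.
by rewrite -cmE_eq0 => /eqP->; rewrite monalgU0 mul0r.
Qed.

Lemma malgUM (c1 c2 : R) (m1 m2 : {cmonom coord}) :
  << c1 *g m1 >> * << c2 *g m2 >> = << c1 * c2 *g mmul m1 m2 >> :> P.
Proof. by rewrite malgM_def fgmulUU. Qed.

(** [divcm] truncates exponents at 0, so the two monomials can differ when b v = 0; the coefficient
    is then 0. *)
Lemma divcmUM (a b : {cmonom coord}) v :
  << (b v)%:R *g divcm (mmul a b) (ucm v) >> = << a >> * << (b v)%:R *g divcm b (ucm v) >> :> P.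
Proof.
rewrite [RHS]malgUM mul1r; have [->|n0] := eqVneq (b v) 0%N.
  by rewrite [LHS]monalgU0 [RHS]monalgU0.
have -> : divcm (mmul a b) (ucm v) = mmul a (divcm b (ucm v)); last reflexivity.
apply/eqP/cmP => w; rewrite !(divcmE, cmM) addnBA //.
rewrite -[X in (X <= _)%N]/(ucm v w) ucmE.
by case: eqP => // <-; rewrite lt0n.
Qed.

Lemma dermonM V m1 m2 :
  dermon V (mmul m1 m2) = << m1 >> * dermon V m2 + dermon V m1 * << m2 >>.
Proof.
have s12 : (finsupp (mmul m1 m2) `<=` finsupp m1 `|` finsupp m2)%fset.
  by rewrite mdomD fsubset_refl.
rewrite (dermonEw _ s12) (@dermonEw V (finsupp m1 `|` finsupp m2)%fset m1 (fsubsetUl _ _)).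
rewrite (@dermonEw V (finsupp m1 `|` finsupp m2)%fset m2 (fsubsetUr _ _)).
apply: (etrans _ (esym (@mul_sum_lr P _ _ _ _ _ _ _))).
apply: eq_bigr => v _; congr (_ * _); rewrite cmM natrD monalgUD [LHS]addrC.
congr (_ + _); first exact: divcmUM.
apply: (etrans _ (@mulrC P _ _)).
rewrite [mmul m1 m2]mulmC; exact: divcmUM.
Qed.

Lemma der_mulU V (c1 c2 : R) m1 m2 : der V (<< c1 *g m1 >> * << c2 *g m2 >>) =
  << c1 *g m1 >> * der V << c2 *g m2 >> + der V << c1 *g m1 >> * << c2 *g m2 >>.
Proof.
have aux (c : R) m : << c *g m >> = c%:MP * << m >> :> P by rewrite [RHS]malgUM mulr1 mul1m.
have gen (A : comNzRingType) (x1 x2 y1 y2 d1 d2 : A) :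
  (x1 * x2) * (y1 * d2 + d1 * y2) = (x1 * y1) * (x2 * d2) + (x1 * d1) * (x2 * y2) by ring.
apply: (etrans (congr1 (der V) (malgUM c1 c2 m1 m2))).
apply: (etrans (derU V _ _)).
apply: (etrans (congr2 *%R (rmorphM (@malgC {cmonom coord} R) c1 c2) (dermonM V m1 m2))).
apply: (etrans (gen P _ _ _ _ _ _)).
exact: (congr2 +%R (congr2 *%R (esym (aux c1 m1)) (esym (derU V c2 m2)))
  (congr2 *%R (esym (derU V c1 m1)) (esym (aux c2 m2)))).
Qed.

Lemma der_mul V f g : der V (f * g) = f * der V g + der V f * g.
Proof.
rewrite [f]monalgE [g]monalgE; apply: (@leibniz_sum P (der V)) => m1 m2.
exact: der_mulU.
Qed.

Lemma derZ V (c : R) f : der V (c *: f) = c *: der V f.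
Proof.
rewrite -![c *: _]mul_malgC der_mul derU /dermon mdom1 big_seq_fset0.
by rewrite [_ * 0]mulr0 [0 * _]mul0r [LHS]addr0.
Qed.

Lemma der_var V v : der V (var R v) = V v.
Proof.
rewrite /var derU /dermon mdomU big_seq_fset1 [LHS]mul1r ucmE eqxx.
have -> : divcm (ucm v) (ucm v) = mone by apply/eqP/cmP => w; rewrite divcmE subnn cm1.
exact: mul1r.
Qed.

Lemma malg_ind (Q : P -> Prop) : (forall c, Q c%:MP) ->
  (forall f g, Q f -> Q g -> Q (f + g)) -> (forall f v, Q f -> Q (f * var R v)) ->
  forall f, Q f.
Proof.
move=> QC QD QV f; rewrite [f]monalgE.
elim/big_rec: _ => [|m g _ Qg]; first by rewrite -malgC0E.
apply: QD => {g Qg} //; move: (f@_m) => c.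
have [n le] := ubnP (mdeg m); elim: n m le => // n IH m le.
have [e|[v vm]] := fset_0Vmem (finsupp m).
  have -> : m = mone; last exact: QC.
  apply/eqP/cmP => v; rewrite cm1; by apply/eqP; rewrite cmE_eq0 e in_fset0.
have {vm} : m v != 0%N by rewrite cmE_neq0.
move=> vm.
have em : m = mmul (divcm m (ucm v)) (ucm v).
  apply/eqP/cmP => w; rewrite cmM divcmE subnK // ucmE.
  by case: eqP => // <-; rewrite lt0n.
rewrite em -[c]mulr1 -malgUM; apply: QV; apply: IH.
by move: le; rewrite {1}em mdegM mdegU addn1 ltnS.
Qed.

Definition cmeval (h : coord -> P) (m : {cmonom coord}) : P :=
  \prod_(v <- finsupp m) h v ^+ m v.

Lemma cmevalEw h (d : {fset coord}) (m : {cmonom coord}) : (finsupp m `<=` d)%fset ->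
  cmeval h m = \prod_(v <- d) h v ^+ m v.
Proof.
move=> le; rewrite /cmeval (big_fset_incl _ le) // => v _.
by rewrite -cmE_eq0 => /eqP->; rewrite expr0.
Qed.

Lemma cmeval_mmorphism h : mmorphism (cmeval h).
Proof.
split=> [m1 m2|]; last by rewrite /cmeval mdom1 big_seq_fset0.
have s12 : (finsupp (mmul m1 m2) `<=` finsupp m1 `|` finsupp m2)%fset.
  by rewrite mdomD fsubset_refl.
rewrite (cmevalEw _ s12) (@cmevalEw h (finsupp m1 `|` finsupp m2)%fset m1 (fsubsetUl _ _)).
rewrite (@cmevalEw h (finsupp m1 `|` finsupp m2)%fset m2 (fsubsetUr _ _)).
by rewrite -big_split /=; apply: eq_bigr => v _; rewrite cmM exprD.
Qed.
HB.instance Definition _ h := isMultiplicative.Build _ _ (cmeval h) (cmeval_mmorphism h).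

Definition subst (h : coord -> P) : P -> P := mmap malgC (cmeval h).
HB.instance Definition _ h := GRing.RMorphism.on (subst h).

Lemma subst_var h v : subst h (var R v) = h v.
Proof. by rewrite /subst mmapU /cmeval mdomU big_seq_fset1 [LHS]mul1r [ucm v v]ucmE eqxx expr1. Qed.

Lemma substZ h (c : R) f : subst h (c *: f) = c *: subst h f.
Proof. by rewrite -![c *: _]mul_malgC rmorphM /=; congr (_ * _); rewrite /subst mmapC. Qed.

Lemma der_linear V : linear (der V).
Proof. by move=> c f g; rewrite raddfD /= derZ. Qed.

Lemma subst_linear h : linear (subst h).
Proof. by move=> c f g; rewrite rmorphD /= substZ. Qed.

Lemma subst_monoid h : monoid_morphism (subst h).
Proof. by split=> [|f g]; [exact: rmorph1|exact: rmorphM]. Qed.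

Lemma malgA_ind (Q : P -> Prop) : (forall c : R, Q c%:A) ->
  (forall f g, Q f -> Q g -> Q (f + g)) -> (forall f v, Q f -> Q (f * var R v)) ->
  forall f, Q f.
Proof.
move=> QC; apply: malg_ind => c; have := QC c; rewrite -[c *: _]mul_malgC.
by rewrite (_ : c%:MP * 1 = c%:MP) //; exact: mulr1.
Qed.

Definition malgAlg : polyAlg R :=
  @PolyAlg R P (@var R) (@der R) subst der_linear der_mul der_var subst_linear subst_monoid
    subst_var malgA_ind.

End Concrete.

(** * Agreement with the definitions of the statement, and weights of monomials *)

Section Transfer.
Variable R : numFieldType.
Local Notation P := {malg R[{cmonom coord}]}.
Local Notation T := (malgAlg R).

Lemma gDx_coef_malg n : gDx_coef T n = Dx_coef R n.
Proof. case: n; reflexivity. Qed.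
Lemma gDy_coef_malg n : gDy_coef T n = Dy_coef R n.
Proof. reflexivity. Qed.
Lemma H_malg N : ser_H (gpsi T) N = HN R N.
Proof. reflexivity. Qed.
Lemma acc_malg m N l : ser_acc (gpsi T) m N l = accN m N l.
Proof. reflexivity. Qed.
Lemma cs_malg m N t : ser_cs (gpsi T) m N t = csN R m N t.
Proof.
elim: t => [|t IH]; first by rewrite /ser_cs /csN H_malg.
rewrite -[LHS]/(let l := ser_cs (gpsi T) m N t in rcons l ((ser_H (gpsi T) N - ser_acc (gpsi T) m N l)`_t.+1)).
rewrite IH; reflexivity.
Qed.
Lemma f_malg k n : ser_f (gpsi T) k n = fcoef R k n.
Proof.
rewrite /ser_f /fcoef; case: (k + 1) => [m|d]; last by rewrite H_malg.
by rewrite /= cs_malg H_malg acc_malg.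
Qed.
Lemma Zgen_malg k : gZgen T k = Zgen R k.
Proof. by rewrite /gZgen /Zgen !f_malg. Qed.
Lemma Sk_z_malg k a b : gSk_z T k a b = Sk_z R k a b.
Proof. by rewrite /gSk_z /Sk_z Zgen_malg. Qed.
Lemma Sk_phi_malg k j : gSk_phi T k j = Sk_phi R k j.
Proof. by rewrite /gSk_phi /Sk_phi !f_malg. Qed.

Lemma intr_sum_mul (A : comNzRingType) (I : Type) (r : seq I) (z : I -> int) (x : A) :
  (\sum_(i <- r) z i)%:~R * x = \sum_(i <- r) (z i)%:~R * x.
Proof. by rewrite rmorph_sum mulr_suml. Qed.

Lemma intr_nat_mul (A : comNzRingType) (a b x : A) (n : nat) (z : int) :
  a * b = n%:R * x -> a * (z%:~R * b) = (n%:Z * z)%:~R * x.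
Proof. by move=> e; rewrite mulrCA e intrM; ring. Qed.

Lemma mul_intr_swap (A : comNzRingType) (c w x : A) : c * (w * x) = w * (c * x).
Proof. exact: mulrCA. Qed.

Lemma malgUE (c : R) (m : {cmonom coord}) : << c *g m >> = c%:MP * << m >> :> P.
Proof. by rewrite [RHS]malgUM mulr1 mul1m. Qed.

Lemma dermon_euler (m : {cmonom coord}) :
  dermon (fun v => (wt v)%:~R * var R v) m = (mwt m)%:~R * << m >>.
Proof.
apply: (etrans _ (esym (@intr_sum_mul P _ _ _ _))).
apply: eq_big_seq => v vm; apply: (@intr_nat_mul P).
apply: (etrans (malgUM _ _ _ _)); rewrite mulr1.
have -> : mmul (divcm m (ucm v)) (ucm v) = m.
  apply/eqP/cmP => w; rewrite cmM divcmE subnK // ucmE.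
  by case: eqP => // <-; rewrite lt0n cmE_neq0.
apply: (etrans (malgUE _ _)); congr (_ * _).
exact: rmorph_nat.
Qed.

Lemma homogeneous_wf w (p : P) : homogeneous w p -> wf (T := T) w p.
Proof.
move=> h; rewrite /wf -[LHS]/(der (fun v => (wt v)%:~R * var R v) p) derE mmapE.
rewrite [in RHS](monalgE p); apply: (etrans _ (esym (@mulr_sumr P _ _ _ _ _))).
apply: eq_big_seq => m mp; rewrite dermon_euler (h m mp) [in RHS](malgUE p@_m m).
exact: (@mul_intr_swap P).
Qed.

End Transfer.

Unset Implicit Arguments.

Theorem mainTheorem3 (R : realType) (k : int)
    (V : coord -> {malg R[{cmonom coord}]}) :
  -4 <= k ->
  nonlocal_symmetry V ->
  vf_homogeneous k V ->
  exists c : R, is_scaled_Sk c k V.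
Proof.
move=> _ [V_x V_y VDx VDy] Vh; pose T := malgAlg R.
(* The weight parameter m of [symmetry_is_scaled] is k + 1. *)
have ek : k + 1 - 1 = k by rewrite addrK.
have V_wf v : wf (T := T) (wt v + (k + 1 - 1)) (V v).
  by rewrite ek; apply: homogeneous_wf; apply: Vh.
have hx q : pder (p := T) V (gDx_coef T q) = gDx (T := T) (V q).
  by rewrite gDx_coef_malg; exact: VDx.
have hy q : pder (p := T) V (gDy_coef T q) = gDy (T := T) (V q).
  by rewrite gDy_coef_malg; exact: VDy.
have [c [hz hphi]] := @symmetry_is_scaled R T V (k + 1) V_x V_y hx hy V_wf.
exists c; split; [exact: V_x|exact: V_y| |] => [a b|j j4].
  by rewrite -Sk_z_malg -{1}ek; exact: hz.
rewrite -Sk_phi_malg -{1}ek; apply: (hphi j); exact: leq_trans j4.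
Qed.
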